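(* Consider the defining equations of an SV model with Gamma-type log-volatility: $X_t=\sigma_t\varepsilon_t$ and $\log\sigma_t=\sum_{i=0}^\infty\alpha_i\eta_{t-i}$, $t\in\mathbb{Z}$, under the assumptions on $(\varepsilon_t)$, $(\eta_t)$ and $(\alpha_i)$ listed in the context. There exists a stationary solution $(X_t,\sigma_t)_{t\in\mathbb{Z}}$ to these equations, and the marginal distributions of $|X_0|$ and $\sigma_0$ are regularly varying with index $-1$. Furthermore, the distribution of $X_0$ is tail balanced with $$\lim_{x\to\infty}\frac{P(X_0>x)}{P(|X_0|>x)}=\frac{E(\varepsilon_0^+)}{E(|\varepsilon_0|)},\qquad\lim_{x\to\infty}\frac{P(X_0<-x)}{P(|X_0|>x)}=\frac{E(\varepsilon_0^-)}{E(|\varepsilon_0|)},$$ and $$\lim_{x\to\infty}\frac{P(|X_0|>x)}{P(\sigma_0>x)}=E(|\varepsilon_0|),\qquad\lim_{x\to\infty}\frac{P(X_0>x)}{P(\sigma_0>x)}=E(\varepsilon_0^+).$$ For the normalizing constants $a_n:=\hat K\,n(\log n)^{\hat\beta}$ (with $\hat K,\hat\beta$ as defined in the context) and every $z>0$ we have, as $n\to\infty$, $$P(\sigma_0\le a_nz)^n\to\exp(-1/z),\quad P(|X_0|\le a_nz)^n\to\exp\bigl(-E(|\varepsilon_0|)/z\bigr),\quad P(X_0\le a_nz)^n\to\exp\bigl(-E(\varepsilon_0^+)/z\bigr).$$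
   Context: Assumptions of the SV model with Gamma-type log-volatility: $\varepsilon_t$, $t\in\mathbb{Z}$, are i.i.d. with $P(\varepsilon_0>0)>0$ and $E(|\varepsilon_0|^{1+\delta})<\infty$ for some $\delta>0$; (a) the coefficients $\alpha_i\in[0,1]$, $i\in\mathbb{N}_0$, satisfy $\max_{i\in\mathbb{N}_0}\alpha_i=1$ and $\alpha_i=O(i^{-\theta})$ as $i\to\infty$ for some $\theta>1$; (b) $\eta_t$, $t\in\mathbb{Z}$, are i.i.d., independent of $(\varepsilon_t)_{t\in\mathbb{Z}}$, with $E(\eta_0^2)<\infty$ and $P(\eta_0>z)\sim Kz^\beta e^{-z}$ as $z\to\infty$, for a real constant $\beta\ne-1$ and a constant $K>0$ ($f\sim g$ means $f/g\to1$). Notation: $x^+=\max\{x,0\}$, $x^-=-\min\{x,0\}$. Let $\Lambda:=\{n\in\mathbb{N}_0:\alpha_n=1\}$ and $k:=|\Lambda|$ (which is finite). Define $\hat\beta:=k\beta+k-1$ if $\beta>-1$ and $\hat\beta:=\beta$ if $\beta<-1$; and $$\hat K:=K^k\frac{\Gamma(\beta+1)^k}{\Gamma(k(\beta+1))}E\Bigl(\exp\Bigl(\sum_{n\notin\Lambda}\alpha_n\eta_n\Bigr)\Bigr)\ \text{ if }\beta>-1,\qquad\hat K:=kK\,E(\exp(\eta_0))^{k-1}E\Bigl(\exp\Bigl(\sum_{n\notin\Lambda}\alpha_n\eta_n\Bigr)\Bigr)\ \text{ if }\beta<-1.$$ A non-negative random variable $Y$ is regularly varying with index $-1$ if $P(Y>sx)/P(Y>x)\to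 s^{-1}$ as $x\to\infty$ for every $s>0$. *)

(* Defs.v *)
From HB Require Import structures.
From mathcomp Require Export all_boot all_order all_algebra finmap.
From mathcomp Require Export all_classical all_reals all_analysis.
Export Order.TTheory GRing.Theory Num.Theory numFieldNormedType.Exports.

Set Implicit Arguments.
Unset Strict Implicit.
Unset Printing Implicit Defensive.

Local Open Scope classical_set_scope.
Local Open Scope ring_scope.

Definition tail d (T : measurableType d) (R : realType) (P : probability T R)
    (Y : T -> R) (x : R) : R :=
  fine (P [set w | x < Y w]).

Definition distfun d (T : measurableType d) (R : realType)
    (P : probability T R) (Y : T -> R) (x : R) : R :=
  fine (P [set w | Y w <= x]).

Definition identically_distributed d (T : measurableType d) (R : realType)
    (P : probability T R) (I : Type) (X : I -> {RV P >-> R}) : Prop :=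
  forall (i j : I) (A : set R), measurable A ->
    distribution P (X i) A = distribution P (X j) A.

Definition mutually_independent d (T : measurableType d) (R : realType)
    (P : probability T R) (I : choiceType) (X : I -> {RV P >-> R}) : Prop :=
  forall (J : {fset I}) (A : I -> set R), (forall i, measurable (A i)) ->
    P (\bigcap_(i in [set` J]) (X i @^-1` A i)) =
    (\prod_(i <- J) P (X i @^-1` A i))%E.

Definition iid d (T : measurableType d) (R : realType)
    (P : probability T R) (I : choiceType) (X : I -> {RV P >-> R}) : Prop :=
  identically_distributed X /\ mutually_independent X.

Definition sigma_generated d (T : measurableType d) (R : realType)
    (P : probability T R) (I : Type) (X : I -> {RV P >-> R}) : set (set T) :=
  <<s \bigcup_i preimage_set_system setT (X i) measurable >>.

Definition independent_processes d (T : measurableType d) (R : realType)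
    (P : probability T R) (I J : Type)
    (X : I -> {RV P >-> R}) (Y : J -> {RV P >-> R}) : Prop :=
  forall A B : set T, sigma_generated X A -> sigma_generated Y B ->
    P (A `&` B) = (P A * P B)%E.

(* Strict stationarity of the bivariate process: all finite-dimensional
   distributions, as laws on (R * R)^n, are invariant under time shifts. *)
Definition stationary d (T : measurableType d) (R : realType)
    (P : probability T R) (X Y : int -> {RV P >-> R}) : Prop :=
  forall (n : nat) (t : 'I_n -> int) (h : int) (B : set (n.-tuple (R * R))),
    measurable B ->
    P [set w | B [tuple (X (t i) w, Y (t i) w) | i < n]] =
    P [set w | B [tuple (X (t i + h) w, Y (t i + h) w) | i < n]].

(* [ln] is 0 on nonpositive reals, so positivity of the volatility has to be
   required explicitly for the logarithm to be meaningful. *)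
Definition SV_solution d (T : measurableType d) (R : realType)
    (P : probability T R) (alpha : nat -> R) (eps eta : int -> {RV P >-> R})
    (X sigma : int -> {RV P >-> R}) : Prop :=
  forall t : int, {ae P, forall w,
    [/\ X t w = sigma t w * eps t w,
        0 < sigma t w &
        (fun n : nat => \sum_(0 <= i < n) alpha i * eta (t - i%:Z) w)
          @ \oo --> ln (sigma t w)]}.

Definition regularly_varying d (T : measurableType d) (R : realType)
    (P : probability T R) (Y : T -> R) (rho : R) : Prop :=
  {ae P, forall w, 0 <= Y w} /\
  forall s : R, 0 < s ->
    tail P Y (s * x) / tail P Y x @[x --> +oo] --> s `^ rho.

Definition Gamma (R : realType) (a : R) : R :=
  \int[lebesgue_measure]_(x in `]0, +oo[) (x `^ (a - 1) * expR (- x)).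

Definition Lambda (R : realType) (alpha : nat -> R) : set nat :=
  [set n | alpha n = 1].

(* [fset_set] is the empty set on infinite sets; here [Lambda alpha] is finite
   since [alpha] tends to 0. *)
Definition cardLambda (R : realType) (alpha : nat -> R) : nat :=
  #|` fset_set (Lambda alpha)|.

(* [limn] is a total operator; under the model assumptions this series converges
   almost surely. *)
Definition mgf_rest d (T : measurableType d) (R : realType)
    (P : probability T R) (alpha : nat -> R) (eta : int -> {RV P >-> R}) : R :=
  fine 'E_P[fun w => expR (limn (fun m : nat =>
    \sum_(0 <= n < m | n \notin Lambda alpha) alpha n * eta n%:Z w))].

Definition betahat (R : realType) (alpha : nat -> R) (beta : R) : R :=
  let k := cardLambda alpha in
  if -1 < beta then k%:R * beta + k%:R - 1 else beta.

Definition Khat d (T : measurableType d) (R : realType)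
    (P : probability T R) (alpha : nat -> R) (eta : int -> {RV P >-> R})
    (beta K : R) : R :=
  let k := cardLambda alpha in
  if -1 < beta then
    K ^+ k * (Gamma (beta + 1) ^+ k / Gamma (k%:R * (beta + 1))) *
    mgf_rest alpha eta
  else
    k%:R * K * fine 'E_P[fun w => expR (eta 0 w)] ^+ k.-1 *
    mgf_rest alpha eta.

Definition norming d (T : measurableType d) (R : realType)
    (P : probability T R) (alpha : nat -> R) (eta : int -> {RV P >-> R})
    (beta K : R) (n : nat) : R :=
  Khat alpha eta beta K * n%:R * ln n%:R `^ betahat alpha beta.

(* Main.v *)
(* The logarithm of the volatility is the sum of k independent copies of eta_0,
   one for each coefficient equal to 1, and of an independent remainder whose
   coefficients stay below some r < 1.  Gamma-type tails are stable under
   convolution: for beta > -1 a large sum is shared between the summands, which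
   yields a Beta integral, while for beta < -1 a single summand is large.  The
   exponential of the remainder has a moment of order q > 1, by
   E exp(s eta_0) <= exp(C s) for s in [0, t], t < 1, and Fatou's lemma.
   Breiman's lemma therefore adds the remainder to the k copies, and applied once
   more to sigma_0 and to |eps_0|, eps_0^+ and eps_0^- it gives the tails of X_0.
   With y_n = log(a_n z) ~ log n, the tail asymptotics turn into
   n P(sigma_0 > a_n z) -> 1/z, hence (1 - P(sigma_0 > a_n z))^n -> exp(-1/z). *)

Require Import Defs.
From mathcomp Require Import measurable_realfun ring lra.

Set Implicit Arguments.
Unset Strict Implicit.
Unset Printing Implicit Defensive.

Local Open Scope classical_set_scope.
Local Open Scope ring_scope.

(** * Independence *)

Section independent_pairs.
Context {d : measure_display} {T : measurableType d} {R : realType}.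
Variable P : probability T R.
Implicit Types U V : T -> R.

(** Only the tail of [eta 0] is known, so a convolution cannot be computed from densities. The event
    U + V > z is cut at a fixed level M. Where one summand is at most M, the probability is the tail
    of the exponential of the other one times a bounded variable, again a case for Breiman's lemma.
    On the corner U > M, V > M both tails are close to those of the model density x^g e^(-x):
    replacing the tail of U, exchanging integrals and replacing the tail of V gives the mass of the
    corner under a product of model densities. There the exponential depends on x + y alone, and
    scaling leaves an incomplete Beta integral. For beta > -1 the corner dominates by a power of z;
    for beta < -1 it has relative size M^(beta+1) and disappears as M grows. The same identity on
    the whole quadrant evaluates the Beta integral. Stationarity rests on another fact: the law of
    the path of an independent family is determined by its marginals, and returns and volatility are
    measurable functions of the path of the innovations. *)

Definition indep2 U V : Prop :=
  forall A B : set R, measurable A -> measurable B ->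
    P (U @^-1` A `&` V @^-1` B) = (P (U @^-1` A) * P (V @^-1` B))%E.

Lemma indep2_sym U V : indep2 U V -> indep2 V U.
Proof. by move=> UV A B mA mB; rewrite setIC UV// muleC. Qed.

Lemma indep2_comp U V (f g : R -> R) : measurable_fun setT f ->
  measurable_fun setT g -> indep2 U V -> indep2 (f \o U) (g \o V).
Proof.
move=> mf mg UV A B mA mB; apply: (UV (f @^-1` A) (g @^-1` B)).
- by have := mf measurableT A mA; rewrite setTI.
- by have := mg measurableT B mB; rewrite setTI.
Qed.

(** On measurable rectangles the law of the pair is the product of the two laws, hence it is the
    product measure, and Tonelli's theorem gives the iterated integral. In the inner integral [V] is
    frozen at [w'], which expresses conditioning on [V]. *)
Lemma indep2_integral U V (h : R * R -> \bar R) :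
  measurable_fun setT U -> measurable_fun setT V -> indep2 U V ->
  measurable_fun setT h -> (forall z, 0 <= h z)%E ->
  (\int[P]_w h (U w, V w) = \int[P]_w' \int[P]_w h (U w, V w'))%E.
Proof.
move=> mU mV UV mh h0.
pose U' : {mfun T >-> R} := mfun_Sub (mem_set mU).
pose V' : {mfun T >-> R} := mfun_Sub (mem_set mV).
have mUV : measurable_fun setT (fun w => (U w, V w)) by exact: measurable_fun_pair.
pose Z : {mfun T >-> (R * R)%type} := mfun_Sub (mem_set mUV).
have -> : (\int[P]_w h (U w, V w) = \int[distribution P Z]_z h z)%E.
  by rewrite ge0_integral_distribution.
have -> : (\int[distribution P Z]_z h z =
    \int[distribution P U' \x distribution P V']_z h z)%E.
  apply: eq_measure_integral => A mA _.
  have UV' B C : measurable B -> measurable C ->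
      distribution P Z (B `*` C) = (distribution P U' B * distribution P V' C)%E.
    exact: UV.
  exact/esym/(product_measure_unique UV').
rewrite fubini_tonelli2// ge0_integral_distribution//; last 2 first.
- exact: measurable_fun_fubini_tonelli_G.
- by move=> y; apply: integral_ge0.
apply: eq_integral => w' _ /=.
rewrite /fubini_G ge0_integral_distribution//.
by apply: measurableT_comp => //; exact: measurable_pair2.
Qed.

Lemma indep2_prob U V (S : set (R * R)) :
  measurable_fun setT U -> measurable_fun setT V -> indep2 U V ->
  measurable S ->
  (P [set w | S (U w, V w)] = \int[P]_w' P [set w | S (U w, V w')])%E.
Proof.
move=> mU mV UV mS.
have mUV : measurable_fun setT (fun w => (U w, V w)) by exact: measurable_fun_pair.
have mSUV : measurable [set w | S (U w, V w)].
  by rewrite -[X in measurable X]setTI; exact: mUV.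
rewrite -[X in P X]setIT -integral_indic//.
have := @indep2_integral U V (fun z => (\1_S z)%:E) mU mV UV.
rewrite (_ : (fun w => _) = (fun x => (\1_[set w | S (U w, V w)] x)%:E)) => [->|].
- apply: eq_integral => w' _.
  have mUw : measurable_fun setT (fun w => (U w, V w')).
    by apply: measurable_fun_pair => //; exact: measurable_cst.
  rewrite -[X in _ = P X]setIT -integral_indic//.
  by rewrite -[X in measurable X]setTI; exact: mUw.
- exact/measurable_EFinP.
- by move=> z; rewrite lee_fin.
by apply/funext.
Qed.

Lemma indep2_expectationM U V : measurable_fun setT U -> measurable_fun setT V ->
  indep2 U V -> (forall w, 0 <= U w) -> (forall w, 0 <= V w) ->
  (\int[P]_w (U w * V w)%:E = (\int[P]_w (U w)%:E) * (\int[P]_w (V w)%:E))%E.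
Proof.
move=> mU mV UV U0 V0.
have mU' : measurable_fun setT (fun w => (U w)%:E) by exact/measurable_EFinP.
have mV' : measurable_fun setT (fun w => (V w)%:E) by exact/measurable_EFinP.
(* The absolute value makes [h] nonnegative on the whole plane, as [indep2_integral] asks; on the
   values of [U] and [V] it changes nothing. *)
pose h (z : R * R) := (`|z.1 * z.2|%:E)%E.
have hE w w' : h (U w, V w') = ((U w)%:E * (V w')%:E)%E.
  by rewrite /h /= ger0_norm ?mulr_ge0// EFinM.
have mh : measurable_fun setT h.
  apply/measurable_EFinP/measurableT_comp => //.
  by apply: measurable_funM.
have := indep2_integral mU mV UV mh (fun z => _).
under eq_integral do rewrite hE -EFinM.
move=> ->; last by move=> z; rewrite lee_fin.
under eq_integral.
  move=> w' _; under eq_integral do rewrite hE.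
  rewrite ge0_integralZr//; last 2 first.
  - by move=> w _; rewrite lee_fin.
  - by rewrite lee_fin.
  over.
rewrite ge0_integralZl//.
- by move=> w _; rewrite lee_fin.
- by apply: integral_ge0 => w _; rewrite lee_fin.
Qed.

End independent_pairs.

(** * Generated sigma-algebras and laws of independent families *)

Section families.
Context {d : measure_display} {T : measurableType d} {R : realType}.
Variable P : probability T R.

Lemma probability_eq_on_generated {d'} {T' : measurableType d'}
    (m1 m2 : {measure set T' -> \bar R}) (G : set (set T')) :
  (forall A, G A -> measurable A) -> setI_closed G -> G setT ->
  (m1 setT < +oo)%E -> (forall A, G A -> m1 A = m2 A) ->
  forall A, <<s G >> A -> m1 A = m2 A.
Proof.
move=> mG GI GT m1y m12 A sA.
apply: (@g_sigma_algebra_measure_unique _ _ _ G mG (fun=> setT)) => //.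
by rewrite bigcup_const.
Qed.

(** With [C] fixed, both sides are finite measures in [A]: the restriction of [P] to [C], and [P]
    scaled by the number [P C]. They agree on the pi-system [G], hence on what it generates. *)
Lemma indep_on_generated (G : set (set T)) (C : set T) :
  measurable C -> (forall A, G A -> measurable A) -> setI_closed G -> G setT ->
  (forall A, G A -> P (A `&` C) = (P A * P C)%E) ->
  forall A, <<s G >> A -> P (A `&` C) = (P A * P C)%E.
Proof.
move=> mC mG GI GT GC A sA.
have fC : P C \is a fin_num by exact: fin_num_measure.
pose c : {nonneg R} := NngNum (fine_ge0 (measure_ge0 P C)).
have cE : P C = (c%:num)%:E by rewrite /= fineK.
have PC : (mrestr P mC setT < +oo)%E.
  by rewrite /mrestr setTI -ge0_fin_numE.
have eqG B : G B -> mrestr P mC B = mscale c P B.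
  by move=> GB; rewrite /mrestr /mscale /= GC// cE muleC.
have -> : P (A `&` C) = mscale c P A.
  exact: (@probability_eq_on_generated _ _ (mrestr P mC) _ G).
by rewrite /mscale /= cE muleC.
Qed.

(** Indexed by a set [J] so that functions of disjoint groups of variables can be told apart; [setT]
    gives the generators used in [sigma_generated]. *)
Definition gen {I : Type} (X : I -> T -> R) (J : set I) : set (set T) :=
  \bigcup_(i in J) preimage_set_system setT (X i) measurable.

(** The preimages in [gen] are not closed under intersection; their finite intersections are, and
    generate the same sigma-algebra. They serve as the pi-system. *)
Definition cyl {I : choiceType} (X : I -> T -> R) (J : set I) : set (set T) :=
  [set S | exists F : {fset I}, exists A : I -> set R,
    [/\ [set` F] `<=` J, forall i, measurable (A i) &
        S = \bigcap_(i in [set` F]) (X i @^-1` A i)]].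

Lemma cylT (I : choiceType) (X : I -> T -> R) J : cyl X J setT.
Proof.
exists fset0, (fun=> setT); split => //.
by rewrite set_fset0 bigcap_set0.
Qed.

Lemma cylI (I : choiceType) (X : I -> T -> R) J : setI_closed (cyl X J).
Proof.
move=> _ _ [F [A [FJ mA ->]]] [F' [A' [FJ' mA' ->]]].
exists (F `|` F')%fset.
exists (fun i => (if i \in F then A i else setT) `&` (if i \in F' then A' i else setT)).
split.
- by move=> i /=; rewrite in_fsetU => /orP[/FJ|/FJ'].
- by move=> i; apply: measurableI; case: ifP.
- apply/seteqP; split => w /=.
    move=> [h h'] i /=; rewrite in_fsetU => _.
    by split; case: ifPn => // iF; [exact: h|exact: h'].
  move=> h; split => i /= iF.
    by have := h i; rewrite /= in_fsetU iF => /(_ isT)[].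
  by have := h i; rewrite /= in_fsetU iF orbT => /(_ isT)[].
Qed.

Lemma cyl_measurable (I : choiceType) (X : I -> {RV P >-> R}) J S :
  cyl X J S -> measurable S.
Proof.
move=> [F [A [_ mA ->]]]; apply: fin_bigcap_measurable => // i _.
by rewrite -[X in measurable X]setTI; exact: measurable_funP.
Qed.

Lemma gen_measurable (I : Type) (X : I -> {RV P >-> R}) J S :
  <<s gen X J >> S -> measurable S.
Proof.
apply: smallest_sub; first exact: sigma_algebra_measurable.
move=> _ [i _ [A mA <-]]; exact: measurable_funP.
Qed.

Lemma sigma_gen_cyl (I : choiceType) (X : I -> T -> R) J S :
  <<s gen X J >> S -> <<s cyl X J >> S.
Proof.
apply: smallest_sub; first exact: smallest_sigma_algebra.
move=> _ [i Ji [A mA <-]]; apply: sub_sigma_algebra.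
exists [fset i]%fset, (fun=> A); split => //.
- by move=> j /=; rewrite inE => /eqP ->.
- by rewrite setTI set_fset1 bigcap_set1.
Qed.

Lemma cyl_indep (I : choiceType) (X : I -> {RV P >-> R}) (J J' : set I) S S' :
  mutually_independent X -> J `&` J' = set0 ->
  cyl X J S -> cyl X J' S' -> P (S `&` S') = (P S * P S')%E.
Proof.
move=> Xi JJ' [F [A [FJ mA ->]]] [F' [A' [FJ' mA' ->]]].
(* Since [F] and [F'] are disjoint, the two families of sets glue into one, and independence is
   applied to the union. *)
pose B i := if i \in F then A i else A' i.
have FF' i : i \in F' -> i \notin F.
  move=> iF'; apply/negP => iF.
  by have : (J `&` J') i; [split; [exact: FJ|exact: FJ']|rewrite JJ'].
have mB i : measurable (B i) by rewrite /B; case: ifP.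
have -> : \bigcap_(i in [set` F]) (X i @^-1` A i) =
    \bigcap_(i in [set` F]) (X i @^-1` B i).
  by apply: eq_bigcapr => i /= iF; rewrite /B iF.
have -> : \bigcap_(i in [set` F']) (X i @^-1` A' i) =
    \bigcap_(i in [set` F']) (X i @^-1` B i).
  by apply: eq_bigcapr => i /= iF; rewrite /B (negbTE (FF' _ iF)).
rewrite -bigcap_setU.
have -> : [set` F] `|` [set` F'] = [set` (F `|` F')%fset] by rewrite set_fsetU.
rewrite !Xi//.
rewrite (big_fsetID _ (mem F)) /=; congr (_ * _)%E.
- apply: eq_fbigl => i; rewrite !inE /=.
  by case: (i \in F) => //=; rewrite ?andbF.
- apply: eq_fbigl => i; rewrite !inE /=.
  case: (boolP (i \in F')) => [/FF' -> //|]; first by rewrite orbT.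
  by rewrite orbF andbN.
Qed.

(** Two passes of [indep_on_generated] extend the product rule from cylinders: one with a cylinder
    over [J'] held fixed, the other with an arbitrary event over [J] held fixed. *)
Lemma mutually_independent_gen (I : choiceType) (X : I -> {RV P >-> R})
    (J J' : set I) S S' :
  mutually_independent X -> J `&` J' = set0 ->
  <<s gen X J >> S -> <<s gen X J' >> S' ->
  P (S `&` S') = (P S * P S')%E.
Proof.
move=> Xi JJ' sS sS'; have mS := gen_measurable sS.
rewrite setIC muleC; apply: (indep_on_generated (G := cyl X J')) => //.
- exact: cyl_measurable.
- exact: cylI.
- exact: cylT.
- move=> C cC; rewrite setIC muleC.
  apply: (indep_on_generated (G := cyl X J)) => //.
  + exact: cyl_measurable cC.
  + exact: cyl_measurable.
  + exact: cylI.
  + exact: cylT.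
  + by move=> A cA; exact: (cyl_indep Xi JJ').
  + exact: sigma_gen_cyl.
- exact: sigma_gen_cyl.
Qed.

Lemma measurable_gen (I : Type) (X : I -> T -> R) (J : set I) i : J i ->
  measurable_fun setT (X i : g_sigma_algebraType (gen X J) -> R).
Proof.
move=> Ji _ A mA; apply: sub_sigma_algebra.
by exists i => //; exists A.
Qed.

(** Measurability for [g_sigma_algebraType (gen X J)] says that [U] depends only on the variables
    with index in [J]; limits of series fit this description as well as finite sums do. *)
Lemma indep2_gen (I : choiceType) (X : I -> {RV P >-> R}) (J J' : set I)
    (U V : T -> R) :
  mutually_independent X -> J `&` J' = set0 ->
  measurable_fun setT (U : g_sigma_algebraType (gen X J) -> R) ->
  measurable_fun setT (V : g_sigma_algebraType (gen X J') -> R) ->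
  indep2 P U V.
Proof.
move=> Xi JJ' mU mV A B mA mB; apply: (mutually_independent_gen Xi JJ').
- by rewrite -[X in <<s _ >> X]setTI; exact: mU.
- by rewrite -[X in <<s _ >> X]setTI; exact: mV.
Qed.

Lemma measurable_fun_gen (I : Type) (X : I -> {RV P >-> R}) (J : set I)
    (U : T -> R) :
  measurable_fun setT (U : g_sigma_algebraType (gen X J) -> R) ->
  measurable_fun setT U.
Proof.
by move=> mU _ A mA; apply: (@gen_measurable _ X J); exact: mU.
Qed.

(** Generators of the product sigma-algebra on path space. *)
Definition coords (I : Type) : set (set (I -> R)) :=
  \bigcup_i preimage_set_system setT (fun x : I -> R => x i) measurable.

(** Both path laws give a finite cylinder the product of its marginal probabilities, and finite
    cylinders form a pi-system that generates the path sigma-algebra. Time shifts and time reversal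
    of the innovations are both instances. *)
Lemma mutually_independent_law (I : choiceType) (X Y : I -> {RV P >-> R}) :
  mutually_independent X -> mutually_independent Y ->
  (forall i A, measurable A -> P (X i @^-1` A) = P (Y i @^-1` A)) ->
  forall S, <<s @coords I >> S ->
  P [set w | S (X ^~ w)] = P [set w | S (Y ^~ w)].
Proof.
move=> Xi Yi XY S sS.
pose Path := g_sigma_algebraType (@coords I).
have mpath (Z : I -> {RV P >-> R}) :
    measurable_fun setT ((fun w => Z ^~ w) : T -> Path).
  apply: (@measurability _ _ T (g_sigma_algebraType (@coords I)) setT _ (@coords I)) => //.
  move=> _ [_ [i _ [A mA <-]] <-].
  by have := @measurable_funP _ _ _ _ setT (Z i) measurableT A mA; rewrite !setTI.
pose G : set (set Path) := [set C | exists F : {fset I}, exists A : I -> set R,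
  (forall i, measurable (A i)) /\ C = \bigcap_(i in [set` F]) [set x | A i (x i)]].
pose mX := mfun_Sub (mem_set (mpath X)).
pose mY := mfun_Sub (mem_set (mpath Y)).
apply: (@probability_eq_on_generated _ _ (distribution P mX) (distribution P mY) G).
- move=> _ [F [A [mA ->]]]; apply: fin_bigcap_measurable => // i _.
  by apply: sub_sigma_algebra; exists i => //; exists (A i) => //; rewrite setTI.
- move=> _ _ [F [A [mA ->]]] [F' [A' [mA' ->]]].
  exists (F `|` F')%fset.
  exists (fun i => (if i \in F then A i else setT) `&`
                   (if i \in F' then A' i else setT)); split.
    by move=> i; apply: measurableI; case: ifP.
  apply/seteqP; split => w /=.
    move=> [h h'] i /=; rewrite in_fsetU => _.
    by split; case: ifPn => // iF; [exact: h|exact: h'].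
  move=> h; split => i /= iF.
    by have := h i; rewrite /= in_fsetU iF => /(_ isT)[].
  by have := h i; rewrite /= in_fsetU iF orbT => /(_ isT)[].
- exists fset0, (fun=> setT); split => //.
  by rewrite set_fset0 bigcap_set0.
- exact: (le_lt_trans (@probability_le1 _ _ _ P _ measurableT) (ltry _)).
- move=> _ [F [A [mA ->]]].
  transitivity (\prod_(i <- F) P (X i @^-1` A i))%E; first exact: Xi.
  under eq_bigr do rewrite XY//.
  exact/esym/Yi.
- apply: smallest_sub sS; first exact: smallest_sigma_algebra.
  move=> _ [i _ [A mA <-]]; apply: sub_sigma_algebra.
  exists [fset i]%fset, (fun=> A); split => //.
  by rewrite set_fset1 bigcap_set1 setTI.
Qed.

Lemma mutually_independent_inj (I I' : choiceType) (X : I -> {RV P >-> R})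
    (tau : I' -> I) : injective tau -> mutually_independent X ->
  mutually_independent (X \o tau).
Proof.
move=> tau_inj Xi F A mA.
(* A partial inverse of [tau] transports the sets [A] to the index type of [X]; indices outside the
   range get [setT] and impose no condition. *)
have /cid[g gK] : exists g : I -> option I', forall i', g (tau i') = Some i'.
  exists (fun i => if pselect (exists i', tau i' = i) is left h
                   then Some (sval (cid h)) else None) => i'.
  case: pselect => [h|[]]; last by exists i'.
  by case: cid => j /= /tau_inj ->.
pose A' i := if g i is Some i' then A i' else setT.
have mA' i : measurable (A' i) by rewrite /A'; case: (g i).
have := Xi (tau @` F)%fset A' mA'.
rewrite big_imfset /=; last by move=> ? ? _ _; exact: tau_inj.
under eq_bigr do rewrite /A' gK.
move=> <-; congr (P _); apply/seteqP; split => w h i /=.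
  by move=> /imfsetP[j /= jF ->]; rewrite /A' gK; exact: h.
move=> iF; have := h (tau i); rewrite /A' /= gK; apply.
by apply/imfsetP; exists i.
Qed.

End families.

(** * Tails and Breiman's lemma *)

Lemma near_pinfty_ge1 (R : realType) (Q : R -> Prop) :
  (\forall x \near +oo, Q x) -> exists M, 1 <= M /\ forall x, M <= x -> Q x.
Proof.
move=> [M [_ MQ]]; exists (Num.max 1 (M + 1)); split.
  by rewrite le_max lexx.
move=> x; rewrite ge_max => /andP[_ Mx]; apply: MQ.
by apply: lt_le_trans Mx; rewrite ltrDl.
Qed.

Section tail_theory.
Context {d : measure_display} {T : measurableType d} {R : realType}.
Variable P : probability T R.
Implicit Types Y : T -> R.

Lemma measurable_gt Y x : measurable_fun setT Y -> measurable [set w | x < Y w].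
Proof.
move=> mY; have := mY measurableT `]x, +oo[%classic (measurable_itv _).
by rewrite setTI; congr (measurable _); apply/seteqP; split => w /=;
  rewrite in_itv /= andbT.
Qed.

Lemma tailE Y x : measurable_fun setT Y -> (tail P Y x)%:E = P [set w | x < Y w].
Proof.
by move=> mY; rewrite fineK// fin_num_measure//; exact: measurable_gt.
Qed.

Lemma tail_ge0 Y x : 0 <= tail P Y x.
Proof. exact: fine_ge0. Qed.

Lemma tail_le1 Y x : measurable_fun setT Y -> tail P Y x <= 1.
Proof.
move=> mY; rewrite -lee_fin tailE//; apply: probability_le1.
exact: measurable_gt.
Qed.

Lemma tail_nincr Y x y : measurable_fun setT Y -> x <= y -> tail P Y y <= tail P Y x.
Proof.
move=> mY xy; rewrite -lee_fin !tailE//; apply: le_measure.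
- by rewrite inE; exact: measurable_gt.
- by rewrite inE; exact: measurable_gt.
- by move=> w /=; exact: le_lt_trans.
Qed.

Lemma tail_ae_eq Y Y' x : measurable_fun setT Y -> measurable_fun setT Y' ->
  {ae P, forall w, Y w = Y' w} -> tail P Y x = tail P Y' x.
Proof.
move=> mY mY' YY'; rewrite /tail; congr fine.
have mA := measurable_gt x mY; have mA' := measurable_gt x mY'.
rewrite -[X in P X]setIT -[X in _ = P X]setIT -!integral_indic//.
apply: ae_eq_integral => //.
- exact/measurable_EFinP.
- exact/measurable_EFinP.
apply: filterS YY' => w YY' _ /=; congr EFin.
rewrite !indicE; congr (nat_of_bool _)%:R.
by apply/idP/idP; rewrite !inE /= YY'.
Qed.

End tail_theory.

(** * A Potter bound from the doubling ratio *)

Section potter.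
Context {R : realType}.
Variables (F : R -> R) (p : R).
Hypotheses (F_nincr : forall x y, x <= y -> F y <= F x)
  (F0 : forall x, 0 <= F x) (F1 : forall x, F x <= 1) (p1 : 1 < p)
  (F_rv : F (2 * x) / F x @[x --> +oo] --> (2^-1 : R)).

(** The limit 1/2 of the ratio exceeds 2^(-p) because p > 1; this strict gap is the origin of the
    moment of order above 1 in Breiman's lemma. *)
Lemma doubling : exists x0, 1 <= x0 /\
  forall x, x0 <= x -> 0 < F x /\ F x <= 2 `^ p * F (2 * x).
Proof.
have lt2 : (2 : R) `^ (- p) < 2^-1.
  rewrite -[ltRHS](@powR_inv1 _ 2)//.
  by rewrite /powR !pnatr_eq0 /= ltr_expR ltr_pM2r ?ltrN2// ln_gt0 ?ltr1n.
have /near_pinfty_ge1[x0 [x01 x0F]] : \forall x \near +oo,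
    (2 : R) `^ (- p) < F (2 * x) / F x.
  by move/cvgrPdist_lt : F_rv => /(_ (2^-1 - 2 `^ (- p)));
    rewrite subr_gt0 => /(_ lt2); apply: filterS => x;
    move/ltr_normlW; lra.
exists x0; split=> // x /x0F h.
(* Were [F x] zero, the quotient would be 0 by the convention for division, against the lower bound
   [h]. *)
have Fx : 0 < F x.
  rewrite lt_neqAle F0 andbT eq_sym; apply/negP => /eqP Fx0.
  by move: h; rewrite Fx0 invr0 mulr0 ltNge powR_ge0.
split=> //.
by move: h; rewrite ltr_pdivlMr// powRN ltr_pdivrMl ?powR_gt0// => /ltW.
Qed.

Lemma pow2_between (v : R) : 1 <= v -> exists n, v <= 2 ^+ n <= 2 * v.
Proof.
move=> v1.
have [n vn] : exists n, v <= 2 ^+ n.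
  have [n vn] : exists n : nat, v <= n%:R.
    by exists (Num.bound v); apply/ltW/archi_boundP; rewrite (le_trans _ v1).
  by exists n; rewrite (le_trans vn)// -natrX ler_nat ltnW// ltn_expl.
elim: n vn => [v0|n IH vn].
  by exists 0%N; rewrite v0 expr0; lra.
have [/IH//|vn'] := leP v (2 ^+ n).
by exists n.+1; rewrite vn exprS ler_pM2l//= ltW.
Qed.

(** Iterating [doubling] along powers of two gives F x <= (2 v)^p F (v x) for v >= 1, while v <= 1
    is settled by monotonicity. The bound is uniform in x, so it can dominate the integrand in
    Breiman's lemma. *)
Lemma potter : exists C x0, [/\ 0 < C, 1 <= x0 & forall x, x0 <= x ->
  0 < F x /\ forall v, 0 < v -> F (x / v) <= C * (1 + v `^ p) * F x].
Proof.
have [x0 [x01 x0F]] := doubling.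
have Fx0 : 0 < F x0 by have [] := x0F x0 (lexx _).
have x00 : 0 < x0 by exact: lt_le_trans x01.
have p0 : 0 <= p by rewrite ltW// (lt_trans _ p1).
have pow n x : x0 <= x -> F x <= (2 ^+ n) `^ p * F (2 ^+ n * x).
  elim: n x => [|n IH] x x0x; first by rewrite expr0 powR1 !mul1r.
  apply: le_trans (IH x x0x) _; rewrite exprS powRM ?exprn_ge0//.
  rewrite -mulrA mulrCA ler_wpM2l ?powR_ge0// -mulrA.
  apply: (x0F _ _).2; rewrite (le_trans x0x)// ler_peMl//.
    by rewrite (le_trans _ x0x)// ltW.
  by rewrite exprn_ege1// ler1n.
have big v x : 1 <= v -> x0 <= x -> F x <= (2 * v) `^ p * F (v * x).
  move=> v1 x0x; have [n /andP[vn nv]] := pow2_between v1.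
  have v0 : 0 < v by exact: lt_le_trans v1.
  apply: le_trans (pow n x x0x) _; apply: ler_pM.
  - exact: powR_ge0.
  - exact: F0.
  - by apply: ge0_ler_powR => //; rewrite nnegrE ?exprn_ge0// mulr_ge0// ltW.
  - by apply: F_nincr; rewrite ler_wpM2r// (le_trans _ x0x)// ltW.
have p2 : 1 <= (2 : R) `^ p by rewrite -[leLHS](powRr0 2) ler_powR// ler1n.
exists (2 `^ p / F x0), x0; split => //.
  by rewrite divr_gt0// powR_gt0.
move=> x x0x; have [Fx _] := x0F x x0x; split=> // v v0.
have x0' : 0 < x by exact: lt_le_trans x0x.
have C1 : 2 `^ p <= 2 `^ p / F x0.
  by rewrite ler_peMr ?powR_ge0// invf_ge1.
have [v1|v1] := leP v 1.
  have : F (x / v) <= F x.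
    by apply: F_nincr; rewrite ler_pdivlMr// ler_piMr// ltW.
  move=> /le_trans; apply; rewrite -[leLHS]mul1r ler_wpM2r ?F0//.
  rewrite -[leLHS]mul1r ler_pM//; first exact: le_trans C1.
  by rewrite lerDl powR_ge0.
have step : F (x / v) <= (2 `^ p / F x0) * (v `^ p * F x).
  have v0' : 0 <= v by exact: ltW.
  have [xv|xv] := leP x0 (x / v).
    have := big v _ (ltW v1) xv.
    have -> : v * (x / v) = x by rewrite mulrC divfK ?gt_eqF.
    rewrite powRM// -mulrA => /le_trans; apply.
    by rewrite ler_wpM2r// mulr_ge0 ?powR_ge0 ?F0.
  (* Here [x / v] lies below the range of [doubling], and only [F <= 1] is available. Going from
     [x0] up to [x] costs a factor of at most (2 v)^p, whence [F x0] in the denominator of the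
     constant. *)
  have x1 : 1 <= x / x0 by rewrite ler_pdivlMr// mul1r.
  have := big _ _ x1 (lexx x0); rewrite divfK ?gt_eqF//.
  have xx0 : 0 <= x / x0 by exact: le_trans x1.
  rewrite powRM// => Fx0F; apply: le_trans (F1 _) _.
  rewrite mulrAC ler_pdivlMr// mul1r; apply: le_trans Fx0F _.
  rewrite -mulrA ler_wpM2l ?powR_ge0// ler_wpM2r ?F0//.
  apply: ge0_ler_powR; rewrite ?nnegrE//.
  by rewrite ler_pdivrMr// mulrC -ler_pdivrMr// ltW.
apply: le_trans step _; rewrite mulrA ler_wpM2r ?F0//.
have C0 : 0 <= 2 `^ p / F x0 by rewrite divr_ge0// powR_ge0.
by rewrite ler_wpM2l// lerDr.
Qed.

End potter.

(** * Breiman's lemma *)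

Section breiman.
Context {d : measure_display} {T : measurableType d} {R : realType}.
Variable P : probability T R.

(** Conditioning on [V]; where [V] vanishes, the product cannot exceed x > 0. The inverse is written
    as a power so that [measurable_powR] applies in [V]. *)
Lemma tail_mulE (W V : T -> R) x :
  measurable_fun setT W -> measurable_fun setT V -> indep2 P W V ->
  (forall w, 0 <= V w) -> 0 < x ->
  (P [set w | x < W w * V w]%R =
   \int[P]_w (if 0 < V w then tail P W (x * V w `^ (-1)) else 0)%:E)%E.
Proof.
move=> mW mV WV V0 x0.
have mS : measurable [set z : R * R | x < z.1 * z.2].
  have : measurable_fun [set: R * R] (fun z => z.1 * z.2) by exact: measurable_funM.
  exact: measurable_gt.
rewrite (indep2_prob mW mV WV mS); apply: eq_integral => w' _ /=.
case: ifPn => Vw.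
  rewrite tailE//; congr (P _); apply/seteqP; split => w /=.
    by rewrite powR_inv1// ltr_pdivrMr.
  by rewrite powR_inv1// ltr_pdivrMr.
have -> : V w' = 0 by apply/eqP; rewrite eq_le V0 andbT leNgt.
rewrite (_ : [set w | _] = set0) ?measure0//; apply/seteqP; split => w //=.
by rewrite mulr0 ltNge ltW.
Qed.

(** Divided by the tail of [W] at x, the integrand of [tail_mulE] tends to [V] pointwise by regular
    variation and is dominated by C (1 + V^p) through [potter]. *)
Lemma breiman (W V : T -> R) (p : R) :
  measurable_fun setT W -> measurable_fun setT V -> indep2 P W V ->
  (forall w, 0 <= V w) -> 1 < p ->
  (\int[P]_w (V w `^ p)%:E < +oo)%E ->
  (forall s, 0 < s -> tail P W (s * x) / tail P W x @[x --> +oo] --> s^-1) ->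
  (\int[P]_w (V w)%:E < +oo)%E /\
  tail P (fun w => W w * V w) x / tail P W x @[x --> +oo] -->
    fine (\int[P]_w (V w)%:E).
Proof.
move=> mW mV WV V0 p1 Vp rv.
set F := tail P W.
have Fn x y : x <= y -> F y <= F x by exact: tail_nincr.
have F0 x : 0 <= F x by exact: tail_ge0.
have F1 x : F x <= 1 by exact: tail_le1.
have [C [x0 [C0 x01 x0F]]] := potter Fn F0 F1 p1 (rv 2 ltac:(by [])).
have mF : measurable_fun setT F.
  by apply: nonincreasing_measurable => // x y _ _; exact: Fn.
pose G x (v : R) : R := if 0 < v then F (x * v `^ (-1)) / F x else 0.
have mG x : measurable_fun setT (fun w => G x (V w)).
  apply: measurable_fun_ifT => //.
    exact: measurable_fun_ltr.
  apply: measurable_funM => //; apply: measurableT_comp => //.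
  apply: measurable_funM => //.
  exact: (measurableT_comp (measurable_powR _)).
have mp : measurable_fun setT (fun w => V w `^ p).
  exact: (measurableT_comp (measurable_powR _)).
pose g w := (C * (1 + V w `^ p))%:E.
have G0 x v : 0 <= G x v by rewrite /G; case: ifP => // _; rewrite divr_ge0.
have ig : P.-integrable setT g.
  rewrite /g; under eq_fun do rewrite EFinM EFinD.
  apply: integrableZl => //; apply: integrableD => //.
    exact: finite_measure_integrable_cst.
  apply/integrableP; split; first exact/measurable_EFinP.
  by under eq_integral do rewrite gee0_abs ?lee_fin ?powR_ge0//.
have Gg x w : x0 <= x -> G x (V w) <= C * (1 + V w `^ p).
  move=> x0x; have [Fx FxC] := x0F x x0x; rewrite /G; case: ifPn => Vw.
    by rewrite ler_pdivrMr// powR_inv1// FxC.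
  by rewrite mulr_ge0 ?(ltW C0)// addr_ge0// powR_ge0.
have Glim (u : R^nat) w : u n @[n --> \oo] --> +oo -> G (u n) (V w) @[n --> \oo] --> V w.
  move=> uoo; rewrite /G; have [Vw|Vw] := ltP 0 (V w).
    have Vi : 0 < (V w)^-1 by rewrite invr_gt0.
    have := rv _ Vi; rewrite invrK => /cvg_pinftyP/(_ u uoo).
    apply: cvg_trans; apply: near_eq_cvg; apply: nearW => n.
    by rewrite powR_inv1// [u n * _]mulrC.
  have -> : V w = 0 by apply/eqP; rewrite eq_le V0 andbT.
  exact: cvg_cst.
(* Dominated convergence speaks of sequences, so the limit at infinity is tested along an arbitrary
   [u]. The theorem also returns the integrability of the limit [V]. *)
have key (u : R^nat) : u n @[n --> \oo] --> +oo -> (forall n, x0 <= u n) ->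
    P.-integrable setT (fun w => (V w)%:E) /\
    ((\int[P]_w (G (u n) (V w))%:E) @[n --> \oo] --> \int[P]_w (V w)%:E)%E.
  move=> uoo x0u.
  have [] := @dominated_convergence _ _ _ P setT measurableT
    (fun n w => (G (u n) (V w))%:E) (fun w => (V w)%:E) g _ _ _ ig _.
  - by move=> n; exact/measurable_EFinP.
  - exact/measurable_EFinP.
  - by apply: aeW => w _; apply: cvg_EFin; [exact: nearW|exact: Glim].
  - by apply: aeW => w n _; rewrite gee0_abs ?lee_fin// Gg.
  - by [].
have iV : P.-integrable setT (fun w => (V w)%:E).
  pose u (n : nat) : R := x0 + n%:R.
  have uoo : u n @[n --> \oo] --> +oo.
    apply/cvgryPge => A; exists (Num.bound `|A|) => // n /= An.
    rewrite /u (@le_trans _ _ n%:R)//; last by rewrite lerDr (le_trans _ x01).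
    rewrite (le_trans (ler_norm _))// ltW//.
    by rewrite (lt_le_trans (archi_boundP _))// ler_nat.
  have xu n : x0 <= u n by rewrite lerDl.
  by have [] := key u uoo xu.
have Vfin : (\int[P]_w (V w)%:E)%E \is a fin_num by exact: integrable_fin_num.
split; first by rewrite -ge0_fin_numE// integral_ge0// => w _; rewrite lee_fin.
apply/cvg_pinftyP => u uoo.
(* Raising [u] to at least [x0] makes the domination hold for every index; eventually nothing
   changes. *)
pose u' n := Num.max (u n) x0.
have u'oo : u' n @[n --> \oo] --> +oo.
  apply/cvgryPge => A; apply: filterS (@cvgry_ge _ _ \oo _ _ uoo A) => n.
  by rewrite le_max => ->.
have xu' n : x0 <= u' n by rewrite le_max lexx orbT.
have [_] := key u' u'oo xu'; rewrite -[X in _ @ _ --> X -> _]fineK//.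
move=> /fine_cvg.
apply: cvg_trans; apply: near_eq_cvg.
apply: filterS (@cvgry_ge _ _ \oo _ _ uoo x0) => n x0u.
have u'E : u' n = u n by apply/max_idPl.
rewrite /= u'E.
have u0 : 0 < u n by apply: lt_le_trans x0u; exact: lt_le_trans x01.
have [Fu _] := x0F _ x0u.
have GE : (P [set w | u n < W w * V w]%R =
    (F (u n))%:E * \int[P]_w (G (u n) (V w))%:E)%E.
  rewrite tail_mulE// -ge0_integralZl//.
  - apply: eq_integral => w _; rewrite -EFinM /G; congr EFin.
    by case: ifPn => _; rewrite ?mulr0// -/F [RHS]mulrC divfK ?gt_eqF.
  - exact/measurable_EFinP.
  - by move=> w _; rewrite lee_fin.
  - by rewrite lee_fin.
rewrite /tail GE fineM//=.
  by rewrite mulrC mulKf// gt_eqF.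
rewrite ge0_fin_numE; last by apply: integral_ge0 => w _; rewrite lee_fin.
apply: le_lt_trans (integrable_lty _ ig) => //.
apply: ge0_le_integral => //.
- by move=> w _; rewrite lee_fin.
- exact/measurable_EFinP.
- exact: measurable_int ig.
- by move=> w _; rewrite lee_fin Gg.
Qed.

End breiman.

(** * Gamma-type tails and their convolution *)

Section lebesgue_affine.
Context {R : realType}.
Local Notation mu := (@lebesgue_measure R).
Implicit Types f : R -> \bar R.

Lemma ge0_integral_shift f (t : R) : measurable_fun setT f -> (forall x, 0 <= f x)%E ->
  (\int[mu]_x f x = \int[mu]_x f (x + t)%R)%E.
Proof.
move=> mf f0.
have mt : measurable_fun setT (fun x : measurableTypeR R => x + t : measurableTypeR R).
  exact: measurable_funD.
rewrite -[RHS](ge0_integral_pushforward mt mu (D := setT) (f := f))//.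
apply: eq_measure_integral => A mA _; apply: lebesgue_measure_unique => //.
move=> _ [[a b] _ <-] /=; rewrite /pushforward.
have -> : (fun x => x + t) @^-1` `]a, b] = `]a - t, b - t]%classic :> set R.
  by apply/seteqP; split => x /=; rewrite !in_itv /= ltrBlDr lerBrDr.
rewrite !lebesgue_measure_itv /= !lte_fin ltrD2r.
by case: ifP => // _; congr EFin; ring.
Qed.

Lemma ge0_integral_opp f : measurable_fun setT f -> (forall x, 0 <= f x)%E ->
  (\int[mu]_x f x = \int[mu]_x f (- x)%R)%E.
Proof.
move=> mf f0.
have mt : measurable_fun setT (-%R : measurableTypeR R -> measurableTypeR R).
  exact: measurable_funN.
rewrite -[RHS](ge0_integral_pushforward mt mu (D := setT) (f := f))//.
by apply: eq_measure_integral => A mA _; exact/esym/lebesgue_measureN.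
Qed.

Lemma ge0_integral_scale f (c : R) : 0 < c ->
  measurable_fun setT f -> (forall x, 0 <= f x)%E ->
  (\int[mu]_x f x = c%:E * \int[mu]_x f (c * x)%R)%E.
Proof.
move=> c0 mf f0.
have mt : measurable_fun setT (fun x : measurableTypeR R => c * x : measurableTypeR R).
  exact: measurable_funM.
rewrite -[X in (_ * X)%E](ge0_integral_pushforward mt mu (D := setT) (f := f))//.
pose c' : {nonneg R} := NngNum (ltW c0).
rewrite -[c]/(c'%:num) -ge0_integral_mscale//.
apply: eq_measure_integral => A mA _; apply: lebesgue_measure_unique => //.
move=> _ [[a b] _ <-] /=.
transitivity (c%:E * mu ((fun x : R => (c * x)%R) @^-1` `]a, b]))%E; last by [].
rewrite (_ : _ @^-1` _ = `]a / c, b / c]%classic :> set R); last first.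
  apply/seteqP; split => x /=; rewrite !in_itv /=.
    by rewrite ltr_pdivrMr// ler_pdivlMr// mulrC.
  by rewrite ltr_pdivrMr// ler_pdivlMr// mulrC.
rewrite !lebesgue_measure_itv /= !lte_fin ltr_pM2r ?invr_gt0//.
case: ifP => _; last by rewrite mule0.
by rewrite -!EFinD -EFinM; congr EFin; field; rewrite gt_eqF.
Qed.

End lebesgue_affine.

Section powR_exp.
Context {R : realType}.

(** From ln x <= ln c + x / c, a choice c >= |g| / e makes the linear term at most e x; the rest
    goes into the constant. *)
Lemma powR_le_expR (g e : R) : 0 < e ->
  exists2 C, 0 < C & forall x, 1 <= x -> x `^ g <= C * expR (e * x).
Proof.
move=> e0; pose c := Num.max 1 (`|g| / e).
have c1 : 1 <= c by rewrite le_max lexx.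
have c0 : 0 < c by exact: lt_le_trans c1.
exists (expR (`|g| * ln c)); first exact: expR_gt0.
move=> x x1; have x0 : 0 < x by exact: lt_le_trans x1.
rewrite /powR gt_eqF// -expRD ler_expR.
have lnx : 0 <= ln x by exact: ln_ge0.
apply: (@le_trans _ _ (`|g| * ln x)); first by rewrite ler_wpM2r// ler_norm.
have -> : ln x = ln c + ln (x / c).
  by rewrite -lnM ?posrE ?divr_gt0// mulrC divfK// gt_eqF.
rewrite mulrDr lerD2l.
have h : ln (x / c) <= x / c.
  have xc : 0 < x / c by rewrite divr_gt0.
  have := expR_ge1Dx (ln (x / c)); rewrite lnK ?posrE//; lra.
apply: (@le_trans _ _ (`|g| * (x / c))); first by rewrite ler_wpM2l.
rewrite mulrCA mulrC; rewrite ler_wpM2r// ?(ltW x0)//.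
rewrite ler_pdivrMr// -ler_pdivrMl// mulrC le_max orbC.
by rewrite lexx.
Qed.

Lemma cvg_powR_expN (g : R) : x `^ g * expR (- x) @[x --> +oo] --> (0 : R).
Proof.
have [C C0 hC] := powR_le_expR g (ltac:(by []) : 0 < 2^-1 :> R).
apply: (@squeeze_cvgr _ _ _ _ (fun=> 0) (fun x => C * expR (- (2^-1 * x)))).
- near=> x; rewrite mulr_ge0 ?powR_ge0 ?expR_ge0//=.
  have -> : - (2^-1 * x) = 2^-1 * x - x by field.
  rewrite expRD mulrA ler_wpM2r ?expR_ge0//.
  by apply: hC; near: x; exact: nbhs_pinfty_ge.
- exact: cvg_cst.
- rewrite -[X in _ --> X](mulr0 C); apply: cvgMr.
  have : ((2^-1 : R) * x) @[x --> +oo] --> +oo.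
    by apply: gt0_cvgMry => //; exact: cvg_id.
  move=> /(cvg_comp (fun x : R => 2^-1 * x) (fun x => expR (- x))); apply.
  exact: cvgr_expR.
Unshelve. all: by end_near. Qed.

End powR_exp.

(** * Incomplete Gamma integrals *)

Section gtail.
Context {R : realType}.
Local Notation mu := (@lebesgue_measure R).

(** The Gamma density of shape g + 1 without its normalization. [gtail] is then the upper incomplete
    Gamma function, kept in the extended reals because at 0 it is infinite for g <= -1. *)
Definition gdens (g x : R) : R := x `^ g * expR (- x).

Definition gtail (g z : R) : \bar R := \int[mu]_(x in `]z, +oo[) (gdens g x)%:E.

Lemma gdens_ge0 g x : 0 <= gdens g x.
Proof. by rewrite mulr_ge0 ?powR_ge0 ?expR_ge0. Qed.

Lemma gdens_gt0 g x : 0 < x -> 0 < gdens g x.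
Proof. by move=> x0; rewrite mulr_gt0 ?powR_gt0 ?expR_gt0. Qed.

Lemma measurable_gdens g D : measurable_fun D (gdens g).
Proof.
apply: measurable_funTS; apply: measurable_funM.
  exact: measurable_powR.
exact: measurableT_comp.
Qed.

Lemma is_derive_powR (g x : R) : 0 < x -> is_derive x 1 (@powR R ^~ g) (g * x `^ (g - 1)).
Proof.
move=> x0; have xI : x \in `]0, +oo[ by rewrite in_itv /= x0.
have /derivableP := @derivable_powR _ 1 g x xI.
by rewrite -derive1E powR_derive1.
Qed.

Lemma is_derive_gdens (g x : R) : 0 < x ->
  is_derive x 1 (gdens g) (- (gdens g x * (1 - g / x))).
Proof.
move=> x0; have dP := is_derive_powR g x0.
have dE : is_derive x 1 (fun x : R => expR (- x)) (- expR (- x)).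
  have := @is_derive1_comp _ expR -%R x (expR (- x)) (-1) _ _.
  by rewrite mulrN1; apply.
apply: (is_derive_eq (is_deriveM dP dE)).
have -> : x `^ (g - 1) = x `^ g / x.
  by rewrite powRB ?powRr1 ?(ltW x0) ?(gt_eqF x0) ?implybT.
rewrite /gdens /GRing.scale /=.
by field; rewrite gt_eqF.
Qed.

Lemma continuous_gdens (g x : R) : 0 < x -> {for x, continuous (gdens g)}.
Proof.
move=> x0; apply: differentiable_continuous; apply/derivable1_diffP.
by have [] := is_derive_gdens g x0.
Qed.

Lemma gtail_FTC (g z : R) : 0 < z -> `|g| <= z ->
  (\int[mu]_(x in `[z, +oo[) (gdens g x * (1 - g / x))%:E = (gdens g z)%:E)%E.
Proof.
move=> z0 gz.
rewrite (@ge0_continuous_FTC2y _ _ (fun x => - gdens g x) z 0).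
- by rewrite EFinN oppeK add0e.
- move=> x zx; rewrite mulr_ge0 ?gdens_ge0// subr_ge0.
  have x0 : 0 < x by exact: lt_le_trans zx.
  by rewrite ler_pdivrMr// mul1r (le_trans (ler_norm _))// (le_trans gz).
- apply: continuous_in_subspaceT => x; rewrite inE /= in_itv /= andbT => zx.
  have x0 : 0 < x by exact: lt_le_trans zx.
  apply: cvgM; first exact: continuous_gdens.
  apply: cvgB; first exact: cvg_cst.
  apply: cvgM; first exact: cvg_cst.
  by apply: cvgV; [rewrite gt_eqF|exact: cvg_id].
- rewrite -[X in _ --> X]oppr0; apply: cvgN; exact: cvg_powR_expN.
- move=> x zx; apply: derivableN.
  by have [] := is_derive_gdens g (lt_trans z0 zx).
- apply: cvgN; apply: cvg_at_right_filter; exact: continuous_gdens.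
- move=> x; rewrite in_itv /= andbT => zx.
  have d := is_derive_gdens g (lt_trans z0 zx).
  by rewrite derive1E deriveN ?derive_val ?opprK//; have [] := d.
Qed.

(* The derivative of -gdens g is gdens g x * (1 - g / x), and |g / x| <= |g| / z for
   x >= z. *)
Lemma gtail_sandwich (g z : R) : 0 < z -> `|g| < z ->
  gtail g z \is a fin_num /\
  (1 - `|g| / z) * fine (gtail g z) <= gdens g z <= (1 + `|g| / z) * fine (gtail g z).
Proof.
move=> z0 gz.
have gz' := ltW gz.
have c0 : 0 < 1 - `|g| / z by rewrite subr_gt0 ltr_pdivrMr// mul1r.
have c1 : 0 < 1 + `|g| / z by rewrite ltr_pwDl// divr_ge0// ltW.
have mg D : measurable_fun D (EFin \o gdens g).
  by apply/measurable_EFinP; exact: measurable_gdens.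
have md : measurable_fun `[z, +oo[ (fun x => (gdens g x * (1 - g / x))%:E).
  apply/measurable_EFinP; apply: measurable_funM; first exact: measurable_gdens.
  apply: measurable_funB => //; apply: measurable_funM => //.
  apply: (@eq_measurable_fun _ _ _ _ _ (fun x : R => x `^ (-1))).
    move=> x; rewrite inE /= in_itv /= andbT => zx.
    by rewrite powR_inv1// (le_trans (ltW z0)).
  by apply: measurable_funTS; exact: measurable_powR.
have gE : gtail g z = (\int[mu]_(x in `[z, +oo[) (gdens g x)%:E)%E.
  rewrite /gtail integral_itv_obnd_cbnd//; exact: mg.
have bnd x : z <= x -> (1 - `|g| / z) <= 1 - g / x <= 1 + `|g| / z.
  move=> zx; have x0 : 0 < x by exact: lt_le_trans zx.
  have : `|g / x| <= `|g| / z.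
    by rewrite normrM normfV (gtr0_norm x0) ler_wpM2l// lef_pV2.
  by rewrite ler_norml; lra.
have ge0 x : z <= x -> 0 <= gdens g x * (1 - g / x).
  move=> zx; rewrite mulr_ge0 ?gdens_ge0//.
  by have /andP[h _] := bnd x zx; exact: le_trans (ltW c0) h.
have le1 : ((1 - `|g| / z)%:E * gtail g z <= (gdens g z)%:E)%E.
  rewrite gE -gtail_FTC// -ge0_integralZl//; last 3 first.
  - exact: mg.
  - by move=> x _; rewrite lee_fin gdens_ge0.
  - by rewrite lee_fin ltW.
  apply: ge0_le_integral => //.
  - by move=> x _; rewrite -EFinM lee_fin mulr_ge0 ?gdens_ge0// ltW.
  - by apply: measurable_funeM; exact: mg.
  - move=> x; rewrite /= in_itv /= andbT => zx.
    by rewrite -EFinM lee_fin mulrC ler_wpM2l ?gdens_ge0//; have /andP[] := bnd x zx.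
have gfin : gtail g z \is a fin_num.
  rewrite ge0_fin_numE; last by apply: integral_ge0 => x _; rewrite lee_fin gdens_ge0.
  move: le1; rewrite -lee_pdivlMl// => /le_lt_trans; apply.
  by rewrite -EFinM ltry.
have le2 : ((gdens g z)%:E <= (1 + `|g| / z)%:E * gtail g z)%E.
  rewrite gE -gtail_FTC// -ge0_integralZl//; last 3 first.
  - exact: mg.
  - by move=> x _; rewrite lee_fin gdens_ge0.
  - by rewrite lee_fin ltW.
  apply: ge0_le_integral => //.
  - by move=> x; rewrite /= in_itv /= andbT => zx; rewrite lee_fin ge0.
  - by apply: measurable_funeM; exact: mg.
  - move=> x; rewrite /= in_itv /= andbT => zx; rewrite -EFinM lee_fin mulrC.
    by rewrite ler_wpM2r ?gdens_ge0//; have /andP[] := bnd x zx.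
split=> //; apply/andP; split.
- by rewrite -lee_fin [(_ * fine _)%:E]EFinM fineK.
- by rewrite -lee_fin [(_ * fine _)%:E]EFinM fineK.
Qed.

Lemma gtail_ge0 g z : (0 <= gtail g z)%E.
Proof. by apply: integral_ge0 => x _; rewrite lee_fin gdens_ge0. Qed.

Lemma gtail_near (g e : R) : 0 < e -> e < 1 -> \forall z \near +oo,
  [/\ gtail g z \is a fin_num, (1 - e) * gdens g z <= fine (gtail g z) &
      fine (gtail g z) <= (1 + e) * gdens g z].
Proof.
move=> e0 e1; near=> z.
have z0 : 0 < z by near: z; exact: nbhs_pinfty_gt.
have gz : `|g| < z by near: z; exact: nbhs_pinfty_gt.
(* Half of [e] suffices: with q <= e / 2 and e < 1, both (1 - e) (1 + q) <= 1 and (1 + e) (1 - q) >=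
   1 hold. *)
have gze : `|g| / z <= e / 2.
  have : `|g| / (e / 2) <= z by near: z; exact/nbhs_pinfty_ge/num_real.
  by rewrite ler_pdivrMr ?divr_gt0// => h; rewrite ler_pdivrMr// mulrC.
have [fT /andP[]] := gtail_sandwich z0 gz.
have T0 : 0 <= fine (gtail g z) by rewrite fine_ge0// gtail_ge0.
have G0 := gdens_gt0 g z0.
move: (fine _) T0 (gdens g z) G0 => T T0 G G0.
have q0 : 0 <= `|g| / z by rewrite divr_ge0// ltW.
move: (`|g| / z) q0 gze => q q0 qe h1 h2; split => //.
- apply: (@le_trans _ _ ((1 - e) * ((1 + q) * T))).
    by rewrite ler_wpM2l// subr_ge0 ltW.
  rewrite mulrA -[leRHS]mul1r ler_wpM2r//; nra.
- apply: (@le_trans _ _ ((1 + e) * ((1 - q) * T))).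
    rewrite mulrA -[leLHS]mul1r ler_wpM2r//; nra.
  by rewrite ler_wpM2l// addr_ge0// ltW.
Unshelve. all: by end_near. Qed.

End gtail.

(** * Convolution of two model densities *)

Section gamma_convolution.
Context {R : realType}.
Local Notation mu := (@lebesgue_measure R).

Lemma cvg_powRN (r : R) : 0 < r -> x `^ (- r) @[x --> +oo] --> (0 : R).
Proof.
move=> r0; apply/cvgr0Pnorm_le => e e0; near=> x.
have x0 : 0 < x by near: x; exact: nbhs_pinfty_gt.
have ex : e `^ (- r^-1) <= x by near: x; exact/nbhs_pinfty_ge/num_real.
rewrite ger0_norm ?powR_ge0// powRN.
have -> : e = ((e `^ (- r^-1)) `^ r)^-1.
  by rewrite -powRrM mulNr mulVf ?gt_eqF// powRN invrK powRr1// ltW.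
rewrite lef_pV2 ?posrE ?powR_gt0//.
by apply: ge0_ler_powR; rewrite ?nnegrE ?powR_ge0// ltW.
Unshelve. all: by end_near. Qed.

(** Half-lines that depend on an outer variable become indicators, so that Tonelli's theorem applies
    on a fixed product space. *)
Lemma integral_gt_if (f : R -> \bar R) (a : R) :
  (\int[mu]_(x in `]a, +oo[) f x = \int[mu]_x (if (a < x)%R then f x else 0))%E.
Proof.
rewrite integral_mkcond; apply: eq_integral => x _.
by rewrite patchE mem_setE in_itv /= andbT.
Qed.

Lemma gtail_if (g z : R) :
  gtail g z = (\int[mu]_x (if (z < x)%R then gdens g x else 0%R)%:E)%E.
Proof.
by rewrite /gtail integral_gt_if; apply: eq_integral => x _; case: ifP.
Qed.

Lemma measurable_gtail (g : R) : measurable_fun setT (gtail g).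
Proof.
pose h (p : R * R) := (if (p.1 < p.2)%R then gdens g p.2 else 0%R)%:E.
have mh : measurable_fun setT h.
  apply/measurable_EFinP; apply: measurable_fun_ifT => //.
    exact: measurable_fun_ltr.
  by apply: measurableT_comp => //; exact: measurable_gdens.
have h0 p : (0 <= h p)%E by rewrite lee_fin; case: ifP => // _; exact: gdens_ge0.
rewrite (_ : gtail g = fubini_F mu h).
  exact: measurable_fun_fubini_tonelli_F.
by apply/funext => z; rewrite gtail_if.
Qed.

(* Scaling reduces pconv g b M to pconv g b (M / s) 1, an incomplete Beta integral. *)
Definition pconv (g b M s : R) : \bar R :=
  \int[mu]_x (if (M < x) && (M < s - x) then x `^ g * (s - x) `^ b else 0)%:E.

Lemma measurable_pconv_integrand (g b M : R) :
  measurable_fun setT (fun p : R * R =>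
    if (M < p.1) && (M < p.2 - p.1) then p.1 `^ g * (p.2 - p.1) `^ b else 0).
Proof.
have mB : measurable_fun setT (fun p : R * R => p.2 - p.1).
  exact: measurable_funB.
apply: measurable_fun_ifT => //.
  by apply: measurable_and; exact: measurable_fun_ltr.
by apply: measurable_funM; apply: (measurableT_comp (measurable_powR _)).
Qed.

Lemma pconv_integrand_ge0 (g b M x s : R) :
  0 <= if (M < x) && (M < s - x) then x `^ g * (s - x) `^ b else 0.
Proof. by case: ifP => // _; rewrite mulr_ge0 ?powR_ge0. Qed.

Lemma pconv_ge0 g b M s : (0 <= pconv g b M s)%E.
Proof. by apply: integral_ge0 => x _; rewrite lee_fin pconv_integrand_ge0. Qed.

Lemma measurable_pconv_integrand1 (g b M s : R) :
  measurable_fun setT (fun x : R =>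
    (if (M < x) && (M < s - x) then x `^ g * (s - x) `^ b else 0)%:E).
Proof.
apply/measurable_EFinP.
exact: (measurableT_comp (measurable_pconv_integrand g b M) (measurable_pair2 s)).
Qed.

(* Mass which the product of the densities [gdens g] and [gdens b] gives to the
   corner [x > M, y > M, x + y > z]. *)
Definition corner_mass (g b M z : R) : \bar R :=
  \int[mu]_x (if (M < x)%R then (gdens g x)%:E * gtail b (Num.max M (z - x)%R) else 0).

(** In the variable s = x + y the product of the two exponentials depends on s alone; after Tonelli
    it leaves the integral over x, and what remains is [pconv]. *)
Lemma corner_massE (g b M z : R) : 0 <= M ->
  corner_mass g b M z =
  (\int[mu]_(s in `]z, +oo[) ((expR (- s))%:E * pconv g b M s))%E.
Proof.
move=> M0.
pose K (p : R * R) := ((if (z < p.2)%R then expR (- p.2) else 0%R) *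
  (if (M < p.1) && (M < p.2 - p.1) then p.1 `^ g * (p.2 - p.1) `^ b else 0))%:E.
have mK : measurable_fun setT K.
  apply/measurable_EFinP; apply: measurable_funM.
    apply: measurable_fun_ifT => //; first exact: measurable_fun_ltr.
    by apply: measurableT_comp => //; exact: measurable_funN.
  exact: measurable_pconv_integrand.
have K0 p : (0 <= K p)%E.
  rewrite lee_fin mulr_ge0 ?pconv_integrand_ge0//.
  by case: ifP => // _; exact: expR_ge0.
transitivity (\int[mu]_x \int[mu]_s K (x, s))%E.
  rewrite /corner_mass; apply: eq_integral => x _; case: ifPn => Mx; last first.
    rewrite (_ : (fun s => K (x, s)) = cst 0%E) ?integral0//.
    by apply/funext => s; rewrite /K /= (negbTE Mx) /= mulr0.
  pose f (y : R) := (if (Num.max M (z - x) < y)%R then gdens b y else 0%R)%:E.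
  rewrite gtail_if -/(integral mu setT f).
  have mf : measurable_fun setT f.
    apply/measurable_EFinP; apply: measurable_fun_ifT => //.
      exact: measurable_fun_ltr.
    exact: measurable_gdens.
  have f0 y : (0 <= f y)%E by rewrite lee_fin; case: ifP => // _; exact: gdens_ge0.
  have mfx : measurable_fun setT (fun s : R => f (s + - x)%R).
    by apply: measurableT_comp => //; exact: measurable_funD.
  have G0 : (0 <= (gdens g x)%:E)%E by rewrite lee_fin gdens_ge0.
  rewrite (@ge0_integral_shift _ _ (- x))// -ge0_integralZl//; last first.
    by move=> s _; exact: f0.
  apply: eq_integral => s _; rewrite /f /K /= -EFinM Mx /=; congr EFin.
  rewrite gt_max ltrD2r andbC.
  case: (ltP z s) => zs /=; last by rewrite mulr0 mul0r.
  case: ifP => _; last by rewrite !mulr0.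
  rewrite /gdens (_ : - s = - x + - (s - x)); last by ring.
  by rewrite expRD; ring.
transitivity (\int[mu]_s \int[mu]_x K (x, s))%E.
  exact: (fubini_tonelli (m1 := mu) (m2 := mu) K mK K0).
rewrite integral_gt_if; apply: eq_integral => s _.
case: ifPn => zs; last first.
  rewrite (_ : (fun x => K (x, s)) = cst 0%E) ?integral0//.
  by apply/funext => x; rewrite /K /= (negbTE zs) mul0r.
rewrite /pconv -ge0_integralZl//.
- by apply: eq_integral => x _; rewrite /K /= zs EFinM.
- exact: measurable_pconv_integrand1.
- by move=> x _; rewrite lee_fin pconv_integrand_ge0.
Qed.

Lemma pconv_scale (g b M s : R) : 0 <= M -> 0 < s ->
  pconv g b M s = ((s `^ (g + b + 1))%:E * pconv g b (M / s) 1)%E.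
Proof.
move=> M0 s0; rewrite /pconv (ge0_integral_scale s0); last 2 first.
- exact: measurable_pconv_integrand1.
- by move=> x; rewrite lee_fin pconv_integrand_ge0.
have sp : s `^ (g + b + 1) = s * s `^ (g + b).
  by rewrite powRD ?(gt_eqF s0) ?implybT// powRr1 ?ltW// mulrC.
rewrite sp EFinM -muleA; congr (_ * _)%E.
rewrite -ge0_integralZl//; last 3 first.
- exact: measurable_pconv_integrand1.
- by move=> x _; rewrite lee_fin pconv_integrand_ge0.
- by rewrite lee_fin powR_ge0.
apply: eq_integral => x _; rewrite -EFinM; congr EFin.
rewrite !ltr_pdivrMr// (_ : s - s * x = (1 - x) * s); last by ring.
rewrite [s * x]mulrC; case: ifPn => [/andP[Mx Mx']|_]; last by rewrite mulr0.
have x0 : 0 <= x by rewrite -(pmulr_lge0 _ s0) (le_trans M0)// ltW.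
have x1 : 0 <= 1 - x by rewrite -(pmulr_lge0 _ s0) (le_trans M0)// ltW.
rewrite !powRM ?(ltW s0)// powRD ?(gt_eqF s0) ?implybT//.
by ring.
Qed.

Lemma pconv_nincr (g b M M' s : R) : M <= M' -> (pconv g b M' s <= pconv g b M s)%E.
Proof.
move=> MM'; apply: ge0_le_integral => //.
- by move=> x _; rewrite lee_fin pconv_integrand_ge0.
- exact: measurable_pconv_integrand1.
- exact: measurable_pconv_integrand1.
- move=> x _; rewrite lee_fin; case: ifPn => [/andP[Mx Mx']|_].
    by rewrite (le_lt_trans MM' Mx) (le_lt_trans MM' Mx').
  exact: pconv_integrand_ge0.
Qed.

Lemma measurable_pconv (g b M : R) : measurable_fun setT (pconv g b M).
Proof.
pose h (p : R * R) :=
  (if (M < p.1) && (M < p.2 - p.1) then p.1 `^ g * (p.2 - p.1) `^ b else 0)%:E.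
have mh : measurable_fun setT h.
  by apply/measurable_EFinP; exact: measurable_pconv_integrand.
have h0 p : (0 <= h p)%E by rewrite lee_fin pconv_integrand_ge0.
exact: (measurable_fun_fubini_tonelli_G (m1 := mu) h).
Qed.

Lemma measurable_exp_pconv (g b M : R) (D : set R) :
  measurable_fun D (fun s : R => (expR (- s))%:E * pconv g b M s)%E.
Proof.
apply: measurable_funTS; apply: emeasurable_funM; last exact: measurable_pconv.
by apply/measurable_EFinP; apply: measurableT_comp => //; exact: measurable_funN.
Qed.

Lemma exp_pconv_ge0 (g b M s : R) : (0 <= (expR (- s))%:E * pconv g b M s)%E.
Proof. by rewrite mule_ge0 ?pconv_ge0// lee_fin expR_ge0. Qed.

Lemma gtail_mulE (g z : R) (B : \bar R) : (0 <= B)%E ->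
  (B * gtail g z = \int[mu]_(s in `]z, +oo[) (B * (gdens g s)%:E))%E.
Proof.
move=> B0; rewrite ge0_integralZl//.
  by apply/measurable_EFinP; exact: measurable_gdens.
by move=> s _; rewrite lee_fin gdens_ge0.
Qed.

Lemma measurable_mul_gdens (g : R) (B : \bar R) (D : set R) :
  measurable_fun D (fun s : R => B * (gdens g s)%:E)%E.
Proof.
by apply: measurable_funeM; apply/measurable_EFinP; exact: measurable_gdens.
Qed.

(** After scaling, the density of the sum is [gdens (g + b + 1)] times an incomplete Beta factor
    that increases to the full Beta integral as [s] grows. This is the source of the shape of the
    sum; bounding the factor from either side gives [corner_mass_le] and [corner_mass_ge]. *)
Lemma exp_pconvE (g b M s : R) : 0 <= M -> 0 < s ->
  ((expR (- s))%:E * pconv g b M s =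
   pconv g b (M / s) 1 * (gdens (g + b + 1) s)%:E)%E.
Proof.
move=> M0 s0; rewrite pconv_scale// muleA -EFinM muleC.
by rewrite /gdens [expR _ * _]mulrC.
Qed.

Lemma corner_mass_le (g b M z : R) : 0 <= M -> 0 <= z ->
  (corner_mass g b M z <= pconv g b 0 1 * gtail (g + b + 1) z)%E.
Proof.
move=> M0 z0; rewrite corner_massE// gtail_mulE ?pconv_ge0//.
apply: ge0_le_integral => //.
- by move=> s _; exact: exp_pconv_ge0.
- exact: measurable_exp_pconv.
- exact: measurable_mul_gdens.
- move=> s; rewrite /= in_itv /= andbT => zs.
  have s0 : 0 < s by exact: le_lt_trans zs.
  rewrite exp_pconvE// lee_wpmul2r ?lee_fin ?gdens_ge0//.
  by apply: pconv_nincr; rewrite divr_ge0// ltW.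
Qed.

Lemma corner_mass_ge (g b M z e : R) : 0 <= M -> 0 < z -> M <= e * z ->
  (pconv g b e 1 * gtail (g + b + 1) z <= corner_mass g b M z)%E.
Proof.
move=> M0 z0 Mez; rewrite corner_massE// gtail_mulE ?pconv_ge0//.
apply: ge0_le_integral => //.
- by move=> s _; rewrite mule_ge0 ?pconv_ge0// lee_fin gdens_ge0.
- exact: measurable_mul_gdens.
- exact: measurable_exp_pconv.
- move=> s; rewrite /= in_itv /= andbT => zs.
  have s0 : 0 < s by exact: lt_trans zs.
  rewrite exp_pconvE// lee_wpmul2r ?lee_fin ?gdens_ge0//.
  apply: pconv_nincr; rewrite ler_pdivrMr// (le_trans Mez)//.
  have e0 : 0 <= e by rewrite -(pmulr_lge0 _ z0) (le_trans M0).
  by rewrite ler_wpM2l// ltW.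
Qed.

Lemma corner_mass0 (g b : R) : corner_mass g b 0 0 = (gtail g 0 * gtail b 0)%E.
Proof.
rewrite muleC gtail_mulE ?gtail_ge0// integral_gt_if /corner_mass.
apply: eq_integral => x _; case: ifP => // x0.
rewrite (_ : Num.max 0 (0 - x) = 0) 1?muleC//.
by apply/max_idPl; rewrite sub0r oppr_le0 ltW.
Qed.

(** The mass of the whole quadrant computed twice, as a product and through the sum: the classical
    identity between the Beta and Gamma functions, in a form that allows infinite values. *)
Lemma gtail_prod (g b : R) :
  (gtail g 0 * gtail b 0 = pconv g b 0 1 * gtail (g + b + 1) 0)%E.
Proof.
rewrite -corner_mass0 corner_massE// gtail_mulE ?pconv_ge0//.
apply: eq_integral => s; rewrite inE /= in_itv /= andbT => s0.
by rewrite exp_pconvE// mul0r.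
Qed.

(** Monotone convergence on the intervals from 1/(n+1) to 1 - 1/(n+1), which exhaust the open unit
    interval. *)
Lemma pconv_cvg0 (g b : R) : pconv g b (n.+1%:R^-1) 1 @[n --> \oo] --> pconv g b 0 1.
Proof.
pose f (x : R) := (x `^ g * (1 - x) `^ b)%:E.
have fE M : pconv g b M 1 = (\int[mu]_(x in `]M, (1 - M)%R[) f x)%E.
  rewrite integral_mkcond; apply: eq_integral => x _.
  rewrite patchE mem_setE in_itv /= [in RHS]ltrBrDl -ltrBrDr.
  by rewrite /f; case: ifP.
have -> : (fun n => pconv g b (n.+1%:R^-1) 1) =
    (fun n => \int[mu]_(x in `]n.+1%:R^-1%R, (1 - n.+1%:R^-1)%R[) f x)%E.
  by apply/funext => n; rewrite fE.
have -> : pconv g b 0 1 =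
    (\int[mu]_(x in \bigcup_n [set` `]n.+1%:R^-1%R, (1 - n.+1%:R^-1)%R[]) f x)%E.
  rewrite fE; congr (integral _ _ _); apply/seteqP; split => x /=.
    rewrite in_itv /= subr0 => /andP[x0 x1].
    pose m := Num.min x (1 - x).
    have m0 : 0 < m by rewrite lt_min x0 subr_gt0.
    exists (Num.bound m^-1) => //=; rewrite in_itv /=.
    have : (Num.bound m^-1).+1%:R^-1 < m.
      rewrite invf_plt ?posrE// (lt_trans (archi_boundP _)) ?invr_ge0 1?ltW//.
      by rewrite ltr_nat.
    by rewrite /m lt_min => /andP[-> h] /=; rewrite ltrBrDl -ltrBrDr.
  move=> [n _ /=]; rewrite !in_itv /= subr0 => /andP[h1 h2].
  have n0 : 0 < n.+1%:R^-1 :> R by rewrite invr_gt0.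
  by move: (n.+1%:R^-1) n0 h1 h2 => q *; apply/andP; split; lra.
apply: ge0_nondecreasing_set_cvg_integral => //.
- move=> n m nm; apply/subsetPset => x /=; rewrite !in_itv /= => /andP[h1 h2].
  have h : m.+1%:R^-1 <= n.+1%:R^-1 :> R by rewrite lef_pV2 ?posrE// ler_nat.
  by rewrite (le_lt_trans h h1) (lt_le_trans h2)// lerB.
- move=> n; apply: measurable_funTS; apply/measurable_EFinP.
  apply: measurable_funM; first exact: measurable_powR.
  by apply: (measurableT_comp (measurable_powR _)); exact: measurable_funB.
- by move=> n x _; rewrite lee_fin mulr_ge0 ?powR_ge0.
Qed.

End gamma_convolution.

(** * Finiteness, the Beta integral, and the corner for shapes below -1 *)

Section gamma_finite.
Context {R : realType}.
Local Notation mu := (@lebesgue_measure R).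

Lemma integral_powR_itv (g a b : R) : g != -1 -> 0 < a -> a < b ->
  (\int[mu]_(x in `[a, b]) (x `^ g)%:E =
   ((b `^ (g + 1) - a `^ (g + 1)) / (g + 1))%:E)%E.
Proof.
move=> g1 a0 ab.
have g10 : g + 1 != 0 by rewrite addr_eq0.
pose F (x : R) := (g + 1)^-1 * x `^ (g + 1).
have dF (x : R) : 0 < x -> is_derive x 1 F (x `^ g).
  move=> x0; have dP := is_derive_powR (g + 1) x0.
  apply: (is_derive_eq (@is_deriveZ _ _ _ (@powR R ^~ (g + 1)) (g + 1)^-1 x 1 _ dP)).
  by rewrite /GRing.scale /= addrK mulKf.
have cF x : 0 < x -> {for x, continuous F}.
  move=> x0; apply: differentiable_continuous; apply/derivable1_diffP.
  by have [] := dF x x0.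
rewrite (@continuous_FTC2 _ _ F)//.
- by rewrite -EFinB /F -mulrBr mulrC.
- apply: continuous_in_subspaceT => x; rewrite inE /= in_itv /= => /andP[ax _].
  apply: differentiable_continuous; apply/derivable1_diffP.
  by have [] := is_derive_powR g (lt_le_trans a0 ax).
- split.
  + by move=> x; rewrite in_itv /= => /andP[ax _]; have [] := dF x (lt_trans a0 ax).
  + by apply: cvg_at_right_filter; exact: cF.
  + by apply: cvg_at_left_filter; apply: cF; exact: lt_trans ab.
- move=> x; rewrite in_itv /= => /andP[ax _].
  have d := dF x (lt_trans a0 ax).
  by rewrite derive1E derive_val.
Qed.

Lemma measurable_EFin_powR (g : R) (D : set R) :
  measurable_fun D (fun x : R => (x `^ g)%:E).
Proof. by apply/measurable_EFinP/measurable_funTS; exact: measurable_powR. Qed.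

Lemma integral_powR_0 (g z : R) : -1 < g -> 0 < z ->
  (\int[mu]_(x in `]0%R, z]) (x `^ g)%:E <= (z `^ (g + 1) / (g + 1))%:E)%E.
Proof.
move=> g1 z0; have g10 : 0 < g + 1 by rewrite -ltrBlDr sub0r.
(* The divisor starts at 2 because [integral_powR_itv] asks for a nondegenerate interval. *)
pose F n := [set` `[z / n.+2%:R, z]] : set R.
have -> : `]0, z]%classic = \bigcup_n F n.
  apply/seteqP; split => x /=.
    rewrite in_itv /= => /andP[x0 xz]; exists (Num.bound (z / x)) => //=.
    rewrite /F /= in_itv /= xz andbT ler_pdivrMr// mulrC -ler_pdivrMr//.
    rewrite ltW// (lt_le_trans (archi_boundP _))//; first by rewrite divr_ge0// ltW.
    by rewrite ler_nat; exact: leq_trans (leqnSn _).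
  move=> [n _]; rewrite /F /= !in_itv /= => /andP[h ->]; rewrite andbT.
  by apply: lt_le_trans h; rewrite divr_gt0.
have cvgF : (\int[mu]_(x in F n) (x `^ g)%:E @[n --> \oo] -->
    \int[mu]_(x in \bigcup_n F n) (x `^ g)%:E)%E.
  apply: ge0_nondecreasing_set_cvg_integral.
  - move=> n m nm; apply/subsetPset => x /=; rewrite /F /= !in_itv /= => /andP[h ->].
    rewrite andbT; apply: le_trans h; rewrite ler_pM2l// lef_pV2 ?posrE//.
    by rewrite ler_nat !ltnS.
  - by move=> n; exact: measurable_itv.
  - by move=> n; exact: measurable_EFin_powR.
  - by move=> n x _; rewrite lee_fin powR_ge0.
rewrite -(cvg_lim _ cvgF)//; apply: lime_le; first by apply/cvg_ex; eexists; exact: cvgF.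
apply: nearW => n; rewrite integral_powR_itv//.
- rewrite lee_fin ler_pM2r ?invr_gt0// lerBlDr lerDl powR_ge0//.
- by rewrite gt_eqF.
- by rewrite divr_gt0.
- by rewrite ltr_pdivrMr// ltr_pMr// ltr1n.
Qed.

Lemma integral_powR_oo (g M : R) : g < -1 -> 0 < M ->
  (\int[mu]_(x in `[M, +oo[) (x `^ g)%:E <= (M `^ (g + 1) / - (g + 1))%:E)%E.
Proof.
move=> g1 M0; have g10 : 0 < - (g + 1) by rewrite oppr_gt0 -ltrBrDr sub0r.
pose F n := [set` `[M, M + n.+1%:R]] : set R.
have -> : `[M, +oo[%classic = \bigcup_n F n.
  apply/seteqP; split => x /=.
    rewrite in_itv /= andbT => Mx; exists (Num.bound x) => //=.
    rewrite /F /= in_itv /= Mx /= (@le_trans _ _ (Num.bound x)%:R)//.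
      rewrite ltW// archi_boundP// (le_trans _ Mx)// ltW//.
    by rewrite -[leLHS]add0r lerD ?(ltW M0)// ler_nat.
  by move=> [n _]; rewrite /F /= !in_itv /= => /andP[->].
have cvgF : (\int[mu]_(x in F n) (x `^ g)%:E @[n --> \oo] -->
    \int[mu]_(x in \bigcup_n F n) (x `^ g)%:E)%E.
  apply: ge0_nondecreasing_set_cvg_integral.
  - move=> n m nm; apply/subsetPset => x /=; rewrite /F /= !in_itv /= => /andP[-> h] /=.
    by apply: le_trans h _; rewrite lerD2l ler_nat ltnS.
  - by move=> n; exact: measurable_itv.
  - by move=> n; exact: measurable_EFin_powR.
  - by move=> n x _; rewrite lee_fin powR_ge0.
rewrite -(cvg_lim _ cvgF)//; apply: lime_le; first by apply/cvg_ex; eexists; exact: cvgF.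
apply: nearW => n; rewrite integral_powR_itv//.
- have -> (A B : R) : (B - A) / (g + 1) = (A - B) / - (g + 1).
    by rewrite invrN mulrN -mulNr opprB.
  by rewrite lee_fin ler_pM2r ?invr_gt0// gerBl powR_ge0.
- by rewrite lt_eqF.
- by rewrite ltrDl.
Qed.

Lemma gtail_nincr (g z z' : R) : z <= z' -> (gtail g z' <= gtail g z)%E.
Proof.
move=> zz'; apply: ge0_subset_integral => //.
- by apply/measurable_EFinP; exact: measurable_gdens.
- by move=> x _; rewrite lee_fin gdens_ge0.
- by move=> x /=; rewrite !in_itv /= !andbT; exact: le_lt_trans.
Qed.

Lemma gtail_gt0 (g z : R) : (0 < gtail g z)%E.
Proof.
have [x [x1 /(_ (Num.max x z))]] := near_pinfty_ge1
  (gtail_near g (ltac:(by []) : 0 < 2^-1 :> R) (ltac:(by rewrite invf_lt1 ?ltr1n) : 2^-1 < 1 :> R)).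
rewrite le_max lexx => /(_ isT)[fT h _].
apply: lt_le_trans (gtail_nincr g (_ : z <= Num.max x z)); last first.
  by rewrite le_max lexx orbT.
rewrite -(fineK fT) lte_fin (lt_le_trans _ h)// mulr_gt0//.
  by rewrite subr_gt0 invf_lt1// ltr1n.
by apply: gdens_gt0; rewrite lt_max (lt_le_trans _ x1).
Qed.

Lemma gtail_fin (g : R) : -1 < g -> (gtail g 0 < +oo)%E.
Proof.
move=> g1.
have [z [z1 /(_ _ (lexx _))[fT _ _]]] := near_pinfty_ge1
  (gtail_near g (ltac:(by []) : 0 < 2^-1 :> R) (ltac:(by rewrite invf_lt1 ?ltr1n) : 2^-1 < 1 :> R)).
have z0 : 0 < z by exact: lt_le_trans z1.
have E : `]0, +oo[%classic = `]0, z] `|` `]z, +oo[ :> set R.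
  apply/seteqP; split => x /=; rewrite !in_itv /= !andbT.
    by move=> ->; case: (leP x z) => ?; [left|right].
  by move=> [/andP[]//|]; exact: lt_trans.
rewrite /gtail E ge0_integral_setU//; last 3 first.
- by apply/measurable_EFinP; exact: measurable_gdens.
- by move=> x _; rewrite lee_fin gdens_ge0.
- apply/disj_setPS => x [] /=; rewrite !in_itv /= andbT => /andP[_ xz].
  by rewrite ltNge xz.
- apply: lte_add_pinfty; last by rewrite -ge0_fin_numE// gtail_ge0.
  apply: le_lt_trans (le_lt_trans (integral_powR_0 g1 z0) (ltry _)).
  apply: ge0_le_integral => //.
  + by move=> x _; rewrite lee_fin gdens_ge0.
  + by apply/measurable_EFinP; exact: measurable_gdens.
  + exact: measurable_EFin_powR.
  + move=> x; rewrite /= in_itv /= => /andP[x0 _]; rewrite lee_fin.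
    by rewrite /gdens ler_piMr ?powR_ge0// -expR0 ler_expR oppr_le0 ltW.
Qed.

Lemma gtail_fin_num (g z : R) : -1 < g -> 0 <= z -> gtail g z \is a fin_num.
Proof.
move=> g1 z0; rewrite ge0_fin_numE ?gtail_ge0//.
exact: le_lt_trans (gtail_nincr g z0) (gtail_fin g1).
Qed.

Lemma GammaE (a : R) : Gamma a = fine (gtail (a - 1) 0).
Proof. by []. Qed.

Lemma Gamma_gt0 (a : R) : 0 < a -> 0 < Gamma a.
Proof.
move=> a0; rewrite GammaE fine_gt0// gtail_gt0 gtail_fin//.
by rewrite ltrBrDr addrC subrr.
Qed.

Lemma pconv_Beta (g b : R) : -1 < g -> -1 < b ->
  pconv g b 0 1 = (Gamma (g + 1) * Gamma (b + 1) / Gamma (g + b + 2))%:E.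
Proof.
move=> g1 b1.
have gb1 : -1 < g + b + 1 by lra.
have := gtail_prod g b.
rewrite -(fineK (gtail_fin_num g1 (lexx 0))) -(fineK (gtail_fin_num b1 (lexx 0))).
rewrite -(fineK (gtail_fin_num gb1 (lexx 0))).
have -> : Gamma (g + 1) = fine (gtail g 0) by rewrite GammaE addrK.
have -> : Gamma (b + 1) = fine (gtail b 0) by rewrite GammaE addrK.
have -> : Gamma (g + b + 2) = fine (gtail (g + b + 1) 0).
  by rewrite GammaE; congr (fine (gtail _ _)); ring.
have T0 : 0 < fine (gtail (g + b + 1) 0).
  by rewrite fine_gt0// gtail_gt0 gtail_fin.
move: (fine (gtail (g + b + 1) 0)) T0 => t t0; rewrite -EFinM.
(* An infinite value times the positive mass [t] would be infinite, against the finite left-hand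
   side. *)
case: (pconv g b 0 1) => [p| |].
- by rewrite -EFinM => -[->]; rewrite mulfK// gt_eqF.
- by rewrite gt0_mulye// ?lte_fin.
- by rewrite gt0_mulNye// ?lte_fin.
Qed.

(** On x + y = s one coordinate is at least s / 2, and its power is at most (s / 2)^b because b < 0.
    The other power is integrated over all values above [M], with a finite result as b < -1. The
    factor 2 counts the two cases and 2^(-b) comes from the halving. *)
Lemma corner_mass_le_ltN1 (b M z : R) : b < -1 -> 0 < M -> 0 <= z ->
  (corner_mass b b M z <=
   (2 * 2 `^ (- b) * (M `^ (b + 1) / - (b + 1)))%:E * gtail b z)%E.
Proof.
move=> b1 M0 z0; rewrite corner_massE ?(ltW M0)//.
have D0 : 0 <= M `^ (b + 1) / - (b + 1).
  by rewrite divr_ge0 ?powR_ge0// oppr_ge0; lra.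
have C0 : 0 <= 2 * 2 `^ (- b) * (M `^ (b + 1) / - (b + 1)).
  by rewrite mulr_ge0// mulr_ge0// powR_ge0.
rewrite gtail_mulE ?lee_fin//.
apply: ge0_le_integral => //.
- by move=> s _; exact: exp_pconv_ge0.
- exact: measurable_exp_pconv.
- exact: measurable_mul_gdens.
move=> s; rewrite /= in_itv /= andbT => zs.
have s0 : 0 < s by exact: le_lt_trans zs.
have b0 : b <= 0 by lra.
have decr (x y : R) : 0 < x -> x <= y -> y `^ b <= x `^ b.
  move=> x0 xy; have y0 := lt_le_trans x0 xy.
  have E (u : R) : u `^ b = (u `^ (- b))^-1 by rewrite powRN invrK.
  rewrite !E lef_pV2 ?posrE ?powR_gt0//.
  by apply: ge0_ler_powR; rewrite ?nnegrE ?oppr_ge0// ltW// (lt_le_trans _ xy).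
pose k (x : R) := (if M < x then x `^ b else 0)%:E.
have mk : measurable_fun setT k.
  apply/measurable_EFinP; apply: measurable_fun_ifT => //.
  exact: measurable_fun_ltr.
have k0 x : (0 <= k x)%E.
  by rewrite /k; case: ifP => // _; rewrite lee_fin powR_ge0.
have kD : (\int[mu]_x k x <= (M `^ (b + 1) / - (b + 1))%:E)%E.
  apply: le_trans (integral_powR_oo b1 M0).
  rewrite -integral_itv_obnd_cbnd; last exact: measurable_EFin_powR.
  by rewrite integral_gt_if; rewrite le_eqVlt; apply/orP; left; apply/eqP;
    apply: eq_integral => x _; rewrite /k; case: ifP.
have kD' : (\int[mu]_x k (s - x)%R <= (M `^ (b + 1) / - (b + 1))%:E)%E.
  apply: le_trans kD; rewrite (ge0_integral_opp mk k0).
  rewrite (@ge0_integral_shift _ (fun x => k (- x)%R) (- s)).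
  - by under [leRHS]eq_integral do rewrite opprD opprK addrC.
  - by apply: measurableT_comp => //; exact: measurable_funN.
  - by move=> x; exact: k0.
have mks : measurable_fun setT (fun x : R => k (s - x)%R).
  by apply: measurableT_comp => //; exact: measurable_funB.
have pc : (pconv b b M s <= (2 * (s / 2) `^ b * (M `^ (b + 1) / - (b + 1)))%:E)%E.
  apply: (@le_trans _ _ (\int[mu]_x (((s / 2) `^ b)%:E * (k x + k (s - x)%R)))%E).
    apply: ge0_le_integral => //.
    - by move=> x _; rewrite lee_fin pconv_integrand_ge0.
    - exact: measurable_pconv_integrand1.
    - by apply: measurable_funeM; exact: emeasurable_funD.
    - move=> x _; rewrite /k -EFinD -EFinM lee_fin.
      case: (ltP M x) => Mx; case: (ltP M (s - x)) => Msx /=;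
        rewrite ?addr0 ?add0r ?mulr0 ?mulr_ge0 ?powR_ge0//.
      rewrite mulrDr; have x0 := lt_trans M0 Mx; have y0 := lt_trans M0 Msx.
      have [xs|xs] := leP x (s / 2).
        have h : s / 2 <= s - x by lra.
        have := decr _ _ (ltac:(by rewrite divr_gt0) : 0 < s / 2) h.
        move=> {}h; apply: (@le_trans _ _ ((s / 2) `^ b * x `^ b)).
          by rewrite mulrC ler_wpM2r ?powR_ge0.
        by rewrite lerDl mulr_ge0 ?powR_ge0.
      have := decr _ _ (ltac:(by rewrite divr_gt0) : 0 < s / 2) (ltW xs).
      move=> {}h; apply: (@le_trans _ _ ((s / 2) `^ b * (s - x) `^ b)).
        by rewrite ler_wpM2r ?powR_ge0.
      by rewrite lerDr mulr_ge0 ?powR_ge0.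
  rewrite ge0_integralZl//; last 3 first.
  - exact: emeasurable_funD.
  - by move=> x _; rewrite adde_ge0.
  - by rewrite lee_fin powR_ge0.
  rewrite ge0_integralD//.
  rewrite (_ : 2 * _ * _ = (s / 2) `^ b * (M `^ (b + 1) / - (b + 1) + M `^ (b + 1) / - (b + 1))); last by ring.
  rewrite [leRHS]EFinM lee_wpmul2l ?lee_fin ?powR_ge0// EFinD.
  exact: leeD.
apply: (@le_trans _ _ ((expR (- s))%:E * (2 * (s / 2) `^ b * (M `^ (b + 1) / - (b + 1)))%:E)%E).
  by rewrite lee_wpmul2l// lee_fin expR_ge0.
rewrite -!EFinM lee_fin /gdens powRM ?(ltW s0) ?invr_ge0//.
have -> : (2^-1 : R) `^ b = 2 `^ (- b) by rewrite -powR_inv1// -powRrM mulN1r.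
by rewrite le_eqVlt; apply/orP; left; apply/eqP; ring.
Qed.

End gamma_finite.

(** * From model densities to tails *)

Section corner.
Context {d : measure_display} {T : measurableType d} {R : realType}.
Variable P : probability T R.
Local Notation mu := (@lebesgue_measure R).
Implicit Types U V : T -> R.

Definition corner U V (M z : R) : set T :=
  [set w | [/\ M < U w, M < V w & z < U w + V w]].

Lemma measurable_tail U : measurable_fun setT U -> measurable_fun setT (tail P U).
Proof.
move=> mU; have h x y : x <= y -> tail P U y <= tail P U x by exact: tail_nincr.
by apply: nonincreasing_measurable => // x y _ _; exact: h.
Qed.

Lemma measurable_corner U V M z : measurable_fun setT U -> measurable_fun setT V ->
  measurable (corner U V M z).
Proof.
move=> mU mV.
have -> : corner U V M z = [set w | M < U w] `&` [set w | M < V w] `&`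
    [set w | z < U w + V w].
  by apply/seteqP; split => w /=; [move=> []|move=> [[]]].
have mUV : measurable_fun setT (fun w => U w + V w) by exact: measurable_funD.
by apply: measurableI; [apply: measurableI|]; exact: measurable_gt.
Qed.

Lemma corner_probE U V M z : measurable_fun setT U -> measurable_fun setT V ->
  indep2 P U V ->
  (P (corner U V M z) =
   \int[P]_w (if (M < V w)%R then tail P U (Num.max M (z - V w)) else 0%R)%:E)%E.
Proof.
move=> mU mV UV.
pose S := [set p : R * R | [/\ M < p.1, M < p.2 & z < p.1 + p.2]].
have mS : measurable S.
  have -> : S = [set p | M < p.1] `&` [set p | M < p.2] `&`
      [set p | z < p.1 + p.2].
    by apply/seteqP; split => w /=; [move=> []|move=> [[]]].
  have m12 : measurable_fun [set: R * R] (fun p => p.1 + p.2) by exact: measurable_funD.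
  by apply: measurableI; [apply: measurableI|]; apply: measurable_gt.
rewrite [LHS](indep2_prob mU mV UV mS); apply: eq_integral => w' _ /=.
case: ifPn => Vw.
  rewrite tailE//; congr (P _); apply/seteqP; split => w /=; rewrite gt_max.
    by move=> [/= -> _]; rewrite ltrBlDr.
  by rewrite ltrBlDr => /andP[].
rewrite (_ : [set w | _] = set0) ?measure0//; apply/seteqP; split => w //=.
by move=> [_ /=]; rewrite (negbTE Vw).
Qed.

(** Once the tail of [U] has been replaced by [gtail g], Tonelli's theorem moves the integration to
    the density [gdens g], against which the tail of [V] now stands; it can be replaced in turn. *)
Lemma gtail_exchange V (g M z : R) : measurable_fun setT V ->
  (\int[P]_w (if (M < V w)%R then gtail g (Num.max M (z - V w)%R) else 0) =
   \int[mu]_x (if (M < x)%R then (gdens g x * tail P V (Num.max M (z - x)))%:E else 0))%E.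
Proof.
move=> mV.
pose H (p : T * R) := (if (M < V p.1) && (Num.max M (z - V p.1) < p.2)
  then gdens g p.2 else 0)%:E.
have mV1 : measurable_fun setT (fun p : T * R => V p.1).
  exact: (measurableT_comp mV measurable_fst).
have mH : measurable_fun setT H.
  apply/measurable_EFinP; apply: measurable_fun_ifT => //.
    apply: measurable_and; apply: measurable_fun_ltr => //.
    by apply: measurable_maxr => //; exact: measurable_funB.
  by apply: measurableT_comp => //; exact: measurable_gdens.
have H0 p : (0 <= H p)%E by rewrite /H; case: ifP => // _; rewrite lee_fin gdens_ge0.
transitivity (\int[P]_w \int[mu]_x H (w, x))%E.
  apply: eq_integral => w _; case: ifPn => Mw.
    by rewrite gtail_if; apply: eq_integral => x _; rewrite /H /= Mw.
  rewrite (_ : (fun x => H (w, x)) = cst 0%E) ?integral0//.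
  by apply/funext => x; rewrite /H /= (negbTE Mw).
transitivity (\int[mu]_x \int[P]_w H (w, x))%E.
  exact: (fubini_tonelli (m1 := P) (m2 := mu) H mH H0).
apply: eq_integral => x _; case: ifPn => Mx; last first.
  rewrite (_ : (fun w => H (w, x)) = cst 0%E) ?integral0//.
  by apply/funext => w; rewrite /H /= gt_max (negbTE Mx) /= andbF.
rewrite EFinM tailE// -[X in P X]setIT -integral_indic//; last exact: measurable_gt.
rewrite -ge0_integralZl//; last 2 first.
- apply/measurable_EFinP; apply: measurable_indic; exact: measurable_gt.
- by rewrite lee_fin gdens_ge0.
apply: eq_integral => w _; rewrite /H /= -EFinM indicE; congr EFin.
rewrite gt_max Mx /= ltrBlDr addrC -ltrBlDr -gt_max.
rewrite (_ : (w \in _) = (Num.max M (z - x) < V w)); last first.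
  by apply/idP/idP; rewrite inE.
by case: ifP => _; rewrite ?mulr1 ?mulr0.
Qed.

Lemma measurable_gtail_max (g M z : R) :
  measurable_fun setT (fun x : R => gtail g (Num.max M (z - x))).
Proof.
apply: (measurableT_comp (measurable_gtail g)).
by apply: measurable_maxr => //; exact: measurable_funB.
Qed.

Section bounds.
Variables (U V : T -> R) (g b M z A B : R).
Hypotheses (mU : measurable_fun setT U) (mV : measurable_fun setT V)
  (UV : indep2 P U V) (A0 : 0 <= A) (B0 : 0 <= B).

Let mtU : measurable_fun setT
  (fun w => (if (M < V w)%R then tail P U (Num.max M (z - V w)) else 0%R)%:E).
Proof.
apply/measurable_EFinP; apply: measurable_fun_ifT => //.
  exact: measurable_fun_ltr.
apply: (measurableT_comp (measurable_tail mU)).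
by apply: measurable_maxr => //; exact: measurable_funB.
Qed.

Let mgU : measurable_fun setT
  (fun w => if (M < V w)%R then gtail g (Num.max M (z - V w)%R) else 0%E).
Proof.
apply: measurable_fun_ifT => //; first exact: measurable_fun_ltr.
exact: (measurableT_comp (measurable_gtail_max g M z)).
Qed.

Let mtV : measurable_fun setT
  (fun x : R => if (M < x)%R then (gdens g x * tail P V (Num.max M (z - x)))%:E else 0%E).
Proof.
apply: measurable_fun_ifT => //; first exact: measurable_fun_ltr.
apply/measurable_EFinP; apply: measurable_funM; first exact: measurable_gdens.
apply: (measurableT_comp (measurable_tail mV)).
by apply: measurable_maxr => //; exact: measurable_funB.
Qed.

Let mgV : measurable_fun setT (fun x : R =>
  if (M < x)%R then ((gdens g x)%:E * gtail b (Num.max M (z - x)%R))%E else 0%E).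
Proof.
apply: measurable_fun_ifT => //; first exact: measurable_fun_ltr.
apply: emeasurable_funM; last exact: measurable_gtail_max.
by apply/measurable_EFinP; exact: measurable_gdens.
Qed.

Let gU0 w : (0 <= if (M < V w)%R then gtail g (Num.max M (z - V w)%R) else 0)%E.
Proof. by case: ifP => // _; exact: gtail_ge0. Qed.

Let tU0 w : (0 <= (if (M < V w)%R then tail P U (Num.max M (z - V w)) else 0%R)%:E)%E.
Proof. by case: ifP => // _; rewrite lee_fin tail_ge0. Qed.

Let tV0 (x : R) :
  (0 <= if (M < x)%R then (gdens g x * tail P V (Num.max M (z - x)))%:E else 0)%E.
Proof. by case: ifP => // _; rewrite lee_fin mulr_ge0 ?gdens_ge0 ?tail_ge0. Qed.

Let gV0 (x : R) :
  (0 <= if (M < x)%R then (gdens g x)%:E * gtail b (Num.max M (z - x)%R) else 0)%E.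
Proof. by case: ifP => // _; rewrite mule_ge0 ?lee_fin ?gdens_ge0 ?gtail_ge0. Qed.

(** The tails are replaced one after the other, with [gtail_exchange] in between. Their arguments
    are maxima with [M], so a comparison above [M] is enough. *)
Lemma corner_prob_le :
  (forall x, M <= x -> ((tail P U x)%:E <= A%:E * gtail g x)%E) ->
  (forall x, M <= x -> ((tail P V x)%:E <= B%:E * gtail b x)%E) ->
  (P (corner U V M z) <= (A * B)%:E * corner_mass g b M z)%E.
Proof.
move=> hU hV; rewrite corner_probE//.
apply: (@le_trans _ _ (A%:E *
    \int[P]_w (if (M < V w)%R then gtail g (Num.max M (z - V w)%R) else 0))%E).
  rewrite -ge0_integralZl ?lee_fin//; apply: ge0_le_integral => //.
    exact: measurable_funeM.
  by move=> w _; case: ifPn => _; rewrite ?mule0// hU// le_max lexx.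
rewrite EFinM -muleA lee_wpmul2l ?lee_fin// gtail_exchange// /corner_mass.
rewrite -ge0_integralZl ?lee_fin//; apply: ge0_le_integral => //.
  exact: measurable_funeM.
move=> x _; case: ifPn => _; rewrite ?mule0// muleCA EFinM.
by rewrite lee_wpmul2l ?lee_fin ?gdens_ge0// hV// le_max lexx.
Qed.

Lemma corner_prob_ge :
  (forall x, M <= x -> (A%:E * gtail g x <= (tail P U x)%:E)%E) ->
  (forall x, M <= x -> (B%:E * gtail b x <= (tail P V x)%:E)%E) ->
  ((A * B)%:E * corner_mass g b M z <= P (corner U V M z))%E.
Proof.
move=> hU hV; rewrite corner_probE//.
apply: (@le_trans _ _ (A%:E *
    \int[P]_w (if (M < V w)%R then gtail g (Num.max M (z - V w)%R) else 0))%E); last first.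
  rewrite -ge0_integralZl ?lee_fin//; apply: ge0_le_integral => //.
  - by move=> w _; rewrite mule_ge0 ?lee_fin.
  - exact: measurable_funeM.
  - by move=> w _; case: ifPn => _; rewrite ?mule0// hU// le_max lexx.
rewrite EFinM -muleA lee_wpmul2l ?lee_fin// gtail_exchange// /corner_mass.
rewrite -ge0_integralZl ?lee_fin//; apply: ge0_le_integral => //.
- by move=> w _; rewrite mule_ge0 ?lee_fin.
- exact: measurable_funeM.
- move=> x _; case: ifPn => _; rewrite ?mule0// muleCA [leRHS]EFinM.
  by rewrite lee_wpmul2l ?lee_fin ?gdens_ge0// hV// le_max lexx.
Qed.

End bounds.

Definition gamma_tail U (A g : R) : Prop := tail P U z / gdens g z @[z --> +oo] --> A.

Lemma gamma_tail_gtail U A g e : 0 < A -> gamma_tail U A g -> 0 < e -> e < 1 ->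
  \forall x \near +oo,
    (((1 - e) * A)%:E * gtail g x <= (tail P U x)%:E)%E /\
    ((tail P U x)%:E <= ((1 + e) * A)%:E * gtail g x)%E.
Proof.
(* Two approximations are chained, of [tail] and of [gtail] by [gdens]. A quarter of [e] for each
   works: (1 - e) (1 + q) <= 1 - q and (1 + e) (1 - q) >= 1 + q. *)
move=> A0 UA e0 e1; pose q := e / 4.
have q0 : 0 < q by rewrite divr_gt0.
have q1 : q < 1 by rewrite /q; lra.
have Aq : 0 < A * q by rewrite mulr_gt0.
near=> x.
have x0 : 0 < x by near: x; exact: nbhs_pinfty_gt.
have [fT T1 T2] : [/\ gtail g x \is a fin_num, (1 - q) * gdens g x <= fine (gtail g x) &
      fine (gtail g x) <= (1 + q) * gdens g x] by near: x; exact: gtail_near.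
have : `|A - tail P U x / gdens g x| < A * q.
  by near: x; move/cvgrPdist_lt : UA; exact.
have G0 := gdens_gt0 g x0.
rewrite ltr_distlC => /andP[h1 h2]; move: h1 h2.
rewrite ltr_pdivlMr// ltr_pdivrMr// => h1 h2.
rewrite -(fineK fT) -!EFinM !lee_fin.
move: (fine _) T1 T2 => t T1 T2; move: (tail P U x) h1 h2 => u h1 h2.
move: (gdens g x) G0 T1 T2 h1 h2 => G G0 T1 T2 h1 h2.
have qe : e = 4 * q by rewrite /q; field.
split.
- apply: (@le_trans _ _ ((1 - e) * A * ((1 + q) * G))).
    by rewrite ler_wpM2l// mulr_ge0 ?(ltW A0)// subr_ge0 ltW.
  apply: le_trans (ltW h1).
  have -> : (1 - e) * A * ((1 + q) * G) = (A * G) * ((1 - e) * (1 + q)) by ring.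
  have -> : (A - A * q) * G = (A * G) * (1 - q) by ring.
  by rewrite ler_wpM2l ?mulr_ge0 ?ltW// qe; nra.
- apply: (@le_trans _ _ ((1 + e) * A * ((1 - q) * G))); last first.
    by rewrite ler_wpM2l// mulr_ge0 ?(ltW A0)// addr_ge0// ltW.
  apply: (le_trans (ltW h2)).
  have -> : (1 + e) * A * ((1 - q) * G) = (A * G) * ((1 + e) * (1 - q)) by ring.
  have -> : (A + A * q) * G = (A * G) * (1 + q) by ring.
  by rewrite ler_wpM2l ?mulr_ge0 ?ltW// qe /q; nra.
Unshelve. all: by end_near. Qed.

Lemma gdens_shift (g c : R) : gdens g (z + c) / gdens g z @[z --> +oo] --> expR (- c).
Proof.
have h1 : (1 + c * z^-1) `^ g @[z --> +oo] --> (1 `^ g : R).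
  have h : 1 + c * z^-1 @[z --> +oo] --> (1 : R).
    rewrite -[X in _ --> X]addr0; apply: cvgD; first exact: cvg_cst.
    rewrite -[X in _ --> X](mulr0 c); apply: cvgMr.
    have := @cvg_powRN R 1 (ltac:(by [])).
    apply: cvg_trans; apply: near_eq_cvg; near=> z.
    by rewrite powR_inv1//; near: z; exact: nbhs_pinfty_ge.
  have c1 : {for (1 : R), continuous (@powR R ^~ g)}.
    apply: differentiable_continuous; apply/derivable1_diffP.
    by have [] := @is_derive_powR R g 1 (ltac:(by [])).
  exact: (cvg_comp _ (fun x : R => x `^ g) h).
have : (1 + c * z^-1) `^ g * expR (- c) @[z --> +oo] --> 1 `^ g * expR (- c).
  by apply: cvgM => //; exact: cvg_cst.
rewrite powR1 mul1r; apply: cvg_trans; apply: near_eq_cvg; near=> z.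
have z0 : 0 < z by near: z; exact: nbhs_pinfty_gt.
have zc : 0 < z + c.
  have : - c < z by near: z; exact/nbhs_pinfty_gt/num_real.
  by rewrite -subr_gt0 opprK.
rewrite /gdens (_ : 1 + c * z^-1 = (z + c) / z); last by field; rewrite gt_eqF.
rewrite powRM ?invr_ge0 ?ltW// -powR_inv1 ?(ltW z0)// -powRrM mulN1r powRN.
rewrite opprD expRD.
by field; rewrite !gt_eqF ?powR_gt0 ?expR_gt0.
Unshelve. all: by end_near. Qed.

Lemma tail_expR U (x : R) : 0 < x -> tail P (fun w => expR (U w)) x = tail P U (ln x).
Proof.
move=> x0; rewrite /tail; congr (fine (P _)); apply/seteqP; split => w /=.
  by rewrite -{1}(lnK x0) ltr_expR.
by rewrite -{2}(lnK x0) ltr_expR.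
Qed.

Lemma cvg_ln_pinfty : ln x @[x --> +oo] --> (+oo : set_system R).
Proof.
apply/cvgryPge => A; near=> x.
have x0 : 0 < x by near: x; exact: nbhs_pinfty_gt.
have Ax : expR A <= x by near: x; exact/nbhs_pinfty_ge/num_real.
by rewrite -[A]expRK ler_ln ?posrE ?expR_gt0.
Unshelve. all: by end_near. Qed.

Lemma cvg_expR_pinfty : expR x @[x --> +oo] --> (+oo : set_system R).
Proof.
apply/cvgryPge => A; near=> x; apply: (@le_trans _ _ (1 + x)); last exact: expR_ge1Dx.
have : A - 1 <= x by near: x; exact/nbhs_pinfty_ge/num_real.
by rewrite lerBlDl.
Unshelve. all: by end_near. Qed.

Lemma gamma_tail_shift U A g c : 0 < A -> gamma_tail U A g ->
  tail P U (z + c) / tail P U z @[z --> +oo] --> expR (- c).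
Proof.
move=> A0 UA.
have UAc : tail P U (z + c) / gdens g (z + c) @[z --> +oo] --> A.
  have h : z + c @[z --> +oo] --> (+oo : set_system R).
    apply/cvgryPge => B; near=> z; have : B - c <= z.
      by near: z; exact/nbhs_pinfty_ge/num_real.
    by rewrite lerBlDr.
  exact: (cvg_comp _ (fun z => tail P U z / gdens g z) h UA).
have A1 : A != 0 by rewrite gt_eqF.
have : (tail P U (z + c) / gdens g (z + c)) * (tail P U z / gdens g z)^-1 *
    (gdens g (z + c) / gdens g z) @[z --> +oo] --> A / A * expR (- c).
  apply: cvgM; last exact: gdens_shift.
  by apply: cvgM => //; exact: cvgV.
rewrite divff// mul1r; apply: cvg_trans; apply: near_eq_cvg; near=> z.
have z0 : 0 < z by near: z; exact: nbhs_pinfty_gt.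
have zc : 0 < z + c.
  have : - c < z by near: z; exact/nbhs_pinfty_gt/num_real.
  by rewrite -subr_gt0 opprK.
have : A / 2 < tail P U z / gdens g z.
  near: z; apply: (cvgr_gt A) => //.
  by rewrite ltr_pdivrMr// ltr_pMr// ltr1n.
have G := gdens_gt0 g z0; have Gc := gdens_gt0 g zc.
rewrite ltr_pdivlMr// => tz.
have t0 : 0 < tail P U z by apply: lt_trans tz; rewrite mulr_gt0// divr_gt0.
by field; rewrite !gt_eqF.
Unshelve. all: by end_near. Qed.

(** Multiplying [x] by [s] shifts [ln x] by [ln s], and a shift by c asymptotically multiplies a
    Gamma-type tail by e^(-c), the power factor being insensitive to it. *)
Lemma gamma_tail_rv U A g s : 0 < A -> gamma_tail U A g -> 0 < s ->
  tail P (fun w => expR (U w)) (s * x) / tail P (fun w => expR (U w)) x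
    @[x --> +oo] --> s^-1.
Proof.
move=> A0 UA s0.
have := cvg_comp _ _ cvg_ln_pinfty (@gamma_tail_shift U A g (ln s) A0 UA).
rewrite expRN lnK ?posrE//; apply: cvg_trans; apply: near_eq_cvg; near=> x.
have x0 : 0 < x by near: x; exact: nbhs_pinfty_gt.
by rewrite !tail_expR ?mulr_gt0//= lnM ?posrE// addrC.
Unshelve. all: by end_near. Qed.

(** Breiman's lemma for [expR U], regularly varying by [gamma_tail_rv], read on the logarithmic
    scale. *)
Lemma breiman_gamma U V A g p : measurable_fun setT U -> measurable_fun setT V ->
  indep2 P U V -> (forall w, 0 <= V w) -> 1 < p ->
  (\int[P]_w (V w `^ p)%:E < +oo)%E -> 0 < A -> gamma_tail U A g ->
  tail P (fun w => expR (U w) * V w) (expR z) / gdens g z @[z --> +oo] -->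
    A * fine (\int[P]_w (V w)%:E).
Proof.
move=> mU mV UV V0 p1 Vp A0 UA.
have meU : measurable_fun setT (fun w => expR (U w)) by exact: measurableT_comp.
have eUV : indep2 P (fun w => expR (U w)) V.
  exact: (indep2_comp (f := expR) (g := id)).
have [_ h] := breiman meU mV eUV V0 p1 Vp (fun s s0 => @gamma_tail_rv U A g s A0 UA s0).
have := cvg_comp _ _ cvg_expR_pinfty h => {}h.
have : (tail P U z / gdens g z) *
    (tail P (fun w => expR (U w) * V w) (expR z) / tail P (fun w => expR (U w)) (expR z))
    @[z --> +oo] --> A * fine (\int[P]_w (V w)%:E) by exact: cvgM.
apply: cvg_trans; apply: near_eq_cvg; near=> z.
have z0 : 0 < z by near: z; exact: nbhs_pinfty_gt.
have : A / 2 < tail P U z / gdens g z.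
  near: z; apply: (cvgr_gt A) => //.
  by rewrite ltr_pdivrMr// ltr_pMr// ltr1n.
have G := gdens_gt0 g z0.
rewrite ltr_pdivlMr// => tz.
have t0 : 0 < tail P U z by apply: lt_trans tz; rewrite mulr_gt0// divr_gt0.
rewrite /= (tail_expR U (expR_gt0 z)) expRK.
by field; rewrite !gt_eqF.
Unshelve. all: by end_near. Qed.

End corner.

(** * Convolution of Gamma-type tails *)

Section convolution.
Context {d : measure_display} {T : measurableType d} {R : realType}.
Variable P : probability T R.
Implicit Types U V : T -> R.

Lemma cvg_eps (f : R -> R) (L C : R) : 0 < C ->
  (forall e, 0 < e -> e < 1 -> \forall z \near +oo, `|f z - L| <= C * e) ->
  f z @[z --> +oo] --> L.
Proof.
move=> C0 h; apply/cvgrPdist_le => t t0.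
pose e := Num.min (2^-1) (t / C).
have e0 : 0 < e by rewrite lt_min divr_gt0//=; lra.
have e1 : e < 1 by rewrite gt_min; apply/orP; left; lra.
apply: filterS (h e e0 e1) => z; rewrite distrC => /le_trans; apply.
by rewrite mulrC -ler_pdivlMr// ge_min lexx orbT.
Qed.

(** Breiman's lemma wants a moment of order above 1, which [expR V] does not have when [V] has a
    Gamma-type tail of rate 1. The truncation is bounded, hence has all moments. *)
Definition expR_trunc V (M : R) (w : T) : R := if V w <= M then expR (V w) else 0.

Lemma expR_trunc_ge0 V M w : 0 <= expR_trunc V M w.
Proof. by rewrite /expR_trunc; case: ifP => // _; exact: expR_ge0. Qed.

Lemma measurable_expR_trunc V M : measurable_fun setT V ->
  measurable_fun setT (expR_trunc V M).
Proof.
move=> mV; apply: measurable_fun_ifT => //; first exact: measurable_fun_ler.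
exact: measurableT_comp.
Qed.

Lemma expR_trunc_moment V M : measurable_fun setT V ->
  (\int[P]_w (expR_trunc V M w `^ 2)%:E < +oo)%E.
Proof.
move=> mV; apply: (@le_lt_trans _ _ (\int[P]_w (expR M `^ 2)%:E)%E).
  apply: ge0_le_integral => //.
  - by move=> w _; rewrite lee_fin powR_ge0.
  - apply/measurable_EFinP/(measurableT_comp (measurable_powR _)).
    exact: measurable_expR_trunc.
  - move=> w _; rewrite lee_fin; apply: ge0_ler_powR => //.
    + by rewrite nnegrE expR_trunc_ge0.
    + by rewrite nnegrE expR_ge0.
    + by rewrite /expR_trunc; case: ifPn => h; rewrite ?ler_expR ?expR_ge0.
by rewrite integral_cst//= probability_setT mule1 ltry.
Qed.

Lemma expR_trunc_cvg V : measurable_fun setT V ->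
  (\int[P]_w (expR (V w))%:E < +oo)%E ->
  fine (\int[P]_w (expR_trunc V M w)%:E) @[M --> +oo] -->
  fine (\int[P]_w (expR (V w))%:E).
Proof.
move=> mV Vfin; apply/cvg_pinftyP => u uoo.
have meV : measurable_fun setT (fun w => (expR (V w))%:E).
  by apply/measurable_EFinP; exact: measurableT_comp.
have iV : P.-integrable setT (fun w => (expR (V w))%:E).
  apply/integrableP; split => //.
  by under eq_integral do rewrite gee0_abs ?lee_fin ?expR_ge0//.
have VE : (\int[P]_w (expR (V w))%:E)%E \is a fin_num by exact: integrable_fin_num.
apply: fine_cvg; rewrite fineK//.
have [] := @dominated_convergence _ _ _ P setT measurableT
    (fun n w => (expR_trunc V (u n) w)%:E) (fun w => (expR (V w))%:E)
    (fun w => (expR (V w))%:E) _ meV _ iV _ => //.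
- by move=> n; apply/measurable_EFinP; exact: measurable_expR_trunc.
- apply: aeW => w _; apply: cvg_EFin; first exact: nearW.
  apply: cvg_near_cst.
  by apply: filterS (@cvgry_ge _ _ \oo _ _ uoo (V w)) => n; rewrite /= /expR_trunc => ->.
- apply: aeW => w n _; rewrite gee0_abs ?lee_fin ?expR_trunc_ge0//.
  by rewrite /expR_trunc; case: ifP => // _; exact: expR_ge0.
Qed.

(* As expR_trunc V M vanishes on M < V, the first two terms are the probabilities
   of {V <= M, z < U + V} and {U <= M, z < U + V}, in the form required by Breiman's
   lemma. *)
Lemma tail_conv_split U V (M z : R) : measurable_fun setT U -> measurable_fun setT V ->
  2 * M <= z ->
  tail P (fun w => U w + V w) z =
  tail P (fun w => expR (U w) * expR_trunc V M w) (expR z) +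
  tail P (fun w => expR (V w) * expR_trunc U M w) (expR z) +
  fine (P (corner U V M z)).
Proof.
move=> mU mV Mz.
have mUV : measurable_fun setT (fun w => U w + V w) by exact: measurable_funD.
have mUV' : measurable_fun setT (fun w => expR (U w) * expR_trunc V M w).
  apply: measurable_funM; first exact: measurableT_comp.
  exact: measurable_expR_trunc.
have mVU' : measurable_fun setT (fun w => expR (V w) * expR_trunc U M w).
  apply: measurable_funM; first exact: measurableT_comp.
  exact: measurable_expR_trunc.
have E U' V' : [set w | expR z < expR (U' w) * expR_trunc V' M w] =
    [set w | V' w <= M /\ z < U' w + V' w] :> set T.
  apply/seteqP; split => w /=; rewrite /expR_trunc; case: ifPn => h.
  - by rewrite -expRD ltr_expR.
  - by rewrite mulr0 ltNge expR_ge0.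
  - by rewrite -expRD ltr_expR => -[].
  - by move=> [].
have mA := measurable_gt (expR z) mUV'; have mB := measurable_gt (expR z) mVU'.
have mC := measurable_corner M z mU mV.
apply: EFin_inj; rewrite !EFinD !tailE// fineK ?fin_num_measure//.
rewrite !E in mA mB *.
rewrite -measureU//; last first.
  (* With both summands at most [M], the sum would be at most 2 M <= z. *)
  by apply/seteqP; split => w //= [[h1 h2] [h3 h4]]; lra.
rewrite -measureU//; last 2 first.
- exact: measurableU.
- apply/seteqP; split => w //= [[[h1 h2]|[h1 h2]] [h3 h4 h5]]; lra.
congr (P _); apply/seteqP; split => w /=.
  move=> h; have [h1|h1] := leP (V w) M; first by left; left.
  have [h2|h2] := leP (U w) M; first by left; right; split; rewrite // addrC.
  by right.
by move=> [[[_ //]|[_]]|[]//]; rewrite addrC.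
Qed.

Lemma gamma_tail_trunc U V A g M : measurable_fun setT U -> measurable_fun setT V ->
  indep2 P U V -> 0 < A -> gamma_tail P U A g ->
  tail P (fun w => expR (U w) * expR_trunc V M w) (expR z) / gdens g z
    @[z --> +oo] --> A * fine (\int[P]_w (expR_trunc V M w)%:E).
Proof.
move=> mU mV UV A0 UA.
apply: (@breiman_gamma _ _ _ P U (expR_trunc V M) A g 2) => //.
- exact: measurable_expR_trunc.
- apply: (indep2_comp (f := id) (g := fun v => if v <= M then expR v else 0)) => //.
  by apply: measurable_fun_ifT => //; exact: measurable_fun_ler.
- exact: expR_trunc_ge0.
- by rewrite ltr1n.
- exact: expR_trunc_moment.
Qed.

Lemma gamma_tail_near2 U V A B g b e : 0 < A -> 0 < B ->
  gamma_tail P U A g -> gamma_tail P V B b -> 0 < e -> e < 1 ->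
  \forall M \near +oo, forall x, M <= x ->
    [/\ ((tail P U x)%:E <= ((1 + e) * A)%:E * gtail g x)%E,
        ((tail P V x)%:E <= ((1 + e) * B)%:E * gtail b x)%E,
        (((1 - e) * A)%:E * gtail g x <= (tail P U x)%:E)%E &
        (((1 - e) * B)%:E * gtail b x <= (tail P V x)%:E)%E].
Proof.
move=> A0 B0 UA VB e0 e1.
have [M1 [_ h1]] := near_pinfty_ge1 (gamma_tail_gtail A0 UA e0 e1).
have [M2 [_ h2]] := near_pinfty_ge1 (gamma_tail_gtail B0 VB e0 e1).
near=> M => x Mx.
have M1x : M1 <= x by apply: le_trans Mx; near: M; exact/nbhs_pinfty_ge/num_real.
have M2x : M2 <= x by apply: le_trans Mx; near: M; exact/nbhs_pinfty_ge/num_real.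
by have [? ?] := h1 x M1x; have [? ?] := h2 x M2x.
Unshelve. all: by end_near. Qed.

Lemma gdens_ratio_cvg0 (f : R -> R) (g r c : R) : 0 < r ->
  f z / gdens g z @[z --> +oo] --> c ->
  f z / gdens (g + r) z @[z --> +oo] --> (0 : R).
Proof.
move=> r0 fc.
have : f z / gdens g z * z `^ (- r) @[z --> +oo] --> c * 0.
  by apply: cvgM => //; exact: cvg_powRN.
rewrite mulr0; apply: cvg_trans; apply: near_eq_cvg; near=> z.
have z0 : 0 < z by near: z; exact: nbhs_pinfty_gt.
rewrite /gdens powRD ?(gt_eqF z0) ?implybT// powRN.
by field; rewrite !gt_eqF ?powR_gt0 ?expR_gt0.
Unshelve. all: by end_near. Qed.

(** For fixed [M] the two truncated terms have the orders of [gdens g] and [gdens b], smaller than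
    [gdens (g + b + 1)] by the powers z^(-(b+1)) and z^(-(g+1)). The corner carries the limit,
    squeezed between a full and a slightly incomplete Beta integral. *)
Lemma gamma_tail_conv_gtN1 U V A B g b : measurable_fun setT U -> measurable_fun setT V ->
  indep2 P U V -> -1 < g -> -1 < b -> 0 < A -> 0 < B ->
  gamma_tail P U A g -> gamma_tail P V B b ->
  gamma_tail P (fun w => U w + V w)
    (A * B * (Gamma (g + 1) * Gamma (b + 1) / Gamma (g + b + 2))) (g + b + 1).
Proof.
move=> mU mV UV g1 b1 A0 B0 UA VB.
set Bc := Gamma (g + 1) * Gamma (b + 1) / Gamma (g + b + 2).
have Bc0 : 0 < Bc by rewrite divr_gt0 ?mulr_gt0// Gamma_gt0//; lra.
have q0 : 0 < A * B * Bc by rewrite mulr_gt0// mulr_gt0.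
(* The factor 7 bounds the corner error on both sides, from (1 + e)^3 <= 1 + 7 e and (1 - e)^4 >= 1
   - 4 e for e < 1; the 2 accounts for one [e] from each truncated term. *)
apply: (@cvg_eps _ _ (7 * (A * B * Bc) + 2)); first by rewrite addr_gt0// mulr_gt0.
move=> e e0 e1.
have [M [M1 /(_ M (lexx M)) hM]] := near_pinfty_ge1 (gamma_tail_near2 A0 B0 UA VB e0 e1).
have M0 : 0 <= M by exact: le_trans M1.
have VU : indep2 P V U by exact: indep2_sym.
have b1' : 0 < b + 1 by lra.
have g1' : 0 < g + 1 by lra.
have lim1 : tail P (fun w => expR (U w) * expR_trunc V M w) (expR z) /
    gdens (g + (b + 1)) z @[z --> +oo] --> 0.
  have l1 : tail P (fun w => expR (U w) * expR_trunc V M w) (expR z) /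
      gdens g z @[z --> +oo] --> A * fine (\int[P]_w (expR_trunc V M w)%:E).
    exact: gamma_tail_trunc.
  exact: (gdens_ratio_cvg0 b1' l1).
have lim2 : tail P (fun w => expR (V w) * expR_trunc U M w) (expR z) /
    gdens (b + (g + 1)) z @[z --> +oo] --> 0.
  have l2 : tail P (fun w => expR (V w) * expR_trunc U M w) (expR z) /
      gdens b z @[z --> +oo] --> B * fine (\int[P]_w (expR_trunc U M w)%:E).
    exact: gamma_tail_trunc.
  exact: (gdens_ratio_cvg0 g1' l2).
have pB : pconv g b 0 1 = Bc%:E by exact: pconv_Beta.
(* [n] is fixed so that the incomplete Beta integral loses at most the fraction [e]; for large z the
   ratio M / z drops below 1/(n+1). *)
have [n pn] : exists n, (((1 - e) * Bc)%:E <= pconv g b (n.+1%:R^-1)%R 1%R)%E.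
  have := @pconv_cvg0 R g b; rewrite pB => /fine_cvgP[fn].
  move=> /cvgrPdist_lt /(_ (e * Bc)); rewrite mulr_gt0// => /(_ isT) h.
  near \oo => n; exists n.
  have fn' : pconv g b n.+1%:R^-1 1 \is a fin_num by near: n.
  have : `|Bc - fine (pconv g b n.+1%:R^-1 1)| < e * Bc by near: n.
  rewrite -(fineK fn') lee_fin; move=> /ltr_normlW h'.
  by rewrite mulrBl mul1r lerBlDl -lerBlDr ltW.
near=> z.
have z0 : 0 < z by near: z; exact: nbhs_pinfty_gt.
have zM : 2 * M <= z by near: z; exact/nbhs_pinfty_ge/num_real.
have zn : M <= n.+1%:R^-1 * z.
  have : n.+1%:R * M <= z by near: z; exact/nbhs_pinfty_ge/num_real.
  by rewrite ler_pdivlMl.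
have [fT T1 T2] : [/\ gtail (g + b + 1) z \is a fin_num,
   (1 - e) * gdens (g + b + 1) z <= fine (gtail (g + b + 1) z) &
   fine (gtail (g + b + 1) z) <= (1 + e) * gdens (g + b + 1) z].
  by near: z; exact: gtail_near.
have t1 : tail P (fun w => expR (U w) * expR_trunc V M w) (expR z) /
    gdens (g + b + 1) z <= e.
  have : `|tail P (fun w => expR (U w) * expR_trunc V M w) (expR z) /
    gdens (g + (b + 1)) z| <= e by near: z; move/cvgr0Pnorm_le : lim1; exact.
  by rewrite addrA; exact/le_trans/ler_norm.
have t2 : tail P (fun w => expR (V w) * expR_trunc U M w) (expR z) /
    gdens (g + b + 1) z <= e.
  have : `|tail P (fun w => expR (V w) * expR_trunc U M w) (expR z) /
    gdens (b + (g + 1)) z| <= e by near: z; move/cvgr0Pnorm_le : lim2; exact.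
  by rewrite addrA [b + g]addrC; exact/le_trans/ler_norm.
have G0 := gdens_gt0 (g + b + 1) z0.
have a1 : 0 <= (1 + e) * A by rewrite mulr_ge0 ?(ltW A0)// addr_ge0// ltW.
have a2 : 0 <= (1 + e) * B by rewrite mulr_ge0 ?(ltW B0)// addr_ge0// ltW.
have a3 : 0 <= (1 - e) * A by rewrite mulr_ge0 ?(ltW A0)// subr_ge0 ltW.
have a4 : 0 <= (1 - e) * B by rewrite mulr_ge0 ?(ltW B0)// subr_ge0 ltW.
have fC : P (corner U V M z) \is a fin_num.
  by rewrite fin_num_measure//; exact: measurable_corner.
have cU : fine (P (corner U V M z)) <=
    (1 + e) * A * ((1 + e) * B) * (Bc * fine (gtail (g + b + 1) z)).
  rewrite -lee_fin fineK// EFinM [(Bc * _)%:E]EFinM fineK// -pB.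
  apply: le_trans (corner_prob_le (g := g) (b := b) z mU mV UV a1 a2 _ _) _.
  - by move=> x /hM[].
  - by move=> x /hM[].
  - apply: lee_wpmul2l; first by rewrite lee_fin mulr_ge0.
    by rewrite corner_mass_le// ltW.
have cL : (1 - e) * A * ((1 - e) * B) * ((1 - e) * Bc * fine (gtail (g + b + 1) z)) <=
    fine (P (corner U V M z)).
  rewrite -lee_fin fineK// EFinM [((1 - e) * Bc * _)%:E]EFinM fineK//.
  apply: le_trans (corner_prob_ge (g := g) (b := b) z mU mV UV a3 a4 _ _).
  - apply: lee_wpmul2l; first by rewrite lee_fin mulr_ge0.
    apply: le_trans (corner_mass_ge g b M0 z0 zn).
    by rewrite lee_wpmul2r ?gtail_ge0.
  - by move=> x /hM[].
  - by move=> x /hM[].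
have t10 : 0 <= tail P (fun w => expR (U w) * expR_trunc V M w) (expR z) /
    gdens (g + b + 1) z by rewrite divr_ge0 ?tail_ge0// ltW.
have t20 : 0 <= tail P (fun w => expR (V w) * expR_trunc U M w) (expR z) /
    gdens (g + b + 1) z by rewrite divr_ge0 ?tail_ge0// ltW.
have key (c t G : R) : 0 < G ->
    c <= (1 + e) * A * ((1 + e) * B) * (Bc * t) ->
    (1 - e) * A * ((1 - e) * B) * ((1 - e) * Bc * t) <= c ->
    (1 - e) * G <= t -> t <= (1 + e) * G ->
    (1 - 4 * e) * (A * B * Bc) <= c / G <= (1 + 7 * e) * (A * B * Bc).
  move=> {}G0 {}cU {}cL {}T1 {}T2; apply/andP; split.
    rewrite ler_pdivlMr//; apply: le_trans cL.
    have -> : (1 - e) * A * ((1 - e) * B) * ((1 - e) * Bc * t) =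
      (A * B * Bc) * ((1 - e) ^+ 3 * t) by ring.
    have -> : (1 - 4 * e) * (A * B * Bc) * G = (A * B * Bc) * ((1 - 4 * e) * G) by ring.
    rewrite ler_wpM2l ?(ltW q0)//.
    apply: (@le_trans _ _ ((1 - e) ^+ 3 * ((1 - e) * G))); last first.
      by rewrite ler_wpM2l// exprn_ge0// subr_ge0 ltW.
    rewrite mulrA ler_wpM2r ?(ltW G0)//.
    have h1 : 1 - 2 * e <= (1 - e) ^+ 2 by rewrite !exprSr expr0; nra.
    have -> : (1 - e) ^+ 3 * (1 - e) = ((1 - e) ^+ 2) ^+ 2 by ring.
    by rewrite [leRHS]expr2; nra.
  rewrite ler_pdivrMr//; apply: le_trans cU _.
  have -> : (1 + e) * A * ((1 + e) * B) * (Bc * t) =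
    (A * B * Bc) * ((1 + e) ^+ 2 * t) by ring.
  have -> : (1 + 7 * e) * (A * B * Bc) * G = (A * B * Bc) * ((1 + 7 * e) * G) by ring.
  rewrite ler_wpM2l ?(ltW q0)//.
  apply: (@le_trans _ _ ((1 + e) ^+ 2 * ((1 + e) * G))).
    by rewrite ler_wpM2l// exprn_ge0// addr_ge0// ltW.
  by rewrite mulrA ler_wpM2r ?(ltW G0)//; rewrite !exprSr expr0; nra.
have {key} := key _ _ _ G0 cU cL T1 T2.
rewrite (tail_conv_split mU mV zM).
rewrite [X in `|X - _|]mulrDl [X in `|X + _ - _|]mulrDl.
move: t1 t10 t2 t20; move: (A * B * Bc) q0 => q q0.
move: (_ / gdens _ z) => y; move: (_ / gdens _ z) => x1; move: (_ / gdens _ z) => x2.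
move=> h1 h2 h3 h4 /andP[h5 h6]; rewrite ler_norml.
by apply/andP; split; nra.
Unshelve. all: by end_near. Qed.

(** Two limits in succession: [M] is taken so large that the truncated exponential moments are
    within [e] of the full ones and the corner, of relative size M^(b+1), is below [e]; then z grows
    with [M] fixed. The truncated terms already have the order of [gdens b] and yield the two
    summands of the constant. *)
Lemma gamma_tail_conv_ltN1 U V A B b : measurable_fun setT U -> measurable_fun setT V ->
  indep2 P U V -> b < -1 -> 0 < A -> 0 < B ->
  gamma_tail P U A b -> gamma_tail P V B b ->
  (\int[P]_w (expR (U w))%:E < +oo)%E -> (\int[P]_w (expR (V w))%:E < +oo)%E ->
  gamma_tail P (fun w => U w + V w)
    (A * fine (\int[P]_w (expR (V w))%:E) + B * fine (\int[P]_w (expR (U w))%:E)) b.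
Proof.
move=> mU mV UV b1 A0 B0 UA VB EU EV.
set eV := fine (\int[P]_w (expR (V w))%:E); set eU := fine (\int[P]_w (expR (U w))%:E).
have VU : indep2 P V U by exact: indep2_sym.
have b10 : 0 < - (b + 1) by lra.
(* 8 is 4 times 2, from (1 + e)^2 <= 4 and [gtail b z] being at most twice [gdens b z]; the bracket
   is the constant of [corner_mass_le_ltN1] without its power of [M]. *)
pose D := 8 * A * B * (2 * 2 `^ (- b) * (- (b + 1))^-1).
have D0 : 0 < D by rewrite !mulr_gt0 ?powR_gt0 ?invr_gt0.
(* [A] and [B] multiply the errors of the truncated moments; the 3 stands for the two limits in z
   and the corner. *)
apply: (@cvg_eps _ _ (A + B + 3)); first by rewrite !addr_gt0.
move=> e e0 e1.
have trV := expR_trunc_cvg mV EV; have trU := expR_trunc_cvg mU EU.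
near (+oo : set_system R) => M.
have M0 : 0 < M by near: M; exact: nbhs_pinfty_gt.
have hM : forall x, M <= x ->
    [/\ ((tail P U x)%:E <= ((1 + e) * A)%:E * gtail b x)%E,
        ((tail P V x)%:E <= ((1 + e) * B)%:E * gtail b x)%E,
        (((1 - e) * A)%:E * gtail b x <= (tail P U x)%:E)%E &
        (((1 - e) * B)%:E * gtail b x <= (tail P V x)%:E)%E].
  by near: M; exact: gamma_tail_near2.
have MV : `|eV - fine (\int[P]_w (expR_trunc V M w)%:E)| <= e.
  by near: M; move/cvgrPdist_le : trV; exact.
have MU : `|eU - fine (\int[P]_w (expR_trunc U M w)%:E)| <= e.
  by near: M; move/cvgrPdist_le : trU; exact.
have MD : D * M `^ (b + 1) <= e.
  have : `|M `^ (b + 1)| <= e / D.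
    near: M; move: (cvg_powRN b10); rewrite opprK => /cvgr0Pnorm_le; apply.
    by rewrite divr_gt0.
  by rewrite ger0_norm ?powR_ge0// ler_pdivlMr// mulrC.
have lim1 : tail P (fun w => expR (U w) * expR_trunc V M w) (expR z) /
    gdens b z @[z --> +oo] --> A * fine (\int[P]_w (expR_trunc V M w)%:E).
  exact: gamma_tail_trunc.
have lim2 : tail P (fun w => expR (V w) * expR_trunc U M w) (expR z) /
    gdens b z @[z --> +oo] --> B * fine (\int[P]_w (expR_trunc U M w)%:E).
  exact: gamma_tail_trunc.
near=> z.
have z0 : 0 < z by near: z; exact: nbhs_pinfty_gt.
have zM : 2 * M <= z by near: z; exact/nbhs_pinfty_ge/num_real.
have [fT T1 T2] : [/\ gtail b z \is a fin_num,
   (1 - e) * gdens b z <= fine (gtail b z) &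
   fine (gtail b z) <= (1 + e) * gdens b z].
  by near: z; exact: gtail_near.
have t1 : `|A * fine (\int[P]_w (expR_trunc V M w)%:E) -
    tail P (fun w => expR (U w) * expR_trunc V M w) (expR z) / gdens b z| <= e.
  by near: z; move/cvgrPdist_le : lim1; exact.
have t2 : `|B * fine (\int[P]_w (expR_trunc U M w)%:E) -
    tail P (fun w => expR (V w) * expR_trunc U M w) (expR z) / gdens b z| <= e.
  by near: z; move/cvgrPdist_le : lim2; exact.
have G0 := gdens_gt0 b z0.
have a1 : 0 <= (1 + e) * A by rewrite mulr_ge0 ?(ltW A0)// addr_ge0// ltW.
have a2 : 0 <= (1 + e) * B by rewrite mulr_ge0 ?(ltW B0)// addr_ge0// ltW.
have fC : P (corner U V M z) \is a fin_num.
  by rewrite fin_num_measure//; exact: measurable_corner.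
have m0 := powR_ge0 M (b + 1).
have cU : fine (P (corner U V M z)) <= (1 + e) * A * ((1 + e) * B) *
    (2 * 2 `^ (- b) * (M `^ (b + 1) / - (b + 1)) * fine (gtail b z)).
  rewrite -lee_fin fineK// EFinM [(_ * fine (gtail b z))%:E]EFinM fineK//.
  apply: le_trans (corner_prob_le (g := b) (b := b) z mU mV UV a1 a2 _ _) _.
  - by move=> x /hM[].
  - by move=> x /hM[].
  - apply: lee_wpmul2l; first by rewrite lee_fin mulr_ge0.
    by apply: corner_mass_le_ltN1 => //; exact: ltW.
have c0 : 0 <= fine (P (corner U V M z)) by exact: fine_ge0.
rewrite (tail_conv_split mU mV zM) !mulrDl.
have cU' : fine (P (corner U V M z)) / gdens b z <= e.
  rewrite ler_pdivrMr//; apply: le_trans cU _.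
  have T0 : 0 <= fine (gtail b z) by rewrite fine_ge0// gtail_ge0.
  have T3 : fine (gtail b z) <= 2 * gdens b z.
    by apply: le_trans T2 _; rewrite ler_wpM2r ?(ltW G0)//; lra.
  apply: (@le_trans _ _ ((D * M `^ (b + 1)) * gdens b z)); last first.
    by rewrite ler_wpM2r ?(ltW G0).
  have -> : (1 + e) * A * ((1 + e) * B) *
    (2 * 2 `^ (- b) * (M `^ (b + 1) / - (b + 1)) * fine (gtail b z)) =
    (A * B * (2 * 2 `^ (- b) * (- (b + 1))^-1) * M `^ (b + 1)) *
    ((1 + e) ^+ 2 * fine (gtail b z)) by ring.
  have -> : D * M `^ (b + 1) * gdens b z =
    (A * B * (2 * 2 `^ (- b) * (- (b + 1))^-1) * M `^ (b + 1)) *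
    (4 * (2 * gdens b z)) by rewrite /D; ring.
  have K0 : 0 <= A * B * (2 * 2 `^ (- b) * (- (b + 1))^-1) * M `^ (b + 1).
    apply: mulr_ge0 => //; apply: ltW.
    by rewrite !mulr_gt0 ?powR_gt0 ?invr_gt0.
  rewrite ler_wpM2l//.
  apply: ler_pM => //; first by rewrite exprn_ge0// addr_ge0// ltW.
  by rewrite !exprSr expr0; nra.
have cL' : 0 <= fine (P (corner U V M z)) / gdens b z.
  by rewrite divr_ge0// ltW.
move: cU' cL' t1 t2 MV MU.
move: (_ / gdens b z) => c; move: (_ / gdens b z) => y; move: (_ / gdens b z) => x.
move: (fine _) => p; move: (fine _) => q.
rewrite !ler_norml => /= c1 c2 /andP[h1 h2] /andP[h3 h4] /andP[h5 h6] /andP[h7 h8].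
by apply/andP; split; nra.
Unshelve. all: by end_near. Qed.

End convolution.

(** * Weighted sums of i.i.d. variables *)

Section limits.
Context {R : realType}.

(** Squeezed by exp(-p/(1-p)) <= 1 - p <= exp(-p), both from 1 + x <= exp(x); convergence of n p_n
    forces p_n to 0. *)
Lemma powR_limit (p : R^nat) (c : R) : n%:R * p n @[n --> \oo] --> c ->
  (1 - p n) ^+ n @[n --> \oo] --> expR (- c).
Proof.
move=> pc.
have p0 : p n @[n --> \oo] --> (0 : R).
  have : n.+1%:R^-1 * (n.+1%:R * p n.+1) @[n --> \oo] --> 0 * c.
    by apply: cvgM; [exact: cvg_harmonic|rewrite (cvg_shiftS (fun n => n%:R * p n))].
  rewrite mul0r => h; rewrite -(cvg_shiftS p); apply: cvg_trans h.
  by apply: near_eq_cvg; apply: nearW => n; rewrite mulKf// pnatr_eq0.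
have q1 : 1 - p n @[n --> \oo] --> (1 : R).
  by rewrite -[X in _ --> X]subr0; apply: cvgB => //; exact: cvg_cst.
have lo : expR (- (n%:R * p n / (1 - p n))) @[n --> \oo] --> expR (- c).
  apply: (cvg_comp (fun n => - (n%:R * p n / (1 - p n))) expR); last exact: continuous_expR.
  apply: cvgN; rewrite -[X in _ --> X]divr1; apply: cvgM => //.
  by apply: cvgV.
have hi : expR (- (n%:R * p n)) @[n --> \oo] --> expR (- c).
  apply: (cvg_comp (fun n => - (n%:R * p n)) expR); last exact: continuous_expR.
  exact: cvgN.
apply: (squeeze_cvgr _ lo hi); near=> n.
have p2 : p n < 1.
  have : 0 < 1 - p n by near: n; apply: (cvgr_gt 1) => //.
  by rewrite subr_gt0.
have s0 : 0 < 1 - p n by rewrite subr_gt0.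
have e1 : 1 - p n <= expR (- p n) by exact: expR_ge1Dx.
have e2 : expR (- (p n / (1 - p n))) <= 1 - p n.
  rewrite expRN -[leRHS]invrK lef_pV2 ?posrE ?expR_gt0 ?invr_gt0//.
  apply: le_trans (expR_ge1Dx _).
  by rewrite le_eqVlt; apply/orP; left; apply/eqP; field; rewrite gt_eqF.
apply/andP; split.
- have -> : - (n%:R * p n / (1 - p n)) = n%:R * - (p n / (1 - p n)) by ring.
  by rewrite expRM_natl lerXn2r ?nnegrE ?expR_ge0// ltW.
- have -> : - (n%:R * p n) = n%:R * - p n by ring.
  by rewrite expRM_natl lerXn2r ?nnegrE ?expR_ge0// ltW.
Unshelve. all: by end_near. Qed.

(** The bound 1 + x <= exp(x) is used at (1 - l) u and at - l u, with weights l and 1 - l; the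
    linear terms cancel. *)
Lemma expR_convex (l u : R) : 0 <= l <= 1 -> expR (l * u) <= 1 - l + l * expR u.
Proof.
move=> /andP[l0 l1].
have h1 := expR_ge1Dx ((1 - l) * u); have h2 := expR_ge1Dx (- (l * u)).
have e0 := expR_gt0 (l * u).
have -> : expR u = expR (l * u) * expR ((1 - l) * u).
  by rewrite -expRD; congr expR; ring.
have ef : expR (l * u) * expR (- (l * u)) = 1 by rewrite -expRD subrr expR0.
move: (expR (l * u)) e0 ef => e e0; move: (expR (- _)) h2 => f h2 ef.
move: (expR ((1 - l) * u)) h1 => g h1.
have h3 : 0 <= (1 - l) * (f - (1 - l * u)) by rewrite mulr_ge0//; lra.
have h4 : 0 <= l * (g - (1 + (1 - l) * u)) by rewrite mulr_ge0//; lra.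
have : 0 <= e * ((1 - l) * (f - (1 - l * u)) + l * (g - (1 + (1 - l) * u))).
  by rewrite mulr_ge0 ?addr_ge0// ltW.
have -> : e * ((1 - l) * (f - (1 - l * u)) + l * (g - (1 + (1 - l) * u))) =
  (1 - l) * (e * f) + l * (e * g) - e by ring.
by rewrite ef mulr1 subr_ge0.
Qed.

(** Integral comparison: from the second on, each term is at most an increment of the primitive [F]
    of x^(-t), the increments telescope, and [F] is bounded above by 0. *)
Lemma riemann_series_cvg (t : R) : 1 < t -> cvgn (series (fun i : nat => i.+1%:R `^ (- t))).
Proof.
move=> t1.
have t10 : 0 < t - 1 by lra.
pose F (n : nat) : R := - (n.+1%:R `^ (1 - t)) / (t - 1).
have step n : n.+2%:R `^ (- t) <= F n.+1 - F n :> R.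
  have n1 : (0 : R) < n.+1%:R by [].
  have nn : n.+1%:R < n.+2%:R :> R by rewrite ltr_nat.
  have tN : - t != -1 :> R by rewrite eqr_opp gt_eqF.
  have := integral_powR_itv tN n1 nn.
  have -> : ((n.+2%:R `^ (- t + 1) - n.+1%:R `^ (- t + 1)) / (- t + 1))%:E =
      (F n.+1 - F n)%:E :> \bar R.
    congr EFin; rewrite /F [- t + 1]addrC.
    have -> : 1 - t = - (t - 1) by ring.
    by rewrite invrN; ring.
  move=> FE; rewrite -lee_fin -FE.
  have -> : (n.+2%:R `^ (- t))%:E =
    (\int[lebesgue_measure]_(x in `[n.+1%:R, n.+2%:R]) (n.+2%:R `^ (- t))%:E)%E :> \bar R.
    rewrite integral_cst//= lebesgue_measure_itv /= lte_fin nn -EFinB.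
    by rewrite -EFinM -natrB// subSnn mulr1.
  apply: ge0_le_integral => //.
  - exact: measurable_EFin_powR.
  - move=> x; rewrite /= in_itv /= => /andP[x1 x2]; rewrite lee_fin.
    have x0 : 0 < x by exact: lt_le_trans x1.
    rewrite !powRN lef_pV2 ?posrE ?powR_gt0//.
    by apply: ge0_ler_powR; rewrite ?nnegrE// ?ltW// (lt_trans _ t1).
apply: nondecreasing_is_cvgn.
  by apply: nondecreasing_series => n _ _; exact: powR_ge0.
exists (1 + (t - 1)^-1) => _ [n _ <-].
suff h m : series (fun i : nat => i.+1%:R `^ (- t)) m.+1 <= 1 + (F m - F 0%N).
  have F0 m : F m <= 0.
    by rewrite /F mulNr oppr_le0 divr_ge0 ?powR_ge0// ltW.
  have FE : - F 0%N = (t - 1)^-1 by rewrite /F powR1 mulN1r opprK.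
  case: n => [|n].
    by rewrite /series /= big_geq// addr_ge0// invr_ge0 ltW.
  apply: le_trans (h n) _; rewrite FE lerD2l; rewrite gerDr; exact: F0.
elim: m => [|m IH].
  by rewrite /series /= big_nat1 powR1 subrr addr0.
rewrite /series /= big_nat_recr//=.
have := step m; move: IH; rewrite /series /=; lra.
Qed.

Lemma limn_einf_ge (u : (\bar R)^nat) (l : \bar R) : (forall n, l <= u n)%E ->
  (l <= limn_einf u)%E.
Proof.
move=> lu; rewrite limn_einf_lim; apply: lime_ge; first exact: is_cvg_einfs.
by apply: nearW => n; apply: le_ereal_inf_tmp => _ [k _ <-].
Qed.

Lemma limn_einf_le (u : (\bar R)^nat) (l : \bar R) : (forall n, u n <= l)%E ->
  (limn_einf u <= l)%E.
Proof.
move=> ul; rewrite limn_einf_lim; apply: lime_le; first exact: is_cvg_einfs.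
apply: nearW => n; apply: le_trans (ul n).
by apply: ereal_inf_lbound; exists n => /=.
Qed.

End limits.

Section measurable_limn.
Context {d : measure_display} {T : measurableType d} {R : realType}.

Lemma measurable_limn_einf (f : (T -> \bar R)^nat) :
  (forall n, measurable_fun setT (f n)) ->
  measurable_fun setT (fun w => limn_einf (f ^~ w)).
Proof.
move=> mf.
have -> : (fun w => limn_einf (f ^~ w)) =
    (fun w => - limn_esup (fun n => - f n w))%E.
  apply/funext => w; rewrite -limn_einfN; congr limn_einf.
  by apply/funext => n; exact/esym/oppeK.
apply: measurableT_comp => //; apply: measurable_fun_limn_esup => n.
exact: measurableT_comp.
Qed.

(** [limn] is total and yields the default [point] without convergence. Convergence in the reals is
    the measurable condition that the lower and upper limits agree and are finite, so the limit is a
    measurable case distinction. *)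
Lemma measurable_limn (h : (T -> R)^nat) : (forall n, measurable_fun setT (h n)) ->
  measurable_fun setT (fun w => limn (h ^~ w)).
Proof.
move=> mh.
pose eh w n := (h n w)%:E.
have mS : measurable_fun setT (fun w => limn_esup (eh w)).
  by apply: measurable_fun_limn_esup => n; exact/measurable_EFinP.
have mI : measurable_fun setT (fun w => limn_einf (eh w)).
  by apply: measurable_limn_einf => n; exact/measurable_EFinP.
have E w : limn (h ^~ w) =
    if (limn_einf (eh w) == limn_esup (eh w)) &&
      ((-oo < limn_esup (eh w))%E && (limn_esup (eh w) < +oo)%E)
    then fine (limn_esup (eh w)) else point.
  case: ifPn => [/andP[/eqP IS fS]|].
    have fin : limn_esup (eh w) \is a fin_num by rewrite fin_real.
    apply/cvg_lim => //.
    have : eh w @ \oo --> limn_esup (eh w).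
      apply: (@squeeze_cvge _ _ _ _ (einfs (eh w)) _ (esups (eh w))).
      - apply: nearW => n; apply/andP; split.
          by apply: ereal_inf_lbound; exists n => /=.
        by apply: ereal_sup_ubound; exists n => /=.
      - by rewrite -IS limn_einf_lim; exact: is_cvg_einfs.
      - by rewrite limn_esup_lim; exact: is_cvg_esups.
    by rewrite -{1}(fineK fin) => /fine_cvg.
  move=> N; apply: dvgP => cv; move/negP : N; apply.
  have ce : eh w n @[n --> \oo] --> (limn (h ^~ w))%:E.
    by apply: cvg_EFin => //; exact: nearW.
  have [I S] := cvg_limn_einf_sup ce.
  by rewrite I S eqxx ltNyr ltry.
rewrite (funext E); apply: measurable_fun_ifT => //.
- apply: measurable_and; first exact: measurable_fun_eqe.
  by apply: measurable_and; exact: measurable_fun_lte.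
- exact: measurableT_comp.
Qed.

End measurable_limn.

(** * Exponential moments from tails *)

Section moments.
Context {d : measure_display} {T : measurableType d} {R : realType}.
Variable P : probability T R.
Local Notation mu := (@lebesgue_measure R).

Lemma expR_pointwise (t M y : R) : 0 < t ->
  ((expR (t * y))%:E <= (expR (t * M))%:E +
    \int[mu]_x (if ((M < x) && (x < y))%R then t * expR (t * x) else 0)%:E)%E.
Proof.
move=> t0; have [yM|My] := leP y M.
  apply: lee_paddr.
    apply: integral_ge0 => x _; rewrite lee_fin; case: ifP => // _.
    by rewrite mulr_ge0 ?expR_ge0// ltW.
  by rewrite lee_fin ler_expR ler_pM2l.
have -> : (\int[mu]_x (if ((M < x) && (x < y))%R then t * expR (t * x) else 0)%:E =
   \int[mu]_(x in `[M, y]) (t * expR (t * x))%:E)%E.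
  rewrite integral_itv_bndoo; last first.
    apply/measurable_EFinP; apply: measurable_funM => //.
    by apply: measurableT_comp => //; exact: measurable_funM.
  rewrite [RHS]integral_mkcond; apply: eq_integral => x _.
  by rewrite patchE mem_setE in_itv /=; case: ifP.
have dF (x : R) : is_derive x 1 (fun x : R => expR (t * x)) (t * expR (t * x)).
  have dl : is_derive x 1 (fun x : R => t * x) t.
    by apply: is_derive_eq; rewrite /GRing.scale /= mulr1.
  have := @is_derive1_comp _ expR (fun x : R => t * x) x (expR (t * x)) t _ dl.
  by rewrite [t * expR _]mulrC; apply.
have cF (x : R) : {for x, continuous (fun x : R => expR (t * x))}.
  apply: differentiable_continuous; apply/derivable1_diffP.
  by have [] := dF x.
rewrite (@continuous_FTC2 _ _ (fun x : R => expR (t * x)))//.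
- by rewrite -EFinB -EFinD addrC subrK.
- apply: continuous_in_subspaceT => x _.
  by apply: cvgM; [exact: cvg_cst|exact: cF].
- split.
  + by move=> x _; have [] := dF x.
  + by apply: cvg_at_right_filter; exact: cF.
  + by apply: cvg_at_left_filter; exact: cF.
- by move=> x _; have h := dF x; rewrite derive1E derive_val.
Qed.

(** Above [M] the exponential is the integral of its derivative; taking expectations and exchanging
    integrals brings in the tail. Values up to [M], where tail asymptotics say nothing, are bounded
    by a constant. *)
Lemma expR_moment_le (Y : T -> R) (t M : R) : measurable_fun setT Y -> 0 < t ->
  (\int[P]_w (expR (t * Y w))%:E <= (expR (t * M))%:E +
    \int[mu]_(x in `]M, +oo[) (t * expR (t * x) * tail P Y x)%:E)%E.
Proof.
move=> mY t0.
pose H (p : T * R) := (if (M < p.2) && (p.2 < Y p.1) then t * expR (t * p.2) else 0)%:E.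
have mY1 : measurable_fun setT (fun p : T * R => Y p.1).
  exact: (measurableT_comp mY measurable_fst).
have mt : measurable_fun setT (fun p : T * R => t * expR (t * p.2)).
  apply: measurable_funM => //; apply: measurableT_comp => //.
  exact: measurable_funM.
have mH : measurable_fun setT H.
  apply/measurable_EFinP; apply: measurable_fun_ifT => //.
  by apply: measurable_and; exact: measurable_fun_ltr.
have c0 (x : R) : 0 <= t * expR (t * x) by rewrite mulr_ge0 ?expR_ge0// ltW.
have H0 p : (0 <= H p)%E by rewrite /H; case: ifP => // _; rewrite lee_fin.
have mHF : measurable_fun setT (fun w => \int[mu]_x H (w, x))%E.
  exact: (measurable_fun_fubini_tonelli_F (m2 := mu) H).
have HF0 w : (0 <= \int[mu]_x H (w, x))%E by apply: integral_ge0.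
apply: (@le_trans _ _ (\int[P]_w ((expR (t * M))%:E + \int[mu]_x H (w, x))))%E.
  apply: ge0_le_integral => //.
  - by apply/measurable_EFinP; apply: measurableT_comp => //; exact: measurable_funM.
  - exact: emeasurable_funD.
  - by move=> w _; exact: expR_pointwise.
rewrite ge0_integralD//.
rewrite integral_cst//= probability_setT mule1 leeD2l//.
rewrite (_ : (\int[P]_w _ = \int[mu]_x \int[P]_w H (w, x))%E); last first.
  exact: (fubini_tonelli (m1 := P) (m2 := mu) H mH H0).
rewrite integral_gt_if le_eqVlt; apply/orP; left; apply/eqP.
apply: eq_integral => x _; case: ifPn => Mx; last first.
  rewrite (_ : (fun w => H (w, x)) = cst 0%E) ?integral0//.
  by apply/funext => w; rewrite /H /= (negbTE Mx).
rewrite EFinM tailE// -[X in P X]setIT -integral_indic//; last exact: measurable_gt.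
rewrite -ge0_integralZl//.
- apply: eq_integral => w _; rewrite /H /= Mx /= -EFinM indicE; congr EFin.
  rewrite (_ : (w \in _) = (x < Y w)); last by apply/idP/idP; rewrite inE.
  by case: ifP => _; rewrite ?mulr1 ?mulr0.
- apply/measurable_EFinP; apply: measurable_indic; exact: measurable_gt.
- by rewrite lee_fin.
Qed.

Lemma expR_moment_fin (Y : T -> R) (A g t : R) : measurable_fun setT Y ->
  0 < A -> gamma_tail P Y A g -> 0 < t -> t < 1 \/ (t = 1 /\ g < -1) ->
  (\int[P]_w (expR (t * Y w))%:E < +oo)%E.
Proof.
move=> mY A0 YA t0 tg.
have [C [r [C0 r1 hC]]] : exists C r, [/\ 0 < C, r < -1 &
    forall x : R, 1 <= x -> expR (t * x) * gdens g x <= C * x `^ r].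
  case: tg => [t1|[-> g1]].
    have e0 : 0 < 1 - t by rewrite subr_gt0.
    (* The spare exponential absorbs the power g + 2, so that the integrable x^(-2) is left. *)
    have [C C0 h] := powR_le_expR (g + 2) e0.
    exists C, (- 2); split => //; first by rewrite ltrN2 ltr1n.
    move=> x x1; have x0 : 0 < x by exact: lt_le_trans x1.
    have := h x x1; rewrite powRD ?(gt_eqF x0) ?implybT// => {}h.
    rewrite powRN ler_pdivlMr ?powR_gt0// /gdens.
    rewrite mulrAC mulrC -mulrA mulrC.
    have -> : C = C * expR ((1 - t) * x) * (expR (t * x) * expR (- x)).
      rewrite -expRD -mulrA -expRD (_ : _ + _ = 0) ?expR0 ?mulr1//; ring.
    apply: (@le_trans _ _ ((x `^ g * x `^ 2) * (expR (t * x) * expR (- x)))).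
      by rewrite le_eqVlt; apply/orP; left; apply/eqP; ring.
    by rewrite ler_wpM2r// mulr_ge0 ?expR_ge0.
  exists 1, g; split => // x _.
  by rewrite /gdens !mul1r mulrCA -expRD subrr expR0 mulr1.
have [M [M1 hM]] : exists M, 1 <= M /\ forall x, M <= x ->
    tail P Y x <= (A + 1) * gdens g x.
  apply: near_pinfty_ge1; near=> x.
  have x0 : 0 < x by near: x; exact: nbhs_pinfty_gt.
  have : tail P Y x / gdens g x < A + 1.
    by near: x; apply: (cvgr_lt A) => //; rewrite ltrDl.
  by rewrite ltr_pdivrMr ?gdens_gt0// => /ltW.
have M0 : 0 < M by exact: lt_le_trans M1.
apply: le_lt_trans (expR_moment_le M mY t0) _.
apply: lte_add_pinfty; first exact: ltry.
have K0 : 0 <= t * (A + 1) * C by rewrite !mulr_ge0// ltW// addr_gt0.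
apply: (@le_lt_trans _ _ ((t * (A + 1) * C)%:E *
    \int[mu]_(x in `[M, +oo[) (x `^ r)%:E)%E); last first.
  apply: lte_mul_pinfty => //.
  exact: le_lt_trans (integral_powR_oo r1 M0) (ltry _).
rewrite -integral_itv_obnd_cbnd; last exact: measurable_EFin_powR.
rewrite -ge0_integralZl//; last 2 first.
- exact: measurable_EFin_powR.
- by move=> x _; rewrite lee_fin powR_ge0.
apply: ge0_le_integral => //.
- move=> x _; rewrite lee_fin mulr_ge0 ?tail_ge0// mulr_ge0 ?expR_ge0// ltW//.
- apply/measurable_EFinP; apply: measurable_funM.
    by apply: measurable_funM => //; apply: measurableT_comp.
  by apply: measurable_funTS; exact: measurable_tail.
- by apply: measurable_funeM; exact: measurable_EFin_powR.
- move=> x; rewrite /= in_itv /= andbT => Mx; rewrite -EFinM lee_fin.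
  have x1 : 1 <= x by exact: le_trans M1 (ltW Mx).
  apply: (@le_trans _ _ (t * expR (t * x) * ((A + 1) * gdens g x))).
    rewrite ler_wpM2l ?hM ?(ltW Mx)// mulr_ge0 ?expR_ge0 ?ltW//.
  have -> : t * expR (t * x) * ((A + 1) * gdens g x) =
    t * (A + 1) * (expR (t * x) * gdens g x) by ring.
  rewrite -[leRHS]mulrA ler_wpM2l ?hC// mulr_ge0 ?ltW ?addr_gt0//.
Unshelve. all: by end_near. Qed.

End moments.

Lemma expectation_gt0 {d : measure_display} {T : measurableType d} {R : realType}
    (P : probability T R) (X : T -> R) :
  measurable_fun setT X -> (forall w, 0 <= X w) -> (0 < P [set w | (0 < X w)%R])%E ->
  (0 < \int[P]_w (X w)%:E)%E.
Proof.
move=> mX X0 PX.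
have I0 : (0 <= \int[P]_w (X w)%:E)%E.
  by apply: integral_ge0 => w _; rewrite lee_fin.
rewrite lt_neqAle I0 andbT eq_sym; apply/negP => /eqP IX.
have mXE : measurable_fun setT (fun w => (X w)%:E) by exact/measurable_EFinP.
have : (\int[P]_w `|(X w)%:E| = 0)%E.
  by under eq_integral do rewrite gee0_abs ?lee_fin//.
move/(ae_eq_integral_abs P measurableT mXE).1 => [A [mA PA0 sA]].
have : (P [set w | (0 < X w)%R] <= P A)%E.
  apply: le_measure; rewrite ?inE//; first exact: measurable_gt.
  by move=> w /= Xw; apply: sA => /= /(_ I) [] /eqP; rewrite gt_eqF.
by rewrite PA0 leNgt PX.
Qed.

Lemma identically_distributed_integral {d : measure_display} {T : measurableType d}
    {R : realType} (P : probability T R) (I : Type) (Y : I -> {RV P >-> R}) (i j : I)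
    (f : R -> \bar R) : identically_distributed Y -> measurable_fun setT f ->
  (forall x, 0 <= f x)%E -> (\int[P]_w f (Y i w) = \int[P]_w f (Y j w))%E.
Proof.
move=> Y_id mf f0.
rewrite -(ge0_integral_distribution (Y i) mf f0).
rewrite -(ge0_integral_distribution (Y j) mf f0).
by apply: eq_measure_integral => A mA _; exact: Y_id.
Qed.

(** * Almost sure convergence and exponential moments of weighted sums *)

Section weighted_sums.
Context {d : measure_display} {T : measurableType d} {R : realType}.
Variable P : probability T R.
Variable Y : nat -> {RV P >-> R}.
Implicit Types c : nat -> R.

Definition wsum c (m : nat) (w : T) : R := \sum_(0 <= n < m) c n * Y n w.

(** Terms with coefficient 0 do not count, so a sum is seen to depend only on its support; the
    independence of the unit part and the remainder is read off from this. *)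
Lemma measurable_wsum_gen (J : set nat) c m :
  (forall n, (n < m)%N -> c n != 0 -> J n) ->
  measurable_fun setT (wsum c m : g_sigma_algebraType (gen Y J) -> R).
Proof.
move=> cJ.
pose h n (w : g_sigma_algebraType (gen Y J)) : R :=
  (* Coefficients from [m] on are set to 0, so that every [h n] is measurable and not only those in
     the sum. *)
  (if (n < m)%N then c n else 0) * Y n w.
have -> : (wsum c m : g_sigma_algebraType (gen Y J) -> R) =
    (fun w => \sum_(n <- index_iota 0 m) h n w).
  apply/funext => w; rewrite /wsum; apply: eq_big_nat => n /andP[_ nm].
  by rewrite /h nm.
have m0 n : measurable_fun setT (fun w : g_sigma_algebraType (gen Y J) => 0 * Y n w).
  by rewrite (_ : (fun _ => _) = cst 0)//; apply/funext => w; rewrite mul0r.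
apply: measurable_sum => n; rewrite /h; case: ifPn => nm.
  have [->|cn] := eqVneq (c n) 0.
    exact: m0.
  by apply: measurable_funM => //; apply: measurable_gen; exact: cJ.
exact: m0.
Qed.

Lemma measurable_wsum c m : measurable_fun setT (wsum c m).
Proof.
apply: (@measurable_fun_gen _ _ _ _ _ Y setT).
exact: measurable_wsum_gen.
Qed.

Definition wseries c (w : T) : R := limn (fun m => wsum c m w).

Lemma measurable_wseries_gen (J : set nat) c :
  (forall n, c n != 0 -> J n) ->
  measurable_fun setT (wseries c : g_sigma_algebraType (gen Y J) -> R).
Proof.
move=> cJ; apply: (@measurable_limn _ (g_sigma_algebraType (gen Y J)) R (wsum c)).
by move=> m; apply: measurable_wsum_gen => n _; exact: cJ.
Qed.

Lemma measurable_wseries c : measurable_fun setT (wseries c).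
Proof.
apply: (@measurable_fun_gen _ _ _ _ _ Y setT).
exact: measurable_wseries_gen.
Qed.

Lemma measurable_RV n : measurable_fun setT (Y n).
Proof. exact: measurable_funP. Qed.

Hypothesis Y_iid : iid Y.

Lemma iid_integral n (f : R -> \bar R) : measurable_fun setT f ->
  (forall x, 0 <= f x)%E -> (\int[P]_w f (Y n w) = \int[P]_w f (Y 0%N w))%E.
Proof. exact: identically_distributed_integral Y_iid.1. Qed.

Lemma iid_tail n x : tail P (Y n) x = tail P (Y 0%N) x.
Proof.
have E (m : nat) : [set w | x < Y m w] = Y m @^-1` `]x, +oo[%classic.
  by apply/seteqP; split => w /=; rewrite in_itv /= andbT.
rewrite /tail !E; congr fine; exact: Y_iid.1.
Qed.

Lemma indep2_wsum_next c m : indep2 P (wsum c m) (Y m).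
Proof.
apply: (@indep2_gen _ _ _ _ _ Y [set n | (n < m)%N] [set m] _ _ Y_iid.2).
- by apply/seteqP; split => n //= [] /[swap] ->; rewrite ltnn.
- exact: measurable_wsum_gen.
- exact: measurable_gen.
Qed.

(** Independence factors the moment, and bounds of the form exp(C s) multiply to one that sees only
    the sum of the coefficients; for a convergent series it stays bounded as [m] grows. *)
Lemma expR_wsum_moment c q (t1 C : R) m :
  (forall n, 0 <= q * c n <= t1) ->
  (forall s, 0 <= s <= t1 -> (\int[P]_w (expR (s * Y 0%N w))%:E <= (expR (C * s))%:E)%E) ->
  (\int[P]_w (expR (q * wsum c m w))%:E <=
   (expR (C * (q * \sum_(0 <= n < m) c n)))%:E)%E.
Proof.
move=> qc hC; elim: m => [|m IH].
  under eq_integral do rewrite /wsum big_geq// mulr0 expR0.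
  by rewrite big_geq// !mulr0 expR0 integral_cst//= probability_setT mule1.
under eq_integral do rewrite /wsum big_nat_recr//= mulrDr expRD mulrA.
rewrite big_nat_recr//= mulrDr mulrDr expRD EFinM.
have mexp (k : R) : measurable_fun setT (fun x : R => expR (k * x)).
  by apply: measurableT_comp => //; exact: measurable_funM.
rewrite (@indep2_expectationM _ _ _ P (fun w => expR (q * wsum c m w))
   (fun w => expR (q * c m * Y m w))).
- apply: lee_pmul => //.
  + by apply: integral_ge0 => w _; rewrite lee_fin expR_ge0.
  + by apply: integral_ge0 => w _; rewrite lee_fin expR_ge0.
  + rewrite (@iid_integral m (fun y => (expR (q * c m * y))%:E)).
    * exact: hC.
    * exact/measurable_EFinP.
    * by move=> x; rewrite lee_fin expR_ge0.
- exact: (measurableT_comp (mexp q) (measurable_wsum c m)).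
- exact: (measurableT_comp (mexp (q * c m)) (measurable_RV m)).
- exact: (indep2_comp (mexp q) (mexp (q * c m)) (indep2_wsum_next c m)).
- by move=> w; exact: expR_ge0.
- by move=> w; exact: expR_ge0.
Qed.

(** On [0, t1] an exponential lies below its chord, so with [e] the moment at [t1], the moment at
    [s] is at most 1 + (e / t1) s. An exponent linear in [s] is what can be summed over the
    coefficients. *)
Lemma expR_moment_linear (t1 : R) : 0 < t1 ->
  (\int[P]_w (expR (t1 * Y 0%N w))%:E < +oo)%E ->
  exists2 C, 0 <= C & forall s, 0 <= s <= t1 ->
    (\int[P]_w (expR (s * Y 0%N w))%:E <= (expR (C * s))%:E)%E.
Proof.
move=> t10 fin.
have mexp (k : R) : measurable_fun setT (fun w => (expR (k * Y 0%N w))%:E).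
  apply/measurable_EFinP; apply: measurableT_comp => //.
  by apply: measurable_funM => //; exact: measurable_RV.
have fn : (\int[P]_w (expR (t1 * Y 0%N w))%:E)%E \is a fin_num.
  by rewrite ge0_fin_numE// integral_ge0// => w _; rewrite lee_fin expR_ge0.
set e := fine (\int[P]_w (expR (t1 * Y 0%N w))%:E).
have e0 : 0 <= e by rewrite fine_ge0// integral_ge0// => w _; rewrite lee_fin expR_ge0.
exists (e / t1); first by rewrite divr_ge0// ltW.
move=> s /andP[s0 st].
have l01 : 0 <= s / t1 <= 1 by rewrite divr_ge0 ?(ltW t10)//= ler_pdivrMr// mul1r.
have /andP[l0 l1] := l01.
apply: (@le_trans _ _ (\int[P]_w ((1 - s / t1)%:E +
    (s / t1)%:E * (expR (t1 * Y 0%N w))%:E))%E).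
  apply: ge0_le_integral => //.
  - by apply: emeasurable_funD => //; exact: measurable_funeM.
  - move=> w _; rewrite -EFinM -EFinD lee_fin.
    have -> : s * Y 0%N w = s / t1 * (t1 * Y 0%N w) by rewrite mulrA divfK// gt_eqF.
    exact: expR_convex.
rewrite ge0_integralD//; last 3 first.
- by move=> w _; rewrite lee_fin subr_ge0.
- by move=> w _; rewrite -EFinM lee_fin mulr_ge0 ?expR_ge0.
- exact: measurable_funeM.
rewrite integral_cst//= probability_setT mule1 ge0_integralZl//.
rewrite -(fineK fn) -/e -EFinM -EFinD lee_fin.
apply: le_trans (expR_ge1Dx _).
have -> : e / t1 * s = s / t1 * e by ring.
lra.
Qed.

Hypothesis Y2 : (\int[P]_w (Y 0%N w ^+ 2)%:E < +oo)%E.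

Lemma abs_moment : (\int[P]_w `|Y 0%N w|%:E < +oo)%E.
Proof.
have m2 : measurable_fun setT (fun w => (Y 0%N w ^+ 2)%:E).
  by apply/measurable_EFinP; apply: measurable_funX; exact: measurable_RV.
apply: (@le_lt_trans _ _ (\int[P]_w (1%:E + (Y 0%N w ^+ 2)%:E))%E).
  apply: ge0_le_integral => //.
  - by apply/measurable_EFinP; apply: measurableT_comp => //; exact: measurable_RV.
  - exact: emeasurable_funD.
  - move=> w _; rewrite -EFinD lee_fin -(real_normK (num_real (Y 0%N w))).
    by move: (`|Y 0%N w|) => y; nra.
rewrite ge0_integralD//; last by move=> w _; rewrite lee_fin sqr_ge0.
by rewrite integral_cst//= probability_setT mule1 lte_add_pinfty// ltry.
Qed.

(** The series of expectations is the mean of |Y_0| times the sum of the coefficients; a nonnegative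
    series with finite expectation is finite almost everywhere. *)
Lemma wseries_abs_cvg c : (forall n, 0 <= c n) -> cvgn (series c) ->
  {ae P, forall w, cvgn (series (fun n => c n * `|Y n w|))}.
Proof.
move=> c0 cc.
have mn n : measurable_fun setT (fun w => (c n * `|Y n w|)%:E).
  apply/measurable_EFinP; apply: measurable_funM => //.
  by apply: measurableT_comp => //; exact: measurable_RV.
have n0 n w : (0 <= (c n * `|Y n w|)%:E)%E by rewrite lee_fin mulr_ge0.
have EY n : (\int[P]_w (c n * `|Y n w|)%:E =
    (\int[P]_w `|Y 0%N w|%:E) * (c n)%:E)%E.
  under eq_integral do rewrite EFinM.
  have mY : measurable_fun setT (fun w => `|Y n w|%:E).
    by apply/measurable_EFinP; apply: measurableT_comp => //; exact: measurable_RV.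
  rewrite ge0_integralZl//; last by rewrite lee_fin.
  rewrite (@iid_integral n (fun y => `|y|%:E)) 1?muleC//.
  exact/measurable_EFinP.
have fin0 : (\int[P]_w `|Y 0%N w|%:E)%E \is a fin_num.
  by rewrite ge0_fin_numE ?abs_moment// integral_ge0.
have cfin : (\sum_(0 <= n <oo) (c n)%:E < +oo)%E.
  have -> : (\sum_(0 <= n <oo) (c n)%:E = (limn (series c))%:E)%E.
    apply/cvg_lim => //.
    have -> : (fun n => \sum_(0 <= k < n) (c k)%:E)%E = EFin \o series c.
      by apply/funext => n /=; rewrite sumEFin.
    by apply: cvg_EFin; [exact: nearW|exact: cc].
  exact: ltry.
have Sfin : (\int[P]_w (\sum_(0 <= n <oo) (c n * `|Y n w|)%:E) < +oo)%E.
  rewrite integral_nneseries//.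
  under eq_eseriesr do rewrite EY.
  rewrite -(fineK fin0) nneseriesZl; last by move=> n _; rewrite lee_fin.
  by apply: lte_mul_pinfty => //; rewrite lee_fin fine_ge0// integral_ge0.
have mS : measurable_fun setT (fun w => \sum_(0 <= n <oo) (c n * `|Y n w|)%:E)%E.
  by apply: ge0_emeasurable_sum.
have iS : P.-integrable setT (fun w => \sum_(0 <= n <oo) (c n * `|Y n w|)%:E)%E.
  apply/integrableP; split => //.
  under eq_integral do rewrite gee0_abs ?nneseries_ge0//.
  exact: Sfin.
apply: filterS (integrable_ae measurableT iS) => w /(_ I) Sw.
apply: nondecreasing_is_cvgn.
  by apply: nondecreasing_series => n _ _; rewrite mulr_ge0.
exists (fine (\sum_(0 <= n <oo) (c n * `|Y n w|)%:E)%E) => _ [m _ <-].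
rewrite -lee_fin fineK// /series /= -sumEFin.
by apply: nneseries_lim_ge => *; exact: n0.
Qed.

Lemma wsum_cvg c c' w : (forall n, `|c' n| <= c n) ->
  cvgn (series (fun n => c n * `|Y n w|)) -> cvgn (fun m => wsum c' m w).
Proof.
move=> cc' cv; apply: normed_cvg.
apply: (series_le_cvg _ _ _ cv) => n /=; first exact: normr_ge0.
- by rewrite mulr_ge0// (le_trans _ (cc' n)).
- by rewrite normrM ler_wpM2r.
Qed.

Lemma expR_wseries_moment c q (t1 C : R) : cvgn (series c) ->
  0 <= C -> 0 <= q -> (forall n, 0 <= c n) -> (forall n, 0 <= q * c n <= t1) ->
  (forall s, 0 <= s <= t1 -> (\int[P]_w (expR (s * Y 0%N w))%:E <= (expR (C * s))%:E)%E) ->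
  (\int[P]_w (expR (q * wseries c w))%:E < +oo)%E.
Proof.
move=> cc C0 q0 c0 qc hC.
pose f m w := (expR (q * wsum c m w))%:E.
have mexp (k : R) : measurable_fun setT (fun x : R => expR (k * x)).
  by apply: measurableT_comp => //; exact: measurable_funM.
have mf m : measurable_fun setT (f m).
  by apply/measurable_EFinP; exact: (measurableT_comp (mexp q) (measurable_wsum c m)).
have f0 m w : (0 <= f m w)%E by rewrite lee_fin expR_ge0.
have cS m : \sum_(0 <= n < m) c n <= limn (series c).
  by apply: nondecreasing_cvgn_le => //; apply: nondecreasing_series.
apply: (@le_lt_trans _ _ (expR (C * (q * limn (series c))))%:E); last exact: ltry.
(* [wseries] has a default value where the partial sums diverge, so its exponential agrees with the
   lower limit only almost everywhere; Fatou's lemma handles the latter. *)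
apply: (@le_trans _ _ (\int[P]_w limn_einf (f ^~ w))%E).
  rewrite le_eqVlt; apply/orP; left; apply/eqP.
  apply: ge0_ae_eq_integral => //.
  - by apply/measurable_EFinP; exact: (measurableT_comp (mexp q) (measurable_wseries c)).
  - exact: measurable_limn_einf.
  - by move=> w _; exact: limn_einf_ge.
  apply: filterS (wseries_abs_cvg c0 cc) => w cv _.
  have cw : cvgn (fun m => wsum c m w).
    by apply: wsum_cvg cv => n; rewrite ger0_norm.
  have cf : f m w @[m --> \oo] --> (expR (q * wseries c w))%:E.
    apply: cvg_EFin; first exact: nearW.
    apply: (cvg_comp (fun m => q * wsum c m w) expR); last exact: continuous_expR.
    by apply: cvgMr; exact: cw.
  by have [-> _] := cvg_limn_einf_sup cf.
apply: le_trans (fatou P measurableT mf (fun n x _ => f0 n x)) _.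
apply: limn_einf_le => m; apply: le_trans (expR_wsum_moment m qc hC) _.
by rewrite lee_fin ler_expR !ler_wpM2l.
Qed.

End weighted_sums.

(** * The sum of the innovations with coefficient 1 *)

Section gamma_sums.
Context {d : measure_display} {T : measurableType d} {R : realType}.
Variable P : probability T R.
Variable Y : nat -> {RV P >-> R}.
Variables (alpha : nat -> R) (beta K : R).
Hypotheses (Y_iid : iid Y) (K0 : 0 < K) (betaN1 : beta != -1)
  (Y_tail : gamma_tail P (Y 0%N) K beta).

(** [unit_coef] and [rest_coef] split [alpha] into the coefficients equal to 1 and the others,
    padded with zeros so that all sums run over the same indices. *)
Definition unit_coef (n : nat) : R := (alpha n == 1)%:R.
Definition rest_coef (n : nat) : R := if alpha n == 1 then 0 else alpha n.
Definition count_unit (m : nat) : nat := (\sum_(0 <= n < m) (alpha n == 1%R))%N.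

(** With j copies in place of k, [sum_shape] is [betahat] and [sum_scale] is [Khat] without the
    moment of the remainder; the induction passes through every j up to k. *)
Definition sum_shape (j : nat) : R :=
  if -1 < beta then j%:R * beta + j%:R - 1 else beta.
Definition sum_scale (j : nat) : R :=
  if -1 < beta then K ^+ j * (Gamma (beta + 1) ^+ j / Gamma (j%:R * (beta + 1)))
  else j%:R * K * fine (\int[P]_w (expR (Y 0%N w))%:E) ^+ j.-1.

Lemma gamma_tail_iid n : gamma_tail P (Y n) K beta.
Proof. by rewrite /gamma_tail; under eq_fun do rewrite (iid_tail Y_iid). Qed.

Lemma expR_iid_fin : beta < -1 ->
  ((\int[P]_w (expR (Y 0%N w))%:E) \is a fin_num)%E /\
  0 < fine (\int[P]_w (expR (Y 0%N w))%:E).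
Proof.
move=> b1; have mY := measurable_RV Y 0%N.
have fin : (\int[P]_w (expR (Y 0%N w))%:E < +oo)%E.
  have := @expR_moment_fin _ _ _ P (Y 0%N) K beta 1 mY K0 Y_tail ltr01 (or_intror (conj erefl b1)).
  by under eq_integral do rewrite mul1r.
have ge0 : (0 <= \int[P]_w (expR (Y 0%N w))%:E)%E.
  by apply: integral_ge0 => w _; rewrite lee_fin expR_ge0.
split; first by rewrite ge0_fin_numE.
rewrite fine_gt0// fin andbT; apply: expectation_gt0 => //.
- exact: measurableT_comp.
- rewrite (_ : [set w | _] = setT) ?probability_setT//.
  by apply/seteqP; split => w //= _; exact: expR_gt0.
Qed.

Lemma sum_scale_gt0 j : (0 < j)%N -> 0 < sum_scale j.
Proof.
move=> j0; rewrite /sum_scale; case: ifPn => b1.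
  have b10 : 0 < beta + 1 by rewrite -ltrBlDr sub0r.
  rewrite mulr_gt0 ?exprn_gt0// divr_gt0 ?exprn_gt0 ?Gamma_gt0//.
  by rewrite mulr_gt0 ?ltr0n.
rewrite mulr_gt0 ?mulr_gt0 ?ltr0n// exprn_gt0//.
by apply: (expR_iid_fin _).2; rewrite lt_neqAle betaN1 leNgt.
Qed.

(** The three parts go through the induction together. Until a coefficient 1 is met, the sum is 0
    and has no Gamma-type tail, so the first part needs the second to start. The convolution for
    beta < -1 asks for the exponential moment, kept in the third. *)
Lemma gamma_tail_unit_sum m :
  [/\ (0 < count_unit m)%N -> gamma_tail P (wsum Y unit_coef m)
        (sum_scale (count_unit m)) (sum_shape (count_unit m)),
      count_unit m = 0%N -> wsum Y unit_coef m = cst 0 &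
      beta < -1 -> (\int[P]_w (expR (wsum Y unit_coef m w))%:E =
        (fine (\int[P]_w (expR (Y 0%N w))%:E) ^+ count_unit m)%:E)%E].
Proof.
elim: m => [|m [IH1 IH2 IH3]].
  rewrite /count_unit big_geq//; split => //.
  - by move=> _; apply/funext => w; rewrite /wsum big_geq.
  - move=> _; under eq_integral do rewrite /wsum big_geq// expR0.
    by rewrite integral_cst//= probability_setT mule1 expr0.
have cE : count_unit m.+1 = (count_unit m + (alpha m == 1%R))%N.
  by rewrite /count_unit big_nat_recr.
have wE : wsum Y unit_coef m.+1 = fun w => wsum Y unit_coef m w + unit_coef m * Y m w.
  by apply/funext => w; rewrite /wsum big_nat_recr.
rewrite cE wE /unit_coef; case: eqP => am /=; last first.
  rewrite addn0; under eq_fun do rewrite mul0r addr0.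
  split => //.
  by move=> b1; under eq_integral do rewrite mul0r addr0; exact: IH3.
rewrite addn1; under eq_fun do rewrite mul1r.
have mU := measurable_wsum Y unit_coef m; have mV := measurable_RV Y m.
have UV := indep2_wsum_next Y_iid unit_coef m.
have eqEY : beta < -1 -> (\int[P]_w (expR (Y m w))%:E =
    (fine (\int[P]_w (expR (Y 0%N w))%:E))%:E)%E.
  move=> b1; rewrite fineK; last exact: (expR_iid_fin b1).1.
  apply: (@iid_integral _ _ _ _ _ Y_iid m (fun y => (expR y)%:E)).
  - exact/measurable_EFinP.
  - by move=> x; rewrite lee_fin expR_ge0.
have IE : beta < -1 -> (\int[P]_w (expR (wsum Y unit_coef m w + Y m w))%:E =
    (fine (\int[P]_w (expR (Y 0%N w))%:E) ^+ (count_unit m).+1)%:E)%E.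
  move=> b1; under eq_integral do rewrite expRD.
  rewrite (@indep2_expectationM _ _ _ P (fun w => expR (wsum Y unit_coef m w))
    (fun w => expR (Y m w))).
  - by rewrite IH3// eqEY// -EFinM exprSr.
  - exact: measurableT_comp.
  - exact: measurableT_comp.
  - exact: (indep2_comp (f := expR) (g := expR)).
  - by move=> w; exact: expR_ge0.
  - by move=> w; exact: expR_ge0.
split => //; last by move=> b1; under eq_integral do rewrite mul1r; exact: IE.
move=> _; have [k0|k0] := posnP (count_unit m).
  rewrite k0; have -> : (fun w => wsum Y unit_coef m w + Y m w) = Y m.
    by apply/funext => w; rewrite IH2//= add0r.
  rewrite /sum_scale /sum_shape; case: ifPn => b1; last first.
    by rewrite expr0 mulr1 mul1r; exact: gamma_tail_iid.
  rewrite !expr1 !mul1r addrK divff ?mulr1; first exact: gamma_tail_iid.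
  by rewrite gt_eqF// Gamma_gt0// -ltrBlDr sub0r.
have {}IH1 := IH1 k0; have s0 := sum_scale_gt0 k0.
move: IH1 s0 IH3; rewrite /sum_scale /sum_shape; case: ifPn => b1 IH1 s0 IH3; last first.
  have {}b1 : beta < -1 by rewrite lt_neqAle betaN1 leNgt.
  have := @gamma_tail_conv_ltN1 _ _ _ P _ _ _ _ _ mU mV UV b1 s0 K0 IH1 (gamma_tail_iid m) _ _.
  rewrite IH3// eqEY// => /(_ (ltry _) (ltry _)) /=; congr gamma_tail.
  have [j ->] : exists j, count_unit m = j.+1 by exists (count_unit m).-1; rewrite prednK.
  by rewrite /= exprSr -[in RHS]addn1 natrD; ring.
have b10 : 0 < beta + 1 by rewrite -ltrBlDr sub0r.
have k0' : (0 : R) < (count_unit m)%:R by rewrite ltr0n.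
have g1 : -1 < (count_unit m)%:R * beta + (count_unit m)%:R - 1.
  rewrite -subr_gt0 (_ : _ - _ = (count_unit m)%:R * (beta + 1)); last by ring.
  by rewrite mulr_gt0.
(* The scale of j copies has Gamma (j (beta + 1)) in its denominator, which cancels against the
   numerator of the new Beta integral: the product of Beta integrals telescopes. *)
have := @gamma_tail_conv_gtN1 _ _ _ P _ _ _ _ _ _ mU mV UV g1 b1 s0 K0 IH1 (gamma_tail_iid m).
have -> : (count_unit m)%:R * beta + (count_unit m)%:R - 1 + 1 =
  (count_unit m)%:R * (beta + 1) by ring.
have -> : (count_unit m)%:R * beta + (count_unit m)%:R - 1 + beta + 2 =
  (count_unit m).+1%:R * (beta + 1) by rewrite -[in RHS]addn1 natrD; ring.
have -> : (count_unit m)%:R * beta + (count_unit m)%:R - 1 + beta + 1 =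
  (count_unit m).+1%:R * beta + (count_unit m).+1%:R - 1.
  by rewrite -[in RHS]addn1 natrD; ring.
congr gamma_tail; rewrite !exprSr; field.
by rewrite !gt_eqF// Gamma_gt0// mulr_gt0// ltr0n.
Qed.

End gamma_sums.

(** * The gap between the remaining coefficients and 1 *)

Section coefficients.
Context {R : realType}.
Variable alpha : nat -> R.
Hypotheses (alpha01 : forall n, 0 <= alpha n <= 1) (alpha_cvg : cvgn (series alpha)).

Lemma alpha_small : exists N, forall n, (N <= n)%N -> alpha n <= 2^-1.
Proof.
have := cvg_series_cvg_0 alpha_cvg => /cvgrPdist_le /(_ 2^-1).
rewrite invr_gt0 ltr0n => /(_ isT) [N _ h]; exists N => n Nn.
have := h n Nn; rewrite /= sub0r normrN ger0_norm//.
by have /andP[] := alpha01 n.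
Qed.

Lemma rest_coef_ge0 n : 0 <= rest_coef alpha n.
Proof. by rewrite /rest_coef; case: ifP => // _; have /andP[] := alpha01 n. Qed.

Lemma rest_coef_le n : rest_coef alpha n <= alpha n.
Proof. by rewrite /rest_coef; case: ifP => // _; have /andP[] := alpha01 n. Qed.

Lemma unit_rest_coefE n : alpha n = unit_coef alpha n + rest_coef alpha n.
Proof. by rewrite /unit_coef /rest_coef; case: eqP => [->|_]; rewrite ?addr0 ?add0r. Qed.

Lemma rest_coef_cvg : cvgn (series (rest_coef alpha)).
Proof. exact: (series_le_cvg rest_coef_ge0 (fun n => (andP (alpha01 n)).1) rest_coef_le). Qed.

(** Only finitely many coefficients exceed 1/2, so those different from 1 stay uniformly below 1.
    The gap leaves room for a moment of order above 1. *)
Lemma rest_coef_bound : exists2 r, 2^-1 <= r < 1 & forall n, rest_coef alpha n <= r.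
Proof.
have [N hN] := alpha_small.
have [r /andP[r1 r2] hr] : exists2 r, 2^-1 <= r < 1 &
    forall n, (n < N)%N -> rest_coef alpha n <= r.
  elim: {hN}N => [|N [r /andP[r1 r2] hr]].
    by exists 2^-1 => //; rewrite lexx invf_lt1// ltr1n.
  exists (Num.max r (rest_coef alpha N)).
    rewrite le_max r1/= gt_max r2 /= /rest_coef; case: eqP => // aN.
    by rewrite lt_neqAle; have /andP[_ ->] := alpha01 N; rewrite andbT; apply/eqP.
  move=> n; rewrite ltnS leq_eqVlt => /orP[/eqP->|/hr h].
    by rewrite le_max lexx orbT.
  by rewrite le_max h.
exists r; first by rewrite r1.
move=> n; have [/hr//|Nn] := ltnP n N.
by rewrite (le_trans (rest_coef_le n))// (le_trans (hN n Nn)).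
Qed.

Lemma cardLambdaE N : (forall n, (N <= n)%N -> alpha n <= 2^-1) ->
  cardLambda alpha = count_unit alpha N.
Proof.
move=> hN; rewrite /cardLambda.
have aN n : alpha n = 1 -> (n < N)%N.
  move=> an; rewrite ltnNge; apply/negP => /hN; rewrite an leNgt => /negP; apply.
  by rewrite invf_lt1// ltr1n.
have fL : finite_set (Lambda alpha).
  apply: (@sub_finite_set _ _ `I_N); last exact: finite_II.
  by move=> n; exact: aN.
have -> : fset_set (Lambda alpha) = [fset n in [seq n <- index_iota 0 N | alpha n == 1]]%fset.
  apply/fsetP => n; rewrite in_fset_set// !inE mem_filter mem_index_iota /=.
  apply/idP/idP; rewrite inE /Lambda /=.
    by move=> an; rewrite an eqxx aN.
  by move=> /andP[/eqP].
rewrite card_fseq undup_id; last by rewrite filter_uniq// iota_uniq.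
by rewrite size_filter -sum1_count big_mkcond /count_unit; apply: eq_bigr => n _; case: eqP.
Qed.

End coefficients.

Section pathseries.
Context {R : realType}.

(** A function on path space, so that processes built from it are functions of the path of the
    innovations. *)
Definition pathseries (c : nat -> R) (x : nat -> R) : R :=
  limn (fun m => \sum_(0 <= n < m) c n * x n).

Lemma measurable_pathseries {d : measure_display} {T : measurableType d} c
    (f : T -> nat -> R) : (forall n, measurable_fun setT (f ^~ n)) ->
  measurable_fun setT (fun w => pathseries c (f w)).
Proof.
move=> mf; apply: (@measurable_limn _ T R (fun m w => \sum_(0 <= n < m) c n * f w n)).
by move=> m; apply: measurable_sum => n; exact: measurable_funM.
Qed.

End pathseries.

(** * Tail of the log-volatility *)

Section log_volatility.
Context {d : measure_display} {T : measurableType d} {R : realType}.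
Variable P : probability T R.
Variables (Y : nat -> {RV P >-> R}) (alpha : nat -> R) (beta K : R).
Hypotheses (Y_iid : iid Y) (Y2 : (\int[P]_w (Y 0%N w ^+ 2)%:E < +oo)%E)
  (K0 : 0 < K) (betaN1 : beta != -1) (Y_tail : gamma_tail P (Y 0%N) K beta)
  (alpha01 : forall n, 0 <= alpha n <= 1) (alpha_cvg : cvgn (series alpha))
  (alpha_max : exists n, alpha n = 1).

Lemma rest_moment : exists2 q, 1 < q &
  (\int[P]_w (expR (wseries Y (rest_coef alpha) w) `^ q)%:E < +oo)%E.
Proof.
have [r /andP[r1 r2] hr] := rest_coef_bound alpha01 alpha_cvg.
have r0 : 0 < r by apply: lt_le_trans r1; rewrite invr_gt0.
(* [t1] lies strictly between r and 1: below 1 the exponential moment of that order is finite, and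
   above r the quotient [q] exceeds 1, while [q] times any remaining coefficient is at most [t1]. *)
pose t1 := (1 + r) / 2; pose q := t1 / r.
have t10 : 0 < t1 by rewrite divr_gt0// addr_gt0.
have t11 : t1 < 1 by rewrite ltr_pdivrMr//; lra.
have q1 : 1 < q by rewrite ltr_pdivlMr// mul1r ltr_pdivlMr//; lra.
exists q => //.
have [C C0 hC] := expR_moment_linear t10
  (expR_moment_fin (measurable_RV Y 0%N) K0 Y_tail t10 (or_introl t11)).
have q0 : 0 <= q by rewrite ltW// (lt_trans _ q1).
have qc n : 0 <= q * rest_coef alpha n <= t1.
  rewrite mulr_ge0 ?rest_coef_ge0//= -[leRHS](divfK (lt0r_neq0 r0)).
  by rewrite ler_wpM2l.
have := expR_wseries_moment Y_iid Y2 (rest_coef_cvg alpha01 alpha_cvg) C0 q0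
  (rest_coef_ge0 alpha01) qc hC.
apply: le_lt_trans; rewrite le_eqVlt; apply/orP; left; apply/eqP.
by apply: eq_integral => w _; rewrite -expRM mulrC.
Qed.

Lemma wseries_split N : (forall n, (N <= n)%N -> alpha n <= 2^-1) ->
  {ae P, forall w, wseries Y alpha w =
    wsum Y (unit_coef alpha) N w + wseries Y (rest_coef alpha) w}.
Proof.
move=> hN.
have := wseries_abs_cvg Y_iid Y2 (fun n => (andP (alpha01 n)).1) alpha_cvg.
apply: filterS => w cv.
have cr : cvgn (fun m => wsum Y (rest_coef alpha) m w).
  apply: wsum_cvg cv => n; rewrite ger0_norm ?rest_coef_ge0//; exact: rest_coef_le.
(* From [N] on no coefficient equals 1, so the unit part is complete. *)
have lN m : (N <= m)%N -> wsum Y (unit_coef alpha) m w = wsum Y (unit_coef alpha) N w.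
  move=> Nm; rewrite /wsum (big_cat_nat (leq0n N) Nm)/= [X in _ + X]big1_seq ?addr0//.
  move=> n /andP[_]; rewrite mem_index_iota => /andP[Nn _].
  rewrite /unit_coef (_ : alpha n == 1 = false) ?mul0r//; apply/eqP => an.
  by have := hN n Nn; rewrite an leNgt invf_lt1// ltr1n.
rewrite /wseries; apply/cvg_lim => //.
have : wsum Y (unit_coef alpha) N w + wsum Y (rest_coef alpha) m w @[m --> \oo] -->
    wsum Y (unit_coef alpha) N w + limn (fun m => wsum Y (rest_coef alpha) m w).
  by apply: cvgD; [exact: cvg_cst|exact: cr].
apply: cvg_trans; apply: near_eq_cvg; exists N => // m /= Nm.
rewrite -(lN m Nm) /wsum -big_split /=; apply: eq_bigr => n _.
by rewrite -mulrDl -unit_rest_coefE.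
Qed.

Definition rest_mgf : R := fine (\int[P]_w (expR (wseries Y (rest_coef alpha) w))%:E).

Lemma log_volatility_tail :
  0 < rest_mgf /\
  gamma_tail P (wseries Y alpha)
    (sum_scale Y beta K (cardLambda alpha) * rest_mgf)
    (sum_shape beta (cardLambda alpha)).
Proof.
have [N hN] := alpha_small alpha01 alpha_cvg.
have k0 : (0 < count_unit alpha N)%N.
  have [n an] := alpha_max.
  have nN : (n < N)%N.
    rewrite ltnNge; apply/negP => /hN; rewrite an leNgt => /negP; apply.
    by rewrite invf_lt1// ltr1n.
  rewrite /count_unit (big_cat_nat (leq0n n) (ltnW nN))/= [X in (_ + X)%N]big_ltn// an eqxx.
  by rewrite addnCA.
rewrite (cardLambdaE hN).
have [/(_ k0) Utail _ _] := gamma_tail_unit_sum alpha Y_iid K0 betaN1 Y_tail N.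
have [q q1 Vq] := rest_moment.
have mU := measurable_wsum Y (unit_coef alpha) N.
have mR := measurable_wseries Y (rest_coef alpha).
(* The two sums use innovations with indices in [Lambda alpha] and in its complement. *)
have UR : indep2 P (wsum Y (unit_coef alpha) N) (wseries Y (rest_coef alpha)).
  apply: (@indep2_gen _ _ _ _ _ Y (Lambda alpha) (~` Lambda alpha) _ _ Y_iid.2).
  - exact: setICr.
  - apply: measurable_wsum_gen => n _; rewrite /unit_coef /Lambda /=.
    by case: (alpha n =P 1) => // _; rewrite eqxx.
  - apply: measurable_wseries_gen => n; rewrite /rest_coef /Lambda /=.
    by case: (alpha n =P 1) => // _; rewrite eqxx.
have meR : measurable_fun setT (fun w => expR (wseries Y (rest_coef alpha) w)).
  exact: measurableT_comp.
have UV : indep2 P (wsum Y (unit_coef alpha) N) (fun w => expR (wseries Y (rest_coef alpha) w)).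
  exact: (indep2_comp (f := id) (g := expR)).
have V0 w : 0 <= expR (wseries Y (rest_coef alpha) w) by exact: expR_ge0.
have s0 : 0 < sum_scale Y beta K (count_unit alpha N).
  exact: sum_scale_gt0.
split.
  rewrite /rest_mgf fine_gt0//; apply/andP; split.
    apply: expectation_gt0 => //.
    rewrite (_ : [set w | _] = setT) ?probability_setT//.
    by apply/seteqP; split => w //= _; exact: expR_gt0.
  apply: (@le_lt_trans _ _ (\int[P]_w (1%:E + (expR (wseries Y (rest_coef alpha) w) `^ q)%:E))%E).
    apply: ge0_le_integral => //.
    - exact/measurable_EFinP.
    - apply: emeasurable_funD => //; apply/measurable_EFinP.
      exact: (measurableT_comp (measurable_powR _)).
    - move=> w _; rewrite -EFinD lee_fin.
      have [h|h] := leP (expR (wseries Y (rest_coef alpha) w)) 1.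
        by apply: le_trans h _; rewrite lerDl powR_ge0.
      apply: (@le_trans _ _ (expR (wseries Y (rest_coef alpha) w) `^ q)).
        by rewrite le1r_powR ?ltW.
      by rewrite lerDr.
  rewrite ge0_integralD//.
  - by rewrite integral_cst//= probability_setT mule1 lte_add_pinfty// ltry.
  - apply/measurable_EFinP; exact: (measurableT_comp (measurable_powR _)).
have := breiman_gamma mU meR UV V0 q1 Vq s0 Utail.
apply: cvg_trans; apply: near_eq_cvg; apply: nearW => z.
congr (_ / _).
have mL : measurable_fun setT (fun w => expR (wseries Y alpha w)).
  by apply: measurableT_comp => //; exact: measurable_wseries.
rewrite -[z in RHS]expRK -(tail_expR P (wseries Y alpha) (expR_gt0 z)).
apply: tail_ae_eq => //.
- by apply: measurable_funM => //; exact: measurableT_comp.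
- by apply: filterS (wseries_split hN) => w ->; rewrite expRD.
Qed.

End log_volatility.

(** * Normalizing constants *)

Section normalization.
Context {d : measure_display} {T : measurableType d} {R : realType}.
Variable P : probability T R.

Lemma cvg_ln_over : ln x / x @[x --> +oo] --> (0 : R).
Proof.
have := cvg_comp _ _ (@cvg_ln_pinfty R) (@cvg_powR_expN R 1).
apply: cvg_trans; apply: near_eq_cvg; near=> x.
have x1 : 1 < x by near: x; exact: nbhs_pinfty_gt.
rewrite /= powRr1 ?ln_ge0 ?(ltW x1)// expRN lnK// posrE.
exact: lt_trans x1.
Unshelve. all: by end_near. Qed.

Lemma cvg_ln_nat : ln n%:R @[n --> \oo] --> (+oo : set_system R).
Proof. exact: (cvg_comp _ _ (@cvgr_idn R) cvg_ln_pinfty). Qed.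

(** The logarithm expands as ln n + g ln ln n + ln C + ln z, where all but the first term are
    negligible against ln n. *)
Lemma cvg_ln_norming_ratio (C g z : R) : 0 < C -> 0 < z ->
  ln (C * n%:R * ln n%:R `^ g * z) / ln n%:R @[n --> \oo] --> (1 : R).
Proof.
move=> C0 z0.
have : 1 + (ln C + ln z) * (ln n%:R)^-1 + g * (ln (ln n%:R) / ln n%:R)
    @[n --> \oo] --> 1 + (ln C + ln z) * 0 + g * 0.
  apply: cvgD; last first.
    by apply: cvgMr; exact: (cvg_comp _ _ cvg_ln_nat cvg_ln_over).
  apply: cvgD; first exact: cvg_cst.
  apply: cvgMr.
  have inv0 : x^-1 @[x --> +oo] --> (0 : R).
    have := @cvg_powRN R 1 ltr01.
    apply: cvg_trans; apply: near_eq_cvg; near=> x.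
    by rewrite powR_inv1//; near: x; exact: nbhs_pinfty_ge.
  exact: (cvg_comp _ _ cvg_ln_nat inv0).
rewrite !mulr0 !addr0; apply: cvg_trans; apply: near_eq_cvg; near=> n.
have l1 : 1 < ln (n%:R : R) by near: n; exact: (@cvgry_gt _ _ \oo _ _ cvg_ln_nat 1).
have l0 : 0 < ln (n%:R : R) by exact: lt_trans l1.
have n0 : 0 < n%:R :> R by rewrite ltr0n; near: n; exists 1%N.
rewrite !lnM ?posrE ?mulr_gt0 ?powR_gt0// ln_powR.
by field; rewrite gt_eqF.
Unshelve. all: by end_near. Qed.

Lemma cvg_ln_norming (C g z : R) : 0 < C -> 0 < z ->
  ln (C * n%:R * ln n%:R `^ g * z) @[n --> \oo] --> +oo.
Proof.
move=> C0 z0; apply/cvgryPge => A; near=> n.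
have h : 2^-1 < ln (C * n%:R * ln n%:R `^ g * z) / ln n%:R.
  near: n; apply: (cvgr_gt 1); first exact: cvg_ln_norming_ratio.
  by rewrite invf_lt1// ltr1n.
have l0 : 0 < ln (n%:R : R) by near: n; exact: (@cvgry_gt _ _ \oo _ _ cvg_ln_nat 0).
have lA : 2 * A <= ln (n%:R : R) by near: n; exact: (@cvgry_ge _ _ \oo _ _ cvg_ln_nat (2 * A)).
move: h; rewrite ltr_pdivlMr//; lra.
Unshelve. all: by end_near. Qed.

Lemma cvg_norming (C g z : R) : 0 < C -> 0 < z ->
  C * n%:R * ln n%:R `^ g * z @[n --> \oo] --> +oo.
Proof.
move=> C0 z0.
have := cvg_comp _ _ (cvg_ln_norming g C0 z0) (@cvg_expR_pinfty R).
apply: cvg_trans; apply: near_eq_cvg; near=> n.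
have l0 : 0 < ln (n%:R : R) by near: n; exact: (@cvgry_gt _ _ \oo _ _ cvg_ln_nat 0).
have n0 : 0 < n%:R :> R by rewrite ltr0n; near: n; exists 1%N.
by rewrite /= lnK// posrE !mulr_gt0 ?powR_gt0.
Unshelve. all: by end_near. Qed.

(** With y_n the logarithm of the threshold, exp(-y_n) is exactly the inverse of the threshold, so n
    cancels; y_n^g against (ln n)^g tends to 1, and C cancels the constant of the tail. *)
Lemma tail_norming (U : T -> R) (C g z : R) : 0 < C -> gamma_tail P U C g -> 0 < z ->
  n%:R * tail P (fun w => expR (U w)) (C * n%:R * ln n%:R `^ g * z) @[n --> \oo]
    --> z^-1.
Proof.
move=> C0 UC z0.
pose y (n : nat) : R := ln (C * n%:R * ln n%:R `^ g * z).
have ratio : y n / ln n%:R @[n --> \oo] --> (1 : R) by exact: cvg_ln_norming_ratio.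
have yoo : y n @[n --> \oo] --> +oo by exact: cvg_ln_norming.
have h1 : tail P U (y n) / gdens g (y n) @[n --> \oo] --> C.
  exact: (cvg_comp _ _ yoo UC).
have h2 : (y n / ln n%:R) `^ g @[n --> \oo] --> (1 `^ g : R).
  have c1 : {for (1 : R), continuous (@powR R ^~ g)}.
    apply: differentiable_continuous; apply/derivable1_diffP.
    by have [] := @is_derive_powR R g 1 ltr01.
  exact: (cvg_comp _ _ ratio c1).
have : tail P U (y n) / gdens g (y n) * (y n / ln n%:R) `^ g * (C * z)^-1
    @[n --> \oo] --> C * 1 `^ g * (C * z)^-1.
  by apply: cvgM; [exact: cvgM|exact: cvg_cst].
rewrite powR1 mulr1 invfM mulrA divff ?gt_eqF// mul1r.
apply: cvg_trans; apply: near_eq_cvg; near=> n.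
have l0 : 0 < ln (n%:R : R) by near: n; exact: (@cvgry_gt _ _ \oo _ _ cvg_ln_nat 0).
have n0 : 0 < n%:R :> R by rewrite ltr0n; near: n; exists 1%N.
have y0 : 0 < y n by near: n; exact: (@cvgry_gt _ _ \oo _ _ yoo 0).
have a0 : 0 < C * n%:R * ln n%:R `^ g * z by rewrite !mulr_gt0 ?powR_gt0.
rewrite (tail_expR P U a0) -/(y n) /gdens expRN lnK ?posrE//.
rewrite powRM ?invr_ge0 ?(ltW y0) ?(ltW l0)//.
have -> : (ln n%:R)^-1 `^ g = (ln (n%:R : R) `^ g)^-1.
  by rewrite -powR_inv1 ?(ltW l0)// -powRrM mulN1r powRN.
by field; rewrite !gt_eqF// powR_gt0.
Unshelve. all: by end_near. Qed.

End normalization.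

(** * The stochastic volatility model *)

Section joint_family.
Context {d : measure_display} {T : measurableType d} {R : realType}.
Variable P : probability T R.

(** Indexing by the disjoint union lets facts about a single independent family apply to [eta] and
    [eps] jointly. *)
Definition sum_family {I J : Type} (X : I -> {RV P >-> R}) (Y : J -> {RV P >-> R})
  (k : I + J) : {RV P >-> R} := match k with inl i => X i | inr j => Y j end.

Lemma mutually_independent_sum (I J : choiceType)
    (X : I -> {RV P >-> R}) (Y : J -> {RV P >-> R}) :
  mutually_independent X -> mutually_independent Y -> independent_processes X Y ->
  mutually_independent (sum_family X Y).
Proof.
move=> Xi Yi XY F A mA.
pose FX := [fset i in pmap (fun k : I + J => if k is inl i then Some i else None) F]%fset.
pose FY := [fset j in pmap (fun k : I + J => if k is inr j then Some j else None) F]%fset.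
have FXE i : (i \in FX) = (inl i \in F).
  rewrite !inE /= mem_pmap; apply/mapP/idP => [[[k|k] kF] [] // ->//|iF].
  by exists (inl i).
have FYE j : (j \in FY) = (inr j \in F).
  rewrite !inE /= mem_pmap; apply/mapP/idP => [[[k|k] kF] [] // ->//|iF].
  by exists (inr j).
have mX : forall i, measurable (A (inl i)) by [].
have mY : forall j, measurable (A (inr j)) by [].
have gX : sigma_generated X (\bigcap_(i in [set` FX]) (X i @^-1` A (inl i))).
  apply: (@fin_bigcap_measurable _ (g_sigma_algebraType (gen X setT))) => // i _.
  by apply: sub_sigma_algebra; exists i => //; exists (A (inl i)) => //; rewrite setTI.
have gY : sigma_generated Y (\bigcap_(j in [set` FY]) (Y j @^-1` A (inr j))).
  apply: (@fin_bigcap_measurable _ (g_sigma_algebraType (gen Y setT))) => // i _.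
  by apply: sub_sigma_algebra; exists i => //; exists (A (inr i)) => //; rewrite setTI.
have -> : \bigcap_(k in [set` F]) (sum_family X Y k @^-1` A k) =
    (\bigcap_(i in [set` FX]) (X i @^-1` A (inl i))) `&`
    (\bigcap_(j in [set` FY]) (Y j @^-1` A (inr j))).
  apply/seteqP; split => w /=.
    by move=> h; split => i /=; rewrite ?FXE ?FYE => iF;
      [have := h (inl i) iF|have := h (inr i) iF].
  by move=> [h1 h2] [i|j] /= kF; [have := h1 i|have := h2 j]; rewrite /= ?FXE ?FYE; apply.
rewrite XY// (Xi FX (fun i => A (inl i)) mX) (Yi FY (fun j => A (inr j)) mY).
rewrite [RHS](big_fsetID _ (fun k => if k is inl _ then true else false)) /=.
congr (_ * _)%E.
- transitivity (\prod_(k <- (inl @` FX)%fset) P (sum_family X Y k @^-1` A k))%E.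
    by rewrite [RHS]big_imfset//= => i j _ _ [].
  apply: eq_fbigl => k; rewrite !inE /=; apply/imfsetP/andP.
    by move=> [i]; rewrite /= FXE => iF ->.
  by case: k => i [iF] // _; exists i => //; have : i \in FX by rewrite FXE.
- transitivity (\prod_(k <- (inr @` FY)%fset) P (sum_family X Y k @^-1` A k))%E.
    by rewrite [RHS]big_imfset//= => i j _ _ [].
  apply: eq_fbigl => k; rewrite !inE /=; apply/imfsetP/andP.
    by move=> [i]; rewrite /= FYE => iF ->.
  by case: k => i [iF] // _; exists i => //; have : i \in FY by rewrite FYE.
Qed.

Lemma measurable_coord (I : Type) (i : I) :
  measurable_fun setT (fun x : g_sigma_algebraType (@coords R I) => x i).
Proof.
by move=> _ A mA; apply: sub_sigma_algebra; exists i => //; exists A.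
Qed.

End joint_family.

Section volatility_model.
Context {d : measure_display} {T : measurableType d} {R : realType}.
Variable P : probability T R.
Variables (eps eta : int -> {RV P >-> R}) (alpha : nat -> R).

Definition logvol (t : int) (w : T) : R := pathseries alpha (fun n => eta (t - n%:Z) w).

Lemma measurable_logvol t : measurable_fun setT (logvol t).
Proof. by apply: measurable_pathseries => n; exact: measurable_funP. Qed.

Lemma measurable_vol t : measurable_fun setT (fun w => expR (logvol t w)).
Proof. by apply: measurableT_comp => //; exact: measurable_logvol. Qed.

Definition vol (t : int) : {RV P >-> R} := mfun_Sub (mem_set (measurable_vol t)).

Lemma measurable_vol_eps t : measurable_fun setT (fun w => vol t w * eps t w).
Proof. by apply: measurable_funM; exact: measurable_funP. Qed.

Definition ret (t : int) : {RV P >-> R} := mfun_Sub (mem_set (measurable_vol_eps t)).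

Lemma volE t w : vol t w = expR (logvol t w).
Proof. by []. Qed.

Lemma retE t w : ret t w = vol t w * eps t w.
Proof. by []. Qed.

Hypotheses (eps_iid : iid eps) (eta_iid : iid eta)
  (eta_eps : independent_processes eta eps).

(** Returns and volatilities at the given times are a fixed measurable function [f] of the joint
    path of [eta] and [eps]; shifting the times amounts to shifting the path, whose law is unchanged
    by [mutually_independent_law]. *)
Lemma ret_vol_stationary : stationary ret vol.
Proof.
move=> n t h B mB.
pose Z := sum_family eta eps.
pose shift (k : int + int) : int + int :=
  match k with inl i => inl (i + h) | inr i => inr (i + h) end.
have shift_inj : injective shift by move=> [i|i] [j|j] // [] /addIr ->.
have Zi : mutually_independent Z by exact: mutually_independent_sum eta_iid.2 eps_iid.2 eta_eps.
have Zsi : mutually_independent (Z \o shift) by exact: mutually_independent_inj.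
have ZE i A : measurable A -> P (Z i @^-1` A) = P ((Z \o shift) i @^-1` A).
  by case: i => i mA; [exact: eta_iid.1|exact: eps_iid.1].
pose vf t (x : int + int -> R) := expR (pathseries alpha (fun n => x (inl (t - n%:Z)))).
pose f (x : int + int -> R) : n.-tuple (R * R) :=
  [tuple (vf (t i) x * x (inr (t i)), vf (t i) x) | i < n].
have mvf s : measurable_fun setT (vf s : g_sigma_algebraType (@coords R (int + int)%type) -> R).
  apply: measurableT_comp => //.
  apply: (@measurable_pathseries _ _ (g_sigma_algebraType (@coords R (int + int)%type))) => m.
  exact: measurable_coord.
have mf : measurable_fun setT
    (f : g_sigma_algebraType (@coords R (int + int)%type) -> n.-tuple (R * R)).
  apply/measurable_fun_tnthP => i.
  rewrite (_ : _ \o _ = fun x => (vf (t i) x * x (inr (t i)), vf (t i) x)); last first.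
    by apply/funext => x /=; rewrite tnth_mktuple.
  apply: measurable_fun_pair => //; apply: measurable_funM => //.
  exact: measurable_coord.
have mS : <<s @coords R (int + int)%type >> (f @^-1` B).
  by rewrite -[X in <<s _ >> X]setTI; exact: mf.
have := mutually_independent_law Zi Zsi ZE mS.
have E s w : logvol (s + h) w = pathseries alpha (fun n => eta (s - n%:Z + h) w).
  by rewrite /logvol; congr pathseries; apply/funext => m; rewrite addrAC.
congr (_ = _); congr (P _); apply/seteqP; split => w /=;
  rewrite /f; congr (B _); apply: eq_mktuple => i /=; first [by rewrite E | by []].
Qed.

Lemma indep2_vol_eps t : indep2 P (vol t) (eps t).
Proof.
move=> A B mA mB; apply: eta_eps.
- have mv : measurable_fun setT (vol t : g_sigma_algebraType (gen eta setT) -> R).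
    apply: (@measurableT_comp _ _ _ (g_sigma_algebraType (gen eta setT)) _ _ expR _ (logvol t)) => //.
    apply: (@measurable_pathseries _ _ (g_sigma_algebraType (gen eta setT))) => n.
    exact: measurable_gen.
  by rewrite -[X in sigma_generated eta X]setTI; exact: mv.
- apply: sub_sigma_algebra; exists t => //; exists B => //.
  by rewrite setTI.
Qed.

Lemma iid_reindex (I : choiceType) (tau : I -> int) : injective tau -> iid (eta \o tau).
Proof.
move=> tau_inj; split; first by move=> i j A mA; exact: eta_iid.1.
exact: mutually_independent_inj eta_iid.2.
Qed.

(* The innovations entering [logvol 0] are [eta 0], [eta (-1)], ..., whereas
   [mgf_rest] is defined with [eta 0], [eta 1], ... *)
Lemma tail_logvol0 x :
  tail P (logvol 0) x = tail P (wseries (fun n : nat => eta n%:Z) alpha) x.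
Proof.
pose tau (n : nat) : int := 0 - n%:Z.
have tau_inj : injective tau by move=> m n /=; rewrite /tau !sub0r => /oppr_inj [].
have pos_inj : injective (fun n : nat => n%:Z) by move=> m n [].
have mp : measurable_fun setT
    (pathseries alpha : g_sigma_algebraType (@coords R nat) -> R).
  apply: (@measurable_pathseries _ _ (g_sigma_algebraType (@coords R nat)) alpha id).
  exact: measurable_coord.
have mS : <<s @coords R nat >> [set y | x < pathseries alpha y].
  exact: (measurable_gt x mp).
congr fine.
apply: (mutually_independent_law (iid_reindex tau_inj).2 (iid_reindex pos_inj).2 _ mS).
by move=> n A mA; exact: eta_iid.1.
Qed.

End volatility_model.

Lemma bigO_series_cvg (R : realType) (alpha : nat -> R) (theta : R) :
  (forall i, 0 <= alpha i <= 1) -> 1 < theta ->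
  alpha =O_\oo (fun i : nat => i%:R `^ (- theta)) -> cvgn (series alpha).
Proof.
move=> alpha01 theta1 /eqO_exP [k k0 [N _ hN]].
(* The second entry covers indices n from 1 to below [N], where alpha <= 1 <= N^theta n^(-theta).
   The bound starts at index 1 because 0 to the power - theta is 0 by convention and bounds
   nothing. *)
pose C := Num.max k (N%:R `^ theta).
have aC n : alpha n.+1 <= C * n.+1%:R `^ (- theta).
  have [nN|Nn] := ltnP n.+1 N; last first.
    have := hN _ Nn; rewrite ger0_norm ?(andP (alpha01 _)).1//.
    rewrite ger0_norm ?powR_ge0// => /le_trans; apply.
    by rewrite ler_wpM2r ?powR_ge0// le_max lexx.
  apply: (@le_trans _ _ 1); first by have /andP[] := alpha01 n.+1.
  rewrite powRN ler_pdivlMr ?powR_gt0// mul1r le_max; apply/orP; right.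
  apply: ge0_ler_powR; rewrite ?nnegrE ?ler_nat ?(ltnW nN)//.
  by rewrite ltW// (lt_trans _ theta1).
have cS : cvgn (series (fun n => alpha n.+1)).
  apply: (series_le_cvg _ _ aC) => [n|n|].
  - by have /andP[] := alpha01 n.+1.
  - by rewrite mulr_ge0 ?powR_ge0// le_max (ltW k0).
  - rewrite (_ : series _ = fun n =>
        C * series (fun i : nat => i.+1%:R `^ (- theta)) n); last first.
      by apply/funext => n; rewrite /series /= mulr_sumr.
    by apply/cvg_ex; eexists; apply: cvgMr; exact: (riemann_series_cvg theta1).
suff : cvgn (fun n => series alpha n.+1).
  by move/cvg_ex => [l]; rewrite (cvg_shiftS (series alpha)) => /cvgP.
rewrite (_ : (fun _ => _) = (fun n => alpha 0%N + series (fun n => alpha n.+1) n)).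
  by apply: is_cvgD => //; exact: is_cvg_cst.
by apply/funext => n; rewrite /series /= big_nat_recl.
Qed.

(** * Limits of powers of distribution functions *)

Section distribution_function.
Context {d : measure_display} {T : measurableType d} {R : realType}.
Variable P : probability T R.

Lemma distfunE (Z : T -> R) x : measurable_fun setT Z ->
  distfun P Z x = 1 - tail P Z x.
Proof.
move=> mZ; rewrite /distfun (_ : [set w | _] = ~` [set w | x < Z w]).
  rewrite probability_setC; last exact: measurable_gt.
  by rewrite -tailE//.
by apply/seteqP; split => w /=; rewrite ltNge; [move=> ->|move/negP; rewrite negbK].
Qed.

(** The normalization is worked out for [W] alone and a tail ratio carries it over to [Z], so one
    computation for the volatility also serves the returns. *)
Lemma distfun_max_limit (Z W : T -> R) (a : R^nat) (c m : R) :
  measurable_fun setT Z -> a n @[n --> \oo] --> +oo -> 0 < m ->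
  n%:R * tail P W (a n) @[n --> \oo] --> m ->
  tail P Z x / tail P W x @[x --> +oo] --> c ->
  distfun P Z (a n) ^+ n @[n --> \oo] --> expR (- (c * m)).
Proof.
move=> mZ aoo m0 Wm ZW.
have h : n%:R * tail P Z (a n) @[n --> \oo] --> c * m.
  have : (tail P Z (a n) / tail P W (a n)) * (n%:R * tail P W (a n)) @[n --> \oo]
      --> c * m.
    by apply: cvgM; [exact: (cvg_comp _ _ aoo ZW)|exact: Wm].
  apply: cvg_trans; apply: near_eq_cvg; near=> n.
  have Wn : 0 < n%:R * tail P W (a n) by near: n; exact: (cvgr_gt m).
  have W0 : tail P W (a n) != 0.
    by apply: contraTneq Wn => ->; rewrite mulr0 ltxx.
  by rewrite /=; field.
have := powR_limit h; apply: cvg_trans; apply: near_eq_cvg; apply: nearW => n.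
by rewrite distfunE.
Unshelve. all: by end_near. Qed.

End distribution_function.

(** * Tails of the volatility and of the returns *)

Section sv_model.
Context {d : measure_display} {T : measurableType d} {R : realType}.
Variable P : probability T R.
Variables (eps eta : int -> {RV P >-> R}) (alpha : nat -> R) (beta K delta : R).
Hypotheses (eta_iid : iid eta) (eta_eps : independent_processes eta eps)
  (alpha01 : forall n, 0 <= alpha n <= 1) (alpha_cvg : cvgn (series alpha))
  (alpha_max : exists n, alpha n = 1)
  (eta2 : (\int[P]_w (eta 0 w ^+ 2)%:E < +oo)%E)
  (K0 : 0 < K) (betaN1 : beta != -1) (eta_tail : gamma_tail P (eta 0) K beta)
  (delta0 : 0 < delta)
  (eps_moment : (\int[P]_w (`|eps 0 w| `^ (1 + delta))%:E < +oo)%E).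

Local Notation sig := (vol eta alpha).
Local Notation eta_nat := (fun n : nat => eta n%:Z).

Lemma eta_nat_iid : iid eta_nat.
Proof. by apply: (iid_reindex eta_iid (tau := fun n : nat => n%:Z)) => m n []. Qed.

Lemma ret_vol_solution : SV_solution alpha eps eta (ret eps eta alpha) sig.
Proof.
move=> t; pose tau (n : nat) : int := t - n%:Z.
have tau_inj : injective tau by move=> m n /addrI /oppr_inj [].
pose Y := eta \o tau.
have Y_iid : iid Y by exact: iid_reindex.
have Y2 : (\int[P]_w (Y 0%N w ^+ 2)%:E < +oo)%E.
  rewrite (identically_distributed_integral (Y := eta) (f := fun x => (x ^+ 2)%:E)
    _ 0 eta_iid.1)//; first by apply/measurable_EFinP; exact: measurable_funX.
  by move=> x; rewrite lee_fin sqr_ge0.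
have := wseries_abs_cvg Y_iid Y2 (fun n => (andP (alpha01 n)).1) alpha_cvg.
apply: filterS => w cv; split => //; first by rewrite volE expR_gt0.
rewrite volE expRK; apply: (@wsum_cvg _ _ _ _ Y alpha alpha w _ cv) => n.
by rewrite ger0_norm// (andP (alpha01 n)).1.
Qed.

Lemma mgf_restE : mgf_rest alpha eta = rest_mgf eta_nat alpha.
Proof.
have E w : (fun m => \sum_(0 <= n < m | n \notin Lambda alpha) alpha n * eta n%:Z w) =
    (fun m => wsum eta_nat (rest_coef alpha) m w).
  apply/funext => m; rewrite /wsum big_mkcond /=; apply: eq_bigr => n _.
  have -> : (n \in Lambda alpha) = (alpha n == 1) by apply/idP/eqP; rewrite inE.
  by rewrite /rest_coef; case: (alpha n == 1); rewrite /= ?mul0r.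
rewrite /mgf_rest /rest_mgf unlock; apply: (congr1 fine).
by apply: eq_integral => w _; rewrite E.
Qed.

Lemma KhatE : Khat alpha eta beta K =
  sum_scale eta_nat beta K (cardLambda alpha) * rest_mgf eta_nat alpha.
Proof. by rewrite /Khat /sum_scale mgf_restE unlock; case: ifP. Qed.

Lemma gamma_tail_logvol : 0 < Khat alpha eta beta K /\
  gamma_tail P (logvol eta alpha 0) (Khat alpha eta beta K) (betahat alpha beta).
Proof.
have [r0 tl] := log_volatility_tail eta_nat_iid eta2 K0 betaN1 eta_tail alpha01
  alpha_cvg alpha_max.
rewrite KhatE; split.
  rewrite mulr_gt0//; apply: (sum_scale_gt0 (Y := eta_nat) K0 betaN1 eta_tail).
  have [n an] := alpha_max; have [N hN] := alpha_small alpha01 alpha_cvg.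
  have fL : finite_set (Lambda alpha).
    apply: (@sub_finite_set _ _ `I_N); last exact: finite_II.
    move=> m /= am; rewrite ltnNge; apply/negP => /hN.
    by rewrite am leNgt invf_lt1// ltr1n.
  rewrite /cardLambda cardfs_gt0; apply/fset0Pn; exists n.
  by rewrite in_fset_set// inE.
by rewrite /gamma_tail; under eq_fun do rewrite (tail_logvol0 alpha eta_iid).
Qed.

Lemma vol_rv s : 0 < s ->
  tail P (sig 0) (s * x) / tail P (sig 0) x @[x --> +oo] --> s^-1.
Proof. by have [A0 A] := gamma_tail_logvol; exact: gamma_tail_rv A. Qed.

(** The absolute value, the positive part and the negative part of the noise are all of this form;
    being at most |x|, [h] inherits the moment of order 1 + delta. *)
Lemma ret_tail (h : R -> R) : measurable_fun setT h -> (forall x, 0 <= h x <= `|x|) ->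
  (\int[P]_w (h (eps 0 w))%:E < +oo)%E /\
  tail P (fun w => sig 0 w * h (eps 0 w)) x / tail P (sig 0) x @[x --> +oo] -->
    fine (\int[P]_w (h (eps 0 w))%:E).
Proof.
move=> mh h01.
have me : measurable_fun setT (fun w => h (eps 0 w)) by exact: measurableT_comp.
apply: (@breiman _ _ _ P (sig 0) _ (1 + delta)).
- exact: measurable_funP.
- exact: me.
- exact: (indep2_comp (f := id) (g := h) _ mh (indep2_vol_eps _ eta_eps 0)).
- by move=> w; have /andP[] := h01 (eps 0 w).
- by rewrite ltrDl.
- apply: le_lt_trans eps_moment; apply: ge0_le_integral => //.
  + by move=> w _; rewrite lee_fin powR_ge0.
  + by apply/measurable_EFinP; exact: (measurableT_comp (measurable_powR _)).
  + apply/measurable_EFinP; apply: (measurableT_comp (measurable_powR _)).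
    by apply: measurableT_comp => //; exact: measurable_funP.
  + move=> w _; rewrite lee_fin; have /andP[h0 h1] := h01 (eps 0 w).
    by apply: ge0_ler_powR; rewrite ?nnegrE// addr_ge0// ltW.
- exact: vol_rv.
Qed.

Lemma vol_max_limit (Z : T -> R) (c z : R) : measurable_fun setT Z -> 0 < z ->
  tail P Z x / tail P (sig 0) x @[x --> +oo] --> c ->
  distfun P Z (norming alpha eta beta K n * z) ^+ n @[n --> \oo] --> expR (- (c / z)).
Proof.
move=> mZ z0 Zc; have [A0 A] := gamma_tail_logvol.
apply: (distfun_max_limit (W := sig 0)) => //.
- exact: cvg_norming.
- by rewrite invr_gt0.
- exact: tail_norming.
Qed.

End sv_model.

Lemma measurable_posr (R : realType) : measurable_fun setT (fun x : R => Num.max x 0).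
Proof. exact: measurable_maxr. Qed.

Lemma measurable_negr (R : realType) : measurable_fun setT (fun x : R => - Num.min x 0).
Proof. by apply: measurableT_comp => //; exact: measurable_minr. Qed.

(** For a positive threshold the nonpositive values of the noise do not matter, so the tail of the
    return is that of the volatility times the positive part. *)
Lemma lt_mul_posr (R : realType) (s e x : R) : 0 < s -> 0 < x ->
  (x < s * Num.max e 0) = (x < s * e).
Proof.
move=> s0 x0; case: (leP e 0) => // e0.
have se : s * e <= 0 by rewrite mulr_ge0_le0// ltW.
by rewrite mulr0 !ltNge (ltW x0) (le_trans se (ltW x0)).
Qed.

Lemma lt_mul_negr (R : realType) (s e x : R) : 0 < s -> 0 < x ->
  (x < s * - Num.min e 0) = (s * e < - x).
Proof.
by move=> s0 x0; rewrite oppr_min oppr0 lt_mul_posr// mulrN ltrNr.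
Qed.

Theorem theorem3p2 (R : realType) (d : measure_display) (Omega : measurableType d)
    (P : probability Omega R) (eps eta : int -> {RV P >-> R})
    (alpha : nat -> R) (delta theta beta K : R)
    (eps_iid : iid eps)
    (eps_pos : (0 < P [set w | (0 < eps 0 w)%R])%E)
    (delta_gt0 : 0 < delta)
    (eps_moment : ('E_P[fun w => (`|eps 0 w| `^ (1 + delta))%R] < +oo)%E)
    (alpha_01 : forall i : nat, 0 <= alpha i <= 1)
    (alpha_max : exists i : nat, alpha i = 1)
    (theta_gt1 : 1 < theta)
    (alpha_bigO : alpha =O_\oo (fun i : nat => i%:R `^ (- theta)))
    (eta_iid : iid eta)
    (eta_eps_indep : independent_processes eta eps)
    (eta_moment : ('E_P[fun w => (eta 0 w ^+ 2)%R] < +oo)%E)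
    (beta_neqN1 : beta != -1)
    (K_gt0 : 0 < K)
    (eta_tail : tail P (eta 0) z / (K * z `^ beta * expR (- z))
                  @[z --> +oo] --> (1 : R)) :
  let absE := fine 'E_P[fun w => `|eps 0 w| ] in
  let posE := fine 'E_P[fun w => Num.max (eps 0 w) 0] in
  let negE := fine 'E_P[fun w => - Num.min (eps 0 w) 0] in
  let a := norming alpha eta beta K in
  exists X sigma : int -> {RV P >-> R},
    let absX0 := fun w : Omega => `|X 0 w| in
    [/\ SV_solution alpha eps eta X sigma,
        stationary X sigma,
        regularly_varying P absX0 (-1) &
        regularly_varying P (sigma 0) (-1)] /\
    [/\ tail P (X 0) x / tail P absX0 x @[x --> +oo] --> posE / absE,
        fine (P [set w | X 0 w < - x]) / tail P absX0 x
          @[x --> +oo] --> negE / absE,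
        tail P absX0 x / tail P (sigma 0) x @[x --> +oo] --> absE &
        tail P (X 0) x / tail P (sigma 0) x @[x --> +oo] --> posE] /\
    forall z : R, 0 < z ->
      [/\ distfun P (sigma 0) (a n * z) ^+ n @[n --> \oo] --> expR (- (1 / z)),
          distfun P absX0 (a n * z) ^+ n @[n --> \oo] --> expR (- (absE / z)) &
          distfun P (X 0) (a n * z) ^+ n @[n --> \oo] --> expR (- (posE / z))].
Proof.
have alpha_cvg := bigO_series_cvg alpha_01 theta_gt1 alpha_bigO.
(* [gdens] carries no constant, so [K] moves from the denominator into the limit. *)
have eta_gam : gamma_tail P (eta 0) K beta.
  rewrite /gamma_tail -[X in _ --> X]mul1r.
  have : tail P (eta 0) z / (K * z `^ beta * expR (- z)) * K @[z --> +oo] --> 1 * K.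
    by apply: cvgM; [exact: eta_tail|exact: cvg_cst].
  apply: cvg_trans; apply: near_eq_cvg; apply: nearW => z /=.
  rewrite /gdens -[_ * _ * expR _]mulrA invfM -mulrA [X in _ * X]mulrAC.
  by rewrite mulVf ?gt_eqF// mul1r.
move: eps_moment eta_moment; rewrite !unlock => eps_m eta_m absE posE negE a.
set sigma := vol eta alpha; set X := ret eps eta alpha.
have sgt0 w : 0 < sigma 0 w by rewrite volE expR_gt0.
have mX : measurable_fun setT (X 0) by exact: measurable_funP.
have meps : measurable_fun setT (eps 0) by exact: measurable_funP.
have mabsX : measurable_fun setT (fun w => `|X 0 w|) by exact: measurableT_comp.
have rt h := @ret_tail _ _ _ P eps eta alpha beta K delta eta_iid eta_eps_indep alpha_01
  alpha_cvg alpha_max eta_m K_gt0 beta_neqN1 eta_gam delta_gt0 eps_m h.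
have sig_rv := vol_rv eta_iid alpha_01 alpha_cvg alpha_max eta_m K_gt0 beta_neqN1 eta_gam.
have lim_max Z c z := @vol_max_limit _ _ _ P eta alpha beta K eta_iid alpha_01 alpha_cvg
  alpha_max eta_m K_gt0 beta_neqN1 eta_gam Z c z.
have abs01 (x : R) : 0 <= `|x| <= `|x| by rewrite normr_ge0 lexx.
have mabs : measurable_fun setT (fun x : R => `|x|) by exact: normr_measurable.
have [absfin abs_tail] := rt _ mabs abs01.
have pos01 (x : R) : 0 <= Num.max x 0 <= `|x|.
  by rewrite le_max lexx orbT /= ge_max normr_ge0 ler_norm.
have neg01 (x : R) : 0 <= - Num.min x 0 <= `|x|.
  by rewrite oppr_ge0 ge_min lexx orbT /= lerNl le_min lerNl -normrN ler_norm oppr_le0 normr_ge0.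
have [posfin pos_tail] := rt _ (@measurable_posr R) pos01.
have [_ neg_tail] := rt _ (@measurable_negr R) neg01.
(* The denominator of the balance ratios is positive because the noise is positive with positive
   probability. *)
have absE0 : 0 < absE.
  rewrite /absE fine_gt0// absfin andbT; apply: expectation_gt0 => //.
    exact: measurableT_comp.
  apply: (lt_le_trans eps_pos); apply: le_measure.
  - by rewrite inE; exact: measurable_gt.
  - by rewrite inE; apply: measurable_gt; exact: measurableT_comp.
  - by move=> w /= ew; rewrite normr_gt0 gt_eqF.
have abs_eq : (fun w => sigma 0 w * `|eps 0 w|) = (fun w => `|X 0 w|).
  by apply/funext => w; rewrite retE normrM (ger0_norm (ltW (sgt0 w))).
have absX_sig : tail P (fun w => `|X 0 w|) x / tail P (sigma 0) x @[x --> +oo] --> absE.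
  by move: abs_tail; rewrite abs_eq.
have X_sig : tail P (X 0) x / tail P (sigma 0) x @[x --> +oo] --> posE.
  apply: cvg_trans pos_tail; apply: near_eq_cvg; near=> x.
  have x0 : 0 < x by near: x; exact: nbhs_pinfty_gt.
  congr (_ / _); rewrite /tail; congr (fine (P _)).
  by apply/seteqP; split => w /=; rewrite lt_mul_posr ?expR_gt0.
have nX_sig : fine (P [set w | X 0 w < - x]) / tail P (sigma 0) x @[x --> +oo] --> negE.
  apply: cvg_trans neg_tail; apply: near_eq_cvg; near=> x.
  have x0 : 0 < x by near: x; exact: nbhs_pinfty_gt.
  congr (_ / _); rewrite /tail; congr (fine (P _)).
  by apply/seteqP; split => w /=; rewrite lt_mul_negr ?expR_gt0.
(* A ratio tending to 1 eventually has a nonzero denominator, a quotient by 0 being 0. *)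
have sig_near : \forall x \near +oo, 0 < tail P (sigma 0) x.
  have h := sig_rv 1 ltr01; rewrite invr1 in h.
  near=> x; rewrite lt_neqAle tail_ge0 andbT eq_sym.
  have : 0 < tail P (sigma 0) (1 * x) / tail P (sigma 0) x.
    by near: x; exact: (cvgr_gt 1).
  by apply: contraTneq => ->; rewrite invr0 mulr0 ltxx.
(* Every tail is compared with that of [sigma 0]; the ratio of two of them follows by cancelling
   it. *)
have ratio (f g : R -> R) (l m : R) : m != 0 ->
    f x / tail P (sigma 0) x @[x --> +oo] --> l ->
    g x / tail P (sigma 0) x @[x --> +oo] --> m ->
    f x / g x @[x --> +oo] --> l / m.
  move=> m0 fl gm; have h : f x / tail P (sigma 0) x * (g x / tail P (sigma 0) x)^-1
      @[x --> +oo] --> l / m by apply: cvgM; [exact: fl|exact: cvgV].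
  apply: cvg_trans h; apply: near_eq_cvg; near=> x.
  have s0 : 0 < tail P (sigma 0) x by near: x.
  by rewrite /= invfM invrK mulrACA [X in _ * X]mulVf ?mulr1// gt_eqF.
exists X, sigma => absX0; split; [split|split].
- exact: ret_vol_solution.
- exact: ret_vol_stationary.
- split; first by apply: aeW => w; exact: normr_ge0.
  move=> s s0; rewrite powR_inv1 ?(ltW s0)//.
  have h : tail P absX0 (s * x) / tail P (sigma 0) x @[x --> +oo] --> absE * s^-1.
    have sx : s * x @[x --> +oo] --> (+oo : set_system R).
      apply/cvgryPge => A; apply: filterS (nbhs_pinfty_ge (num_real (A / s))) => x.
      by rewrite ler_pdivrMr// mulrC.
    have : tail P absX0 (s * x) / tail P (sigma 0) (s * x) *
        (tail P (sigma 0) (s * x) / tail P (sigma 0) x) @[x --> +oo] --> absE * s^-1.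
      by apply: cvgM; [exact: (cvg_comp _ _ sx absX_sig)|exact: sig_rv].
    have ssig : \forall x \near +oo, 0 < tail P (sigma 0) (s * x) by exact: sx sig_near.
    apply: cvg_trans; apply: near_eq_cvg; apply: filterS ssig => x sx0.
    by rewrite /= mulrA divfK// gt_eqF.
  have := ratio _ _ _ _ (lt0r_neq0 absE0) h absX_sig.
  by rewrite mulrAC mulfV ?mul1r// gt_eqF.
- split; first by apply: aeW => w; exact: ltW.
  by move=> s s0; rewrite powR_inv1 ?(ltW s0)//; exact: sig_rv.
- split.
  + exact: (ratio _ _ _ _ (lt0r_neq0 absE0) X_sig absX_sig).
  + exact: (ratio _ _ _ _ (lt0r_neq0 absE0) nX_sig absX_sig).
  + exact: absX_sig.
  + exact: X_sig.
- move=> z z0; split.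
  + apply: lim_max => //.
    (* The volatility compared with itself has a ratio tending to 1, which is regular variation at s
       = 1. *)
    by have := sig_rv 1 ltr01; rewrite invr1; under eq_fun do rewrite mul1r.
  + exact: lim_max.
  + exact: lim_max.
Unshelve. all: by end_near. Qed.
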